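(* On $F(5)=\mathrm{SU}(5)/T^4$ consider the invariant metrics, in the order $(x_{12},x_{13},x_{14},x_{15},x_{23},x_{24},x_{25},x_{34},x_{35},x_{45})$, $$g_i=(2C_i,2C_i,2C_i,2C_i,X_i,Y_i,X_i,X_i,Y_i,X_i),\qquad i=1,2,$$ where $C_1>C_2$ are the only two positive real roots of $P(x)=27x^4-270x^3+1008x^2-1700x+1129$ and $$X_i=-\tfrac{10}{3}C_i^3+\tfrac{250}{9}C_i^2-\tfrac{2110}{27}C_i+\tfrac{2258}{27},\qquad Y_i=\tfrac{20}{3}C_i^3-\tfrac{536}{9}C_i^2+\tfrac{4760}{27}C_i-\tfrac{4516}{27}$$ (numerically $(2C_1,X_1,Y_1)\approx(6.9152,7.7224,5.8870)$ and $(2C_2,X_2,Y_2)\approx(5.8586,9.2800,5.7028)$). Then $g_1$ and $g_2$ are both Einstein with Einstein constant $\rho=\tfrac1{10}$ (where $\mathrm{Rc}(g_i)=\rho g_i$), and they are $G$-non-degenerate and $G$-unstable with coindex $6$ and $5$, respectively.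
   Context: $F(n)=\mathrm{SU}(n)/T^{n-1}$, where $T=T^{n-1}$ is the diagonal maximal torus with Lie algebra $\mathfrak{t}$; $G=\mathrm{SU}(n)$. Let $Q=-B$ be minus the Killing form of $\mathfrak{su}(n)$. There is a $Q$-orthogonal decomposition $\mathfrak{su}(n)=\mathfrak{t}\oplus\bigoplus_{1\le i<j\le n}\mathfrak{p}_{ij}$, where $\mathfrak{p}_{ij}$ is the 2-dimensional space of skew-Hermitian matrices whose only nonzero entries are in positions $(i,j)$ and $(j,i)$; the $\mathfrak{p}_{ij}$ are irreducible and pairwise inequivalent under $\mathrm{Ad}(T)$. Hence every $G$-invariant metric on $F(n)$ is determined by $g=\sum_{i<j}x_{ij}\,Q|_{\mathfrak{p}_{ij}}$ on $\mathfrak{p}=\bigoplus\mathfrak{p}_{ij}\cong T_oF(n)$ with $x_{ij}>0$, and is denoted by the tuple $(x_{ij})$ in lexicographic order. Stability notions. Let $\mathcal M_1^G$ be the manifold of unit-volume $G$-invariant metrics. A metric $g\in\mathcal M_1^G$ is Einstein ($\mathrm{Rc}(g)=\rho g$) iff it is a critical point of the scalar curvature functional $\mathrm{Sc}:\mathcal M_1^G\to\mathbb R$. Let $\mathrm{Sc}''_g$ be the Hessian at such $g$, restricted to the space $\mathcal{TT}_g^G$ of $G$-invariant traceless divergence-free symmetric 2-tensors (here equal to $T_g\mathcal M_1^G$, the $G$-invariant $g$-traceless symmetric 2-tensors). The Einstein metric $g$ is $G$-unstable if $\mathrm{Sc}''_g(T,T)>0$ for some $T\in\mathcal{TT}_g^G$,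 and $G$-non-degenerate if $\mathrm{Sc}''_g|_{\mathcal{TT}_g^G}$ is non-degenerate; its coindex is the maximal dimension of a subspace of $\mathcal{TT}_g^G$ on which $\mathrm{Sc}''_g$ is positive definite. For Einstein metrics not of unit volume, these notions refer to the unit-volume rescaling.
   Formalization: With Q = -B the metrics g_1, g_2 have Einstein constant 1/20, not 1/10 as stated; the formal theorem asserts Rc(g_i) = (1/20) g_i, and constant 1/10 for the rescaled metrics g_i/2; all other claims are kept. *)

(* Defs.v *)
From HB Require Import structures.
From mathcomp Require Import all_boot all_order all_algebra.
From mathcomp Require Import all_classical all_reals all_analysis.
From mathcomp Require Import complex.

Set Implicit Arguments.
Unset Strict Implicit.
Unset Printing Implicit Defensive.

Import Order.TTheory GRing.Theory Num.Theory.
Import numFieldNormedType.Exports.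

Local Open Scope ring_scope.
Local Open Scope complex_scope.

(* Invariant Riemannian geometry of F(n) = SU(n)/T is expressed on the tangent
   space at the base point, p = (+)_{i<j} p_ij: a G-invariant tensor on F(n) is
   an Ad(T)-invariant tensor on p.  The real vector space p (skew-Hermitian
   matrices with zero diagonal) is coordinatized by the basis
     E_ij - E_ji,  i(E_ij + E_ji)      (i < j),
   so that a tangent vector is a row vector and a symmetric 2-tensor is its
   Gram matrix in this basis. *)

Definition lieb (R : realType) (n : nat) (X Y : 'M[R[i]]_n) : 'M[R[i]]_n :=
  X *m Y - Y *m X.

Definition pidx (n : nat) : finType :=
  {a : 'I_n * 'I_n * bool | (a.1.1 < a.1.2)%N}.

(* dim_R F(n) = n(n-1) *)
Definition dimF (n : nat) : nat := #|pidx n|.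

Definition pvec (R : realType) (n : nat) (a : pidx n) : 'M[R[i]]_n :=
  let: (i, j, b) := val a in
  if b then (0 +i* 1) *: (delta_mx i j + delta_mx j i)
  else delta_mx i j - delta_mx j i.

Definition pentry (R : realType) (n : nat) (X : 'M[R[i]]_n) (a : pidx n) : R :=
  let: (i, j, b) := val a in if b then complex.Im (X i j) else complex.Re (X i j).

Definition p_mx (R : realType) (n : nat) (v : 'rV[R]_(dimF n)) : 'M[R[i]]_n :=
  \sum_(a < dimF n) (v 0 a)%:C *: pvec R (enum_val a).

(* On su(n), p_coord is the projection onto p along t, in coordinates. *)
Definition p_coord (R : realType) (n : nat) (X : 'M[R[i]]_n) : 'rV[R]_(dimF n) :=
  \row_a pentry X (enum_val a).

(* Real coordinates on su(n): the basis of p above, followed by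
   i(E_kk - E_{k+1,k+1}) for the Lie algebra t of the maximal torus.  The
   coefficient of X along the latter is Im (X_00 + ... + X_kk). *)
Definition suidx (n : nat) : finType := (pidx n + 'I_n.-1)%type.

Definition tvec (R : realType) (n : nat) (k : 'I_n.-1) : 'M[R[i]]_n :=
  (0 +i* 1) *: diag_mx (\row_(l < n) ((l == k :> nat)%:R - (l == k.+1 :> nat)%:R)).

Definition tentry (R : realType) (n : nat) (X : 'M[R[i]]_n) (k : 'I_n.-1) : R :=
  complex.Im (\sum_(l < n | (l <= k)%N) X l l).

Definition su_mx (R : realType) (n : nat) (v : 'rV[R]_#|suidx n|) : 'M[R[i]]_n :=
  \sum_(a < #|suidx n|)
    (v 0 a)%:C *: match (enum_val a : pidx n + 'I_n.-1) with
                  | inl c => pvec R c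
                  | inr k => tvec R k
                  end.

Definition su_coord (R : realType) (n : nat) (X : 'M[R[i]]_n) : 'rV[R]_#|suidx n| :=
  \row_a match (enum_val a : pidx n + 'I_n.-1) with
         | inl c => pentry X c
         | inr k => tentry X k
         end.

(* The Killing form B(X, Y) = tr (ad X o ad Y) of su(n). *)
Definition killing (R : realType) (n : nat) (X Y : 'M[R[i]]_n) : R :=
  \tr (lin1_mx (fun v : 'rV[R]_#|suidx n| =>
                  su_coord (lieb X (lieb Y (su_mx v))))).

Definition Qform (R : realType) (n : nat) (X Y : 'M[R[i]]_n) : R := - killing X Y.

Definition proj_pij (R : realType) (n : nat) (i j : 'I_n) (X : 'M[R[i]]_n)
    : 'M[R[i]]_n :=
  \matrix_(k, l)
    if ((k == i) && (l == j)) || ((k == j) && (l == i)) then X k l else 0.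

(* sum_{i<j} x_ij Q|p_ij *)
Definition diag_tensor (R : realType) (n : nat) (x : 'I_n -> 'I_n -> R)
    : 'M[R]_(dimF n) :=
  \matrix_(a, b) \sum_(i < n) \sum_(j < n | (i < j)%N)
    x i j * Qform (proj_pij i j (pvec R (enum_val a)))
                  (proj_pij i j (pvec R (enum_val b))).

Definition lex_pairs (n : nat) : seq (nat * nat) :=
  [seq (i, j) | i <- iota 0 n, j <- iota i.+1 (n - i.+1)].

Definition lex_tensor (R : realType) (n : nat) (s : seq R) : 'M[R]_(dimF n) :=
  diag_tensor (fun i j : 'I_n => s`_(index (val i, val j) (lex_pairs n))).

Definition in_torus (R : realType) (n : nat) (t : 'M[R[i]]_n) : Prop :=
  [/\ is_diag_mx t, t *m (map_mx Num.conj t)^T = 1%:M & \det t = 1].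

Definition Ad_p (R : realType) (n : nat) (t : 'M[R[i]]_n) (v : 'rV[R]_(dimF n))
    : 'rV[R]_(dimF n) :=
  p_coord (t *m p_mx v *m invmx t).

Definition tens (R : realType) (N : nat) (h : 'M[R]_N) (u v : 'rV[R]_N) : R :=
  (u *m h *m v^T) 0 0.

Definition invariant_tensor (R : realType) (n : nat) (h : 'M[R]_(dimF n)) : Prop :=
  h^T = h /\
  forall t : 'M[R[i]]_n, in_torus t ->
    forall u v, tens h (Ad_p t u) (Ad_p t v) = tens h u v.

Definition invariant_metric (R : realType) (n : nat) (g : 'M[R]_(dimF n)) : Prop :=
  invariant_tensor g /\ forall v : 'rV[R]_(dimF n), v != 0 -> 0 < tens g v v.

Definition brp (R : realType) (n : nat) (u v : 'rV[R]_(dimF n)) : 'rV[R]_(dimF n) :=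
  p_coord (lieb (p_mx u) (p_mx v)).

(* [[u, v]_t, w] *)
Definition brt (R : realType) (n : nat) (u v w : 'rV[R]_(dimF n))
    : 'rV[R]_(dimF n) :=
  let X := lieb (p_mx u) (p_mx v) in
  p_coord (lieb (diag_mx (\row_k X k k)) (p_mx w)).

(* The symmetric part U of the Levi-Civita connection, determined by
   2 g(U(u, v), z) = g([z, u]_p, v) + g(u, [z, v]_p) for all z in p. *)
Definition Upart (R : realType) (n : nat) (g : 'M[R]_(dimF n))
    (u v : 'rV[R]_(dimF n)) : 'rV[R]_(dimF n) :=
  (\row_a ((tens g (brp (delta_mx 0 a) u) v + tens g u (brp (delta_mx 0 a) v)) / 2))
    *m invmx g.

(* Levi-Civita connection of g as a bilinear map on p, and its curvature
   R(u, v) = [L_u, L_v] - L_{[u,v]_p} - ad [u,v]_t  (Nomizu). *)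
Definition levi_civita (R : realType) (n : nat) (g : 'M[R]_(dimF n))
    (u v : 'rV[R]_(dimF n)) : 'rV[R]_(dimF n) :=
  2^-1 *: brp u v + Upart g u v.

Definition curvature (R : realType) (n : nat) (g : 'M[R]_(dimF n))
    (u v w : 'rV[R]_(dimF n)) : 'rV[R]_(dimF n) :=
  levi_civita g u (levi_civita g v w) - levi_civita g v (levi_civita g u w)
  - levi_civita g (brp u v) w - brt u v w.

(* Rc(u, v) = tr (z |-> R(z, u) v) *)
Definition ricci (R : realType) (n : nat) (g : 'M[R]_(dimF n)) : 'M[R]_(dimF n) :=
  \matrix_(a, b)
    \tr (lin1_mx (fun z => curvature g z (delta_mx 0 a) (delta_mx 0 b))).

Definition tr_wrt (R : realType) (N : nat) (g h : 'M[R]_N) : R := \tr (h *m invmx g).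

Definition scalar_curvature (R : realType) (n : nat) (g : 'M[R]_(dimF n)) : R :=
  tr_wrt g (ricci g).

Definition einstein (R : realType) (n : nat) (rho : R) (g : 'M[R]_(dimF n)) : Prop :=
  ricci g = rho *: g.

(* Riemannian volume of (F(n), g), where v0 is the volume of F(n) for the
   metric induced by Q. *)
Definition volume (R : realType) (n : nat) (v0 : R) (g : 'M[R]_(dimF n)) : R :=
  v0 * Num.sqrt (\det g / \det (diag_tensor (fun _ _ : 'I_n => (1 : R)))).

Definition unit_volume (R : realType) (n : nat) (v0 : R) (g : 'M[R]_(dimF n))
    : 'M[R]_(dimF n) :=
  (volume v0 g `^ (- (2 / (dimF n)%:R))) *: g.

(* T_g M_1^G: the G-invariant g-traceless symmetric 2-tensors, all of which are
   divergence-free. *)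
Definition TT (R : realType) (n : nat) (g T : 'M[R]_(dimF n)) : Prop :=
  invariant_tensor T /\ tr_wrt g T = 0.

(* At a critical point g of the scalar curvature on the unit-volume metrics, the
   Hessian at (S, T) is the mixed derivative along any 2-parameter variation of
   g through unit-volume metrics with initial velocities S and T. *)
Definition hess_sc (R : realType) (n : nat) (v0 : R) (g S T : 'M[R]_(dimF n)) : R :=
  derive1 (fun s : R => derive1 (fun t : R =>
    scalar_curvature (unit_volume v0 (g + s *: S + t *: T))) 0) 0.

Definition G_unstable (R : realType) (n : nat) (v0 : R) (g : 'M[R]_(dimF n)) : Prop :=
  let g1 := unit_volume v0 g in
  exists2 T, TT g1 T & 0 < hess_sc v0 g1 T T.

Definition G_nondegenerate (R : realType) (n : nat) (v0 : R) (g : 'M[R]_(dimF n))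
    : Prop :=
  let g1 := unit_volume v0 g in
  forall S, TT g1 S -> (forall T, TT g1 T -> hess_sc v0 g1 S T = 0) -> S = 0.

Definition positive_on (R : realType) (n : nat) (v0 : R) (g : 'M[R]_(dimF n))
    (V : {vspace 'M[R]_(dimF n)}) : Prop :=
  (forall T, T \in V -> TT g T) /\
  (forall T, T \in V -> T != 0 -> 0 < hess_sc v0 g T T).

Definition G_coindex (R : realType) (n : nat) (v0 : R) (g : 'M[R]_(dimF n))
    (k : nat) : Prop :=
  let g1 := unit_volume v0 g in
  (exists2 V, positive_on v0 g1 V & \dim V = k) /\
  (forall V, positive_on v0 g1 V -> (\dim V <= k)%N).

Definition Ppoly (R : realType) : {poly R} :=
  27%:P * 'X^4 - 270%:P * 'X^3 + 1008%:P * 'X^2 - 1700%:P * 'X + 1129%:P.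

Definition Xc (R : realType) (C : R) : R :=
  - (10 / 3) * C ^+ 3 + 250 / 9 * C ^+ 2 - 2110 / 27 * C + 2258 / 27.

Definition Yc (R : realType) (C : R) : R :=
  20 / 3 * C ^+ 3 - 536 / 9 * C ^+ 2 + 4760 / 27 * C - 4516 / 27.

Definition gC (R : realType) (C : R) : 'M[R]_(dimF 5) :=
  let X := Xc C in let Y := Yc C in
  lex_tensor 5 [:: 2 * C; 2 * C; 2 * C; 2 * C; X; Y; X; X; Y; X].

Definition decimal (R : realType) (ds : seq nat) : R :=
  \sum_(k < size ds) (nth 0%N ds k)%:R / 10 ^+ k.

(* Agreement up to rounding in the fourth decimal. *)
Definition approx4 (R : realType) (x : R) (ds : seq nat) : Prop :=
  `|x - decimal R ds| <= 1 / (2 * 10 ^+ 4).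

(* Main.v *)
(* For n >= 5 the invariant symmetric 2-tensors are exactly the diagonal ones,
   and the Ricci tensor of the diagonal metric with eigenvalues y_ij is diagonal
   with entries 2n - sum_j (y_ij^2 + y_kj^2 - y_ik^2) / (y_ij y_kj).  For the
   weights (a, a, a, a, X, Y, X, X, Y, X) the Einstein equations reduce to three
   rational equations, which follow from P(C) = 0.  Along variations
   y_ij (1 + u_ij) with sum u_ij = 0 the Hessian of the scalar curvature is a
   positive multiple of an explicit quadratic form in u.  The weights are
   invariant under the symmetries of the 4-cycle through the last four indices,
   so that this form splits into blocks of size at most 2, whose signs are read
   off decimal enclosures of C, X and Y. *)
Require Import Defs.
From HB Require Import structures.
From mathcomp Require Import all_boot all_order all_algebra.
From mathcomp Require Import all_classical all_reals all_analysis.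
From mathcomp Require Import complex ring lra.
Import Order.TTheory GRing.Theory Num.Theory.
Import numFieldNormedType.Exports.
Local Open Scope ring_scope.

Local Open Scope complex_scope.
Set Implicit Arguments.
Unset Strict Implicit.
Unset Printing Implicit Defensive.

(** * The isotropy representation in coordinates *)

(** The signature is certified without eigenvalues. The nine traceless directions are split into a
    family of dimension k on which the form is positive and a complementary one on which it is
    negative; the first bounds the coindex from below, the second from above, and together they
    exclude a kernel. Only one block tells the two metrics apart: the form on the fully symmetric
    directions is positive definite at C1 and indefinite at C2. In both cases the block [a] gives
    two positive directions, [b] a negative one, and each of the two equal blocks of the
    two-dimensional representation one of each sign, whence 2 + 2 + 2 = 6 and 1 + 2 + 2 = 5. Two
    obstacles shape the rest. Ricci curvature is a trace over the real space [p], so connection and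
    curvature are rewritten as complex-linear operations on matrices and the trace is taken on
    matrix units. The Hessian is an iterated derivative through volume-normalized metrics, whose
    closed form is available only for positive weights, so it is computed by a calculus of
    second-order data valid near the origin. *)

Section RealPart.
Variable R : realType.
Implicit Types (z w : R[i]) (r s : R).

Local Notation Re := (@complex.Re R).
Local Notation Im := (@complex.Im R).

Lemma Re_sum (I : Type) (s : seq I) (P : pred I) (F : I -> R[i]) :
  Re (\sum_(i <- s | P i) F i) = \sum_(i <- s | P i) Re (F i).
Proof. exact: (raddf_sum (@complex.Re R : Rcomplex R -> R)). Qed.

Lemma Im_sum (I : Type) (s : seq I) (P : pred I) (F : I -> R[i]) :
  Im (\sum_(i <- s | P i) F i) = \sum_(i <- s | P i) Im (F i).
Proof. exact: (raddf_sum (@complex.Im R : Rcomplex R -> R)). Qed.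

Lemma ReD z w : Re (z + w) = Re z + Re w. Proof. by case: z; case: w. Qed.
Lemma ImD z w : Im (z + w) = Im z + Im w. Proof. by case: z; case: w. Qed.
Lemma ReN z : Re (- z) = - Re z. Proof. by case: z. Qed.
Lemma ImN z : Im (- z) = - Im z. Proof. by case: z. Qed.
Lemma Re_real r z : Re (r%:C * z) = r * Re z.
Proof. by case: z => a b /=; rewrite mul0r subr0. Qed.
Lemma Im_real r z : Im (r%:C * z) = r * Im z.
Proof. by case: z => a b /=; rewrite mul0r addr0. Qed.
Lemma Re_i z : Re ('i%C * z) = - Im z.
Proof. by case: z => a b /=; rewrite mul0r mul1r sub0r. Qed.
Lemma Im_i z : Im ('i%C * z) = Re z.
Proof. by case: z => a b /=; rewrite mul0r mul1r add0r. Qed.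
Lemma ReM z w : Re (z * w) = Re z * Re w - Im z * Im w.
Proof. by case: z; case: w. Qed.
Lemma ImM z w : Im (z * w) = Re z * Im w + Im z * Re w.
Proof. by case: z; case: w. Qed.
Lemma Re_conj z : Re (conjc z) = Re z. Proof. by case: z. Qed.
Lemma Im_conj z : Im (conjc z) = - Im z. Proof. by case: z. Qed.
Lemma Re0 : Re 0 = 0. Proof. by []. Qed.
Lemma Im0 : Im 0 = 0. Proof. by []. Qed.
Lemma Re1 : Re 1 = 1. Proof. by []. Qed.
Lemma Im1 : Im 1 = 0. Proof. by []. Qed.
Lemma ReC r : Re (r%:C) = r. Proof. by []. Qed.
Lemma ImC r : Im (r%:C) = 0. Proof. by []. Qed.
Lemma Re_nat (n : nat) : Re n%:R = n%:R.
Proof. by rewrite -(rmorph_nat (real_complex R)). Qed.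
Lemma Im_nat (n : nat) : Im n%:R = 0.
Proof. by rewrite -(rmorph_nat (real_complex R)). Qed.

Lemma conjD z w : conjc (z + w) = conjc z + conjc w. Proof. exact: rmorphD. Qed.
Lemma conj0 : conjc (0 : R[i]) = 0. Proof. by rewrite /= oppr0. Qed.
Lemma conjN z : conjc (- z) = - conjc z. Proof. exact: rmorphN. Qed.
Lemma conjM z w : conjc (z * w) = conjc z * conjc w. Proof. exact: rmorphM. Qed.
Lemma conj_sum (I : Type) (s : seq I) (P : pred I) (F : I -> R[i]) :
  conjc (\sum_(i <- s | P i) F i) = \sum_(i <- s | P i) conjc (F i).
Proof. exact: rmorph_sum. Qed.
Lemma conj_real r : conjc (r%:C) = r%:C :> R[i]. Proof. exact: conjc_real. Qed.

Lemma realCD r s : (r + s)%:C = r%:C + s%:C. Proof. exact: rmorphD. Qed.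
Lemma realCN r : (- r)%:C = - r%:C. Proof. exact: rmorphN. Qed.
Lemma realCM r s : (r * s)%:C = r%:C * s%:C. Proof. exact: rmorphM. Qed.

Lemma complexP z w : Re z = Re w -> Im z = Im w -> z = w.
Proof. by case: z => a b; case: w => c d /= -> ->. Qed.

Definition ReImE := (ReD, ImD, ReN, ImN, ReC, ImC, Re0, Im0, Re1, Im1, Re_nat, Im_nat).

End RealPart.

Section Coordinates.
Variables (R : realType) (n : nat).
Local Notation C := R[i].
Local Notation Re := (@complex.Re R).
Local Notation Im := (@complex.Im R).
Implicit Types (X Y Z : 'M[C]_n) (u v : 'rV[R]_(dimF n)) (c d : pidx n).

Lemma sum_dimF (V : nmodType) (F : pidx n -> V) :
  \sum_(a < dimF n) F (enum_val a) = \sum_c F c.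
Proof. by rewrite -(big_enum_val F). Qed.

Lemma sum_pidx (V : nmodType) (F : 'I_n * 'I_n * bool -> V) :
  \sum_(c : pidx n) F (val c) =
  \sum_(i < n) \sum_(j < n | (i < j)%N) (F (i, j, true) + F (i, j, false)).
Proof.
transitivity (\sum_(a : 'I_n * 'I_n * bool | (a.1.1 < a.1.2)%N) F a).
  by rewrite -[LHS](big_sub (fun a : 'I_n * 'I_n * bool => (a.1.1 < a.1.2)%N)).
rewrite pair_big_dep /=.
under [RHS]eq_bigr => p _ do rewrite -(big_bool _ (fun b => F (p.1, p.2, b))).
rewrite (pair_big_dep (fun p : 'I_n * 'I_n => (p.1 < p.2)%N) (fun _ _ => true)
           (fun p b => F (p.1, p.2, b))) /=.
by apply: eq_big => [[[i j] b]|[[i j] b] _] //=; rewrite andbT.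
Qed.

Lemma sum_ord_ltn_sym (V : nmodType) (f : 'I_n -> 'I_n -> V) :
  \sum_(i < n) \sum_(j < n | (i < j)%N) (f i j + f j i) =
  \sum_(i < n) \sum_(j < n | j != i) f i j.
Proof.
under eq_bigr do rewrite big_split.
rewrite big_split /= [X in _ + X](exchange_big_dep predT) //= -big_split /=.
apply: eq_bigr => i _; rewrite [RHS](bigID (fun j : 'I_n => (i < j)%N)) /=.
congr (_ + _); apply: eq_bigl => j; rewrite -val_eqE /=; case: ltngtP => //.
Qed.

(** Trace zero is not imposed: the coordinates on [p] ignore the diagonal, so [su(n)] may be
    enlarged to [u(n)]. *)
Definition skewh X := forall i j, X j i = - conjc (X i j).
Definition offd X : 'M[C]_n := \matrix_(i, j) if i == j then 0 else X i j.

Lemma pentryE X c :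
  pentry X c = if (val c).2 then Im (X (val c).1.1 (val c).1.2)
               else Re (X (val c).1.1 (val c).1.2).
Proof. by rewrite /pentry; case: (val c) => [[i j] b]. Qed.

Lemma pvecE c k l :
  pvec R c k l =
  if (val c).2
  then 'i%C * (((k == (val c).1.1) && (l == (val c).1.2))%:R
          + ((k == (val c).1.2) && (l == (val c).1.1))%:R)
  else ((k == (val c).1.1) && (l == (val c).1.2))%:R
          - ((k == (val c).1.2) && (l == (val c).1.1))%:R.
Proof.
by rewrite /pvec; case: (val c) => [[i j] []] /=; rewrite !mxE.
Qed.

Lemma pidx_ltn c : ((val c).1.1 < (val c).1.2)%N. Proof. exact: (valP c). Qed.

Lemma pidx_neq c : (val c).1.1 != (val c).1.2.
Proof. by rewrite -val_eqE neq_ltn pidx_ltn. Qed.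

Lemma pvec_skewh c : skewh (pvec R c).
Proof.
move=> k l; rewrite !pvecE; case: ifP => _; apply: complexP;
  rewrite ?(ReN, ImN, Re_conj, Im_conj, Re_i, Im_i, ReD, ImD, Re_nat, Im_nat);
  rewrite ?(andbC (l == _)); ring.
Qed.

Lemma pvec_diag c k : pvec R c k k = 0.
Proof.
rewrite pvecE; have := pidx_neq c; case: (val c) => [[i j] b] /= ij.
have h1 : (k == i) && (k == j) = false.
  by apply/negP => /andP[/eqP -> /eqP e]; rewrite e eqxx in ij.
by rewrite (andbC (k == j)) h1 addr0 subr0 mulr0; case: b.
Qed.

Lemma pentry_pvec c d : pentry (pvec R c) d = (c == d)%:R.
Proof.
have hE : (c == d) = [&& (val d).1.1 == (val c).1.1, (val d).1.2 == (val c).1.2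
                       & (val c).2 == (val d).2].
  rewrite -(inj_eq val_inj) /=; case: (val c) => [[i j] b]; case: (val d) => [[k l] b'] /=.
  by rewrite [LHS]xpair_eqE [X in X && _]xpair_eqE (eq_sym i) (eq_sym j) andbA.
rewrite pentryE pvecE hE; have := pidx_ltn c; have := pidx_ltn d.
case: (val c) => [[i j] b]; case: (val d) => [[k l] b'] /= kl ij.
have -> : (k == j) && (l == i) = false.
  apply/negP => /andP[/eqP ekj /eqP eli]; subst k l.
  by move: (ltn_trans kl ij); rewrite ltnn.
case: b; case: b' => /=;
  rewrite ?(ReN, ImN, Re_i, Im_i, ReD, ImD, Re_nat, Im_nat) ?andbT ?andbF //=; ring.
Qed.

Fact pentry_is_additive (c : pidx n) : {morph (fun X : 'M[C]_n => pentry X c) : X Y / X + Y}.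
Proof. by move=> X Y; rewrite !pentryE !mxE; case: ifP => _; rewrite (ReD, ImD). Qed.

Lemma pentryN X c : pentry (- X) c = - pentry X c.
Proof. by rewrite !pentryE !mxE; case: ifP => _; rewrite (ReN, ImN). Qed.

Lemma pentryZ (r : R) X c : pentry (r%:C *: X) c = r * pentry X c.
Proof. by rewrite !pentryE !mxE; case: ifP => _; rewrite (Re_real, Im_real). Qed.

Lemma pentry0 c : pentry (0 : 'M[C]_n) c = 0.
Proof. by rewrite !pentryE !mxE; case: ifP. Qed.

Lemma p_coordE X a : p_coord X 0 a = pentry X (enum_val a).
Proof. by rewrite mxE. Qed.

Lemma p_coordD X Y : p_coord (X + Y) = p_coord X + p_coord Y.
Proof. by apply/rowP => a; rewrite !mxE pentry_is_additive. Qed.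

Lemma p_coordN X : p_coord (- X) = - p_coord X.
Proof. by apply/rowP => a; rewrite !mxE pentryN. Qed.

Lemma p_coordB X Y : p_coord (X - Y) = p_coord X - p_coord Y.
Proof. by rewrite p_coordD p_coordN. Qed.

Lemma p_coordZ (r : R) X : p_coord (r%:C *: X) = r *: p_coord X.
Proof. by apply/rowP => a; rewrite !mxE pentryZ. Qed.

Lemma p_coord_offd X : p_coord (offd X) = p_coord X.
Proof.
apply/rowP => a; rewrite !p_coordE !pentryE !mxE.
by have /negbTE -> := pidx_neq (enum_val a).
Qed.

Lemma p_mxK v : p_coord (p_mx v) = v.
Proof.
apply/rowP => a; rewrite p_coordE /p_mx.
rewrite (big_morph _ (pentry_is_additive (enum_val a)) (pentry0 _)).
rewrite (bigD1 a) //= pentryZ pentry_pvec eqxx mulr1 big1 ?addr0 // => b ba.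
by rewrite pentryZ pentry_pvec (inj_eq enum_val_inj) (negbTE ba) mulr0.
Qed.

Lemma p_mxE v k l : p_mx v k l = \sum_(a < dimF n) (v 0 a)%:C * pvec R (enum_val a) k l.
Proof. by rewrite /p_mx summxE; apply: eq_bigr => a _; rewrite !mxE. Qed.

Lemma p_mx_skewh v : skewh (p_mx v).
Proof.
move=> k l; rewrite !p_mxE conj_sum -sumrN; apply: eq_bigr => a _.
by rewrite conjM conj_real pvec_skewh mulrN.
Qed.

Lemma p_mx_diag v k : p_mx v k k = 0.
Proof. by rewrite p_mxE big1 // => a _; rewrite pvec_diag mulr0. Qed.

(** The coordinates are the entries above the diagonal, and skewness recovers those below it. *)
Lemma skewh_p_coord_inj X Y : skewh X -> skewh Y ->
  (forall k, X k k = Y k k) -> p_coord X = p_coord Y -> X = Y.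
Proof.
move=> sX sY dXY eXY; apply/matrixP.
have lt (i j : 'I_n) : (i < j)%N -> X i j = Y i j.
  move=> ij; have e b : pentry X (exist _ (i, j, b) ij : pidx n)
                      = pentry Y (exist _ (i, j, b) ij : pidx n).
    have := congr1 (fun v : 'rV[R]_(dimF n) => v 0 (enum_rank (exist _ (i, j, b) ij : pidx n))) eXY.
    by rewrite !p_coordE enum_rankK.
  by apply: complexP; [have := e false | have := e true]; rewrite !pentryE.
move=> i j; have [/lt // | ji | ij] := ltngtP i j.
- by rewrite sX sY lt.
- by have -> : i = j by apply/val_inj.
Qed.

Lemma offd_skewh X : skewh X -> skewh (offd X).
Proof.
move=> sX i j; rewrite !mxE eq_sym; case: ifP => // _.
by rewrite conj0 oppr0.
Qed.

Lemma p_coordK X : skewh X -> p_mx (p_coord X) = offd X.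
Proof.
move=> sX; apply: skewh_p_coord_inj.
- exact: p_mx_skewh.
- exact: offd_skewh.
- by move=> k; rewrite p_mx_diag mxE eqxx.
- by rewrite p_mxK p_coord_offd.
Qed.

Lemma lieb_skewh X Y : skewh X -> skewh Y -> skewh (lieb X Y).
Proof.
move=> sX sY i j; rewrite !mxE conjD conjN !conj_sum opprD opprK.
rewrite [RHS]addrC; congr (_ - _); apply: eq_bigr => k _.
  by rewrite conjM (sX k j) (sY i k) mulrNN mulrC.
by rewrite conjM (sY k j) (sX i k) mulrNN mulrC.
Qed.

End Coordinates.

(** * Traces and the Killing form *)

Section TraceForm.
Variables (R : realType) (n : nat).
Local Notation C := R[i].
Local Notation Re := (@complex.Re R).
Local Notation Im := (@complex.Im R).
Implicit Types (X Y Z M : 'M[C]_n) (u v : 'rV[R]_(dimF n)) (c d : pidx n).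

Lemma submxE X Y k l : (X - Y) k l = X k l - Y k l.
Proof. by rewrite !mxE. Qed.

Lemma mulmx_deltaE M (i j k l : 'I_n) : (M *m (delta_mx i j : 'M[C]_n)) k l = M k i *+ (l == j).
Proof.
rewrite mxE (bigD1 i) //= big1 ?addr0 => [|m mi].
  by rewrite mxE eqxx /= mulr_natr.
by rewrite mxE (negbTE mi) mulr0.
Qed.

Lemma delta_mulmxE M (i j k l : 'I_n) : ((delta_mx i j : 'M[C]_n) *m M) k l = M j l *+ (k == i).
Proof.
rewrite mxE (bigD1 j) //= big1 ?addr0 => [|m mj].
  by rewrite mxE eqxx andbT /= mulr_natl.
by rewrite mxE (negbTE mj) andbF mul0r.
Qed.

Lemma p_mx_delta (a : 'I_(dimF n)) : p_mx (delta_mx 0 a : 'rV[R]_(dimF n)) = pvec R (enum_val a).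
Proof.
apply/matrixP => k l; rewrite p_mxE (bigD1 a) //= big1 ?addr0 => [|b ba].
  by rewrite mxE !eqxx rmorph1 mul1r.
by rewrite mxE (negbTE ba) andbF rmorph0 mul0r.
Qed.

(** For each pair the two basis vectors contribute the [E_ij] term with the same sign and the [E_ji]
    term with opposite signs, so only the former survives, doubled. *)
Lemma sum_pentry (Phi : 'M[C]_n -> 'M[C]_n) :
  {morph Phi : X Y / X + Y} -> (forall z : C, {morph Phi : X / z *: X}) ->
  \sum_(c : pidx n) pentry (Phi (pvec R c)) c =
  \sum_(i < n) \sum_(j < n | (i < j)%N) 2 * Re (Phi (delta_mx i j) i j).
Proof.
move=> hD hZ.
pose F (p : 'I_n * 'I_n * bool) : R := let: (i, j, b) := p in
  if b then Im (Phi ('i%C *: (delta_mx i j + delta_mx j i)) i j)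
  else Re (Phi (delta_mx i j - delta_mx j i) i j).
rewrite (eq_bigr (fun c => F (val c))) => [|c _]; last first.
  by rewrite pentryE /pvec /F; case: (val c) => [[i j] []].
rewrite sum_pidx; apply: eq_bigr => i _; apply: eq_bigr => j _; rewrite /F.
rewrite -scaleN1r !hZ !hD !hZ scaleN1r !mxE Im_i !ReImE; ring.
Qed.

(* The trace of a complex-linear map restricted to the real form p can be taken
   over the matrix units, which need not lie in p. *)
Lemma mxtrace_p (Phi : 'M[C]_n -> 'M[C]_n) (f : 'rV[R]_(dimF n) -> 'rV[R]_(dimF n)) :
  {morph Phi : X Y / X + Y} -> (forall z : C, {morph Phi : X / z *: X}) ->
  (forall v, f v = p_coord (Phi (p_mx v))) ->
  \tr (lin1_mx f) =
  \sum_(i < n) \sum_(j < n | (i < j)%N) 2 * Re (Phi (delta_mx i j) i j).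
Proof.
move=> hD hZ hf; rewrite -sum_pentry // -sum_dimF /mxtrace.
by apply: eq_bigr => a _; rewrite mxE hf p_coordE p_mx_delta.
Qed.

Lemma ReM_conj (z w : C) : Re (conjc z * conjc w) = Re (z * w).
Proof. by rewrite -conjM Re_conj. Qed.

Lemma Re_mulmx_skewC X Y i : skewh X -> skewh Y ->
  Re ((X *m Y) i i) = Re ((Y *m X) i i).
Proof.
move=> sX sY; rewrite !mxE !Re_sum; apply: eq_bigr => k _.
by rewrite (sX k i) (sY i k) mulrNN ReM_conj mulrC.
Qed.

(** The basis of [p] is orthogonal for [Re tr], with all squares equal to -2. Coordinates can
    therefore be traded for traces, where cyclicity is available. *)
Lemma retr_pvec c M : skewh M -> Re (\tr (pvec R c *m M)) = - 2 * pentry M c.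
Proof.
move=> sM; rewrite pentryE /pvec; case: (val c) => [[i j] b] /=.
have tr (i' j' : 'I_n) : \tr ((delta_mx i' j' : 'M[C]_n) *m M) = M j' i'.
  rewrite /mxtrace (bigD1 i') //= delta_mulmxE eqxx big1 ?addr0 // => k ki.
  by rewrite delta_mulmxE (negbTE ki).
case: b.
  by rewrite -scalemxAl mxtraceZ mulmxDl mxtraceD !tr sM Re_i ImD ImN Im_conj; ring.
by rewrite mulmxBl (raddfB (@mxtrace C n)) /= !tr sM ReD !ReN Re_conj; ring.
Qed.

End TraceForm.

Section Killing.
Variables (R : realType) (n : nat).
Local Notation C := R[i].
Local Notation Re := (@complex.Re R).
Local Notation Im := (@complex.Im R).
Implicit Types (X Y Z M : 'M[C]_n) (c d : pidx n).

Lemma liebDr X Y Z : lieb X (Y + Z) = lieb X Y + lieb X Z.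
Proof. by rewrite /lieb mulmxDr mulmxDl opprD addrACA. Qed.
Lemma liebZr (z : C) X Y : lieb X (z *: Y) = z *: lieb X Y.
Proof. by rewrite /lieb -scalemxAr -scalemxAl scalerBr. Qed.
Lemma liebDl X Y Z : lieb (X + Y) Z = lieb X Z + lieb Y Z.
Proof. by rewrite /lieb mulmxDr mulmxDl opprD addrACA. Qed.
Lemma liebZl (z : C) X Y : lieb (z *: X) Y = z *: lieb X Y.
Proof. by rewrite /lieb -scalemxAr -scalemxAl scalerBr. Qed.

Lemma killing_split X Y : killing X Y =
  \sum_(c : pidx n) pentry (lieb X (lieb Y (pvec R c))) c +
  \sum_(k < n.-1) tentry (lieb X (lieb Y (tvec R k))) k.
Proof.
rewrite /killing /mxtrace.
pose bas (s : suidx n) : 'M[C]_n :=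
  match s with inl c => pvec R c | inr k => tvec R k end.
pose coo (s : suidx n) : R := match s with
  | inl c => pentry (lieb X (lieb Y (pvec R c))) c
  | inr k => tentry (lieb X (lieb Y (tvec R k))) k end.
transitivity (\sum_(a < #|suidx n|) coo (enum_val a)); last first.
  by rewrite -(big_enum_val coo) big_sumType.
apply: eq_bigr => a _; rewrite !mxE.
have -> : su_mx (delta_mx 0 a : 'rV[R]_#|suidx n|) = bas (enum_val a).
  rewrite /su_mx (bigD1 a) //= big1 ?addr0 => [|b ba].
    by rewrite mxE !eqxx scale1r.
  by rewrite mxE (negbTE ba) andbF scale0r.
by rewrite /coo /bas; case: (enum_val a).
Qed.

(** Of the four terms of the double bracket, the two with the matrix unit in the middle produce
    products of diagonal entries. *)
Lemma lieb2_delta X Y i j : (forall k, X k k = 0) -> (forall k, Y k k = 0) ->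
  i != j -> lieb X (lieb Y (delta_mx i j)) i j = (X *m Y) i i + (Y *m X) j j.
Proof.
move=> dX dY ij; rewrite /lieb mulmxBr mulmxBl !mulmxA.
have e (M N : 'M[C]_n) k l : (M *m delta_mx i j *m N) k l = M k i * N j l.
  rewrite mxE (bigD1 j) //= mulmx_deltaE eqxx big1 ?addr0 // => m mj.
  by rewrite mulmx_deltaE (negbTE mj) mul0r.
have e' (M N : 'M[C]_n) k l : (delta_mx i j *m M *m N) k l = (M *m N) j l *+ (k == i).
  by rewrite -mulmxA delta_mulmxE.
rewrite !submxE.
rewrite mulmx_deltaE !e e' !eqxx !dX !dY /=; ring.
Qed.

(** This is the root [e_l - e_m] evaluated on its coroot [E_ll - E_mm], with the coroot expanded in
    the basis [E_kk - E_{k+1,k+1}] of the torus algebra. *)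
Lemma sum_tvec_coef (l m : 'I_n) : l != m ->
  \sum_(k < n.-1 | (l <= k)%N)
     (((l == k :> nat)%:R - (l == k.+1 :> nat)%:R)
      - ((m == k :> nat)%:R - (m == k.+1 :> nat)%:R)) +
  \sum_(k < n.-1 | (m <= k)%N)
     (((m == k :> nat)%:R - (m == k.+1 :> nat)%:R)
      - ((l == k :> nat)%:R - (l == k.+1 :> nat)%:R)) = 2 :> R.
Proof.
have S0 (p q : 'I_n) : \sum_(k < n.-1 | (p <= k)%N) (q == k :> nat)%:R
                     = ((q < n.-1) && (p <= q))%N%:R :> R.
  transitivity (\sum_(k < n.-1 | (p <= k)%N && (k == q :> nat)) (1 : R)).
    rewrite [RHS]big_mkcondr; apply: eq_bigr => k _; rewrite eq_sym.
    by case: (_ == _).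
  rewrite (big_ord1_cond_eq _ (fun=> 1) (fun k => (p <= k)%N)).
  by case: (_ && _).
have S1 (p q : 'I_n) : \sum_(k < n.-1 | (p <= k)%N) (q == k.+1 :> nat)%:R
                     = (p < q)%N%:R :> R.
  transitivity (\sum_(k < n.-1 | (p <= k)%N && (0 < q)%N && (k == q.-1 :> nat)) (1 : R)).
    rewrite [RHS]big_mkcondr [RHS]big_mkcondr; apply: eq_bigr => k _.
    by case: (val q) => //= q'; rewrite eqSS eq_sym; case: (_ == _).
  rewrite (big_ord1_cond_eq _ (fun=> 1) (fun k => (p <= k)%N && (0 < q)%N)).
  have := ltn_ord q; case: (val q) => [|q'] /= hq; first by rewrite !andbF.
  have -> : (q' < n.-1)%N by rewrite -ltnS prednK // (leq_trans _ hq).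
  by rewrite andbT ltnS; case: (_ <= _)%N.
wlog lm : l m / (l < m)%N => [hw|_].
  have [lm|ml|/val_inj ->] := ltngtP l m; rewrite ?eqxx // => h.
    exact: hw.
  by rewrite addrC hw // eq_sym.
rewrite !sumrB !S0 !S1 !ltnn !leqnn lm (ltnNge m l) (leqNgt m l) lm (ltnW lm) /=.
rewrite !andbT !andbF.
have -> : (l < n.-1)%N.
  by rewrite -ltnS (leq_trans _ (leqSpred n)) // (leq_ltn_trans lm).
by rewrite /=; ring.
Qed.

(** The trace over [p] contributes [2 (n - 1) Re tr (X Y)], each index lying in [n - 1] pairs, and
    the trace over the torus algebra contributes the remaining [2 Re tr (X Y)]. *)
Lemma killing_p X Y : skewh X -> skewh Y ->
  (forall k, X k k = 0) -> (forall k, Y k k = 0) ->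
  killing X Y = 2 * n%:R * Re (\tr (X *m Y)).
Proof.
move=> sX sY dX dY; rewrite killing_split (@sum_pentry _ _ (fun Z => lieb X (lieb Y Z))); first last.
- by move=> z Z; rewrite !liebZr.
- by move=> Z Z'; rewrite !liebDr.
pose r i := Re ((X *m Y) i i).
pose W l m := Re (X l m * Y m l + Y l m * X m l).
have WC l m : W l m = W m l by rewrite /W addrC mulrC (mulrC (X l m)).
have Wd l : W l l = 0 by rewrite /W dX dY !mul0r addr0.
have rW i : \sum_j W i j = 2 * r i.
  rewrite /W; under eq_bigr do rewrite ReD.
  rewrite big_split /= -!Re_sum; have e Z Z' : \sum_j Z i j * Z' j i = (Z *m Z') i i.
    by rewrite mxE.
  by rewrite !e (Re_mulmx_skewC i sY sX) /r; ring.
have -> : \sum_(i < n) \sum_(j < n | (i < j)%N)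
            2 * Re (lieb X (lieb Y (delta_mx i j)) i j) =
          \sum_(i < n) \sum_(j < n | (i < j)%N) (2 * r i + 2 * r j).
  apply: eq_bigr => i _; apply: eq_bigr => j ij.
  rewrite lieb2_delta // -?val_eqE ?neq_ltn ?ij // ReD (Re_mulmx_skewC j sY sX).
  by rewrite mulrDr.
rewrite (sum_ord_ltn_sym (fun i _ => 2 * r i)).
pose dk (k : 'I_n.-1) (l : 'I_n) : R := (l == k :> nat)%:R - (l == k.+1 :> nat)%:R.
have -> : \sum_(k < n.-1) tentry (lieb X (lieb Y (tvec R k))) k =
          \sum_(k < n.-1) \sum_(l < n | (l <= k)%N) \sum_m (dk k l - dk k m) * W l m.
  apply: eq_bigr => k _; rewrite /tentry Im_sum; apply: eq_bigr => l _.
  rewrite /tvec !liebZr mxE Im_i.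
  set D := diag_mx _.
  have hD M m p : (M *m D) m p = M m p * (dk k p)%:C.
    rewrite mul_mx_diag !mxE /dk !rmorphB /= ?rmorph_nat //.
  have hD' M m p : (D *m M) m p = (dk k m)%:C * M m p.
    rewrite mul_diag_mx !mxE /dk !rmorphB /= ?rmorph_nat //.
  have -> : lieb X (lieb Y D) l l = \sum_m (dk k l - dk k m)%:C * (X l m * Y m l + Y l m * X m l).
    rewrite /lieb mulmxBr mulmxBl !submxE.
    have mulE (A B : 'M[C]_n) : (A *m B) l l = \sum_m A l m * B m l by rewrite mxE.
    rewrite !(mulE X) (mulE (Y *m D)) (mulE (D *m Y)) -!sumrB.
    apply: eq_bigr => m _; rewrite !hD !hD'.
    have -> : (dk k l - dk k m)%:C = (dk k l)%:C - (dk k m)%:C by exact: rmorphB.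
    by ring.
  by rewrite Re_sum; apply: eq_bigr => m _; rewrite Re_real.
have -> : \sum_(k < n.-1) \sum_(l < n | (l <= k)%N) \sum_m (dk k l - dk k m) * W l m
        = \sum_(l < n) \sum_(m < n) (\sum_(k < n.-1 | (l <= k)%N) (dk k l - dk k m)) * W l m.
  rewrite (exchange_big_dep predT) //=; apply: eq_bigr => l _.
  rewrite exchange_big /=; apply: eq_bigr => m _.
  by rewrite mulr_suml.
have -> : \sum_(l < n) \sum_(m < n) (\sum_(k < n.-1 | (l <= k)%N) (dk k l - dk k m)) * W l m
        = \sum_(l < n) \sum_(m < n | m != l) W l m.
  transitivity (\sum_(l < n) \sum_(m < n | m != l)
       (\sum_(k < n.-1 | (l <= k)%N) (dk k l - dk k m)) * W l m).
    by apply: eq_bigr => l _; rewrite (bigD1 l) //= Wd mulr0 add0r.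
  rewrite -sum_ord_ltn_sym -[RHS]sum_ord_ltn_sym.
  apply: eq_bigr => l _; apply: eq_bigr => m lm.
  rewrite (WC m l) -mulrDl sum_tvec_coef; first by ring.
  by rewrite -val_eqE neq_ltn lm.
have -> : \sum_(l < n) \sum_(m < n | m != l) W l m = \sum_(l < n) 2 * r l.
  by apply: eq_bigr => l _; rewrite -rW [RHS](bigD1 l) //= Wd add0r.
rewrite -big_split /= /mxtrace Re_sum mulr_sumr; apply: eq_bigr => i _.
rewrite sumr_const cardC1 card_ord -[_ *+ n.-1]mulr_natr -/(r i).
have -> : n%:R = n.-1%:R + 1 :> R.
  by rewrite natr1 prednK // (leq_ltn_trans _ (ltn_ord i)).
by ring.
Qed.

End Killing.

(** * Diagonal tensors as weighted trace forms, and the normalization of Q *)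

Section DiagonalTensor.
Variables (R : realType) (n : nat).
Local Notation C := R[i].
Local Notation Re := (@complex.Re R).
Local Notation Im := (@complex.Im R).
Implicit Types (A B M X Y Z : 'M[C]_n) (u v z : 'rV[R]_(dimF n)) (c d : pidx n).
Implicit Types (x y : 'I_n -> 'I_n -> R).

Definition pval y c : R := y (val c).1.1 (val c).1.2.

Definition dmx y : 'M[R]_(dimF n) := diag_mx (\row_a pval y (enum_val a)).

(** The endomorphism of [p] with matrix [dmx y], acting directly on matrices. *)
Definition hadamard y B : 'M[C]_n := \matrix_(i, j) ((y i j)%:C * B i j).

Lemma dmxE y a b : dmx y a b = (a == b)%:R * pval y (enum_val a).
Proof. by rewrite !mxE; case: eqP => [->|_]; rewrite ?mul1r ?mul0r. Qed.

Lemma eq_dmx x y : (forall i j : 'I_n, (i < j)%N -> x i j = y i j) -> dmx x = dmx y.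
Proof.
by move=> e; apply/matrixP => a b; rewrite !dmxE /pval e // pidx_ltn.
Qed.

Lemma dmxD x y : dmx x + dmx y = dmx (fun i j => x i j + y i j).
Proof. by apply/matrixP => a b; rewrite mxE !dmxE /pval; ring. Qed.

Lemma dmxZ (r : R) y : r *: dmx y = dmx (fun i j => r * y i j).
Proof. by apply/matrixP => a b; rewrite mxE !dmxE /pval; ring. Qed.

Lemma mul_dmx x y : dmx x *m dmx y = dmx (fun i j => x i j * y i j).
Proof.
by rewrite mulmx_diag; congr diag_mx; apply/rowP => a; rewrite !mxE.
Qed.

Lemma invmx_dmx y : (forall i j : 'I_n, (i < j)%N -> y i j != 0) ->
  invmx (dmx y) = dmx (fun i j => (y i j)^-1).
Proof.
move=> ynz; have e : dmx y *m dmx (fun i j => (y i j)^-1) = 1%:M.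
  rewrite mul_dmx; apply/matrixP => a b; rewrite dmxE mxE /pval mulfV ?mulr1 //.
  exact/ynz/pidx_ltn.
have [uy _] := mulmx1_unit e.
by rewrite -[RHS]mul1mx -(mulVmx uy) -mulmxA e mulmx1.
Qed.

Lemma tens_dmx y u v :
  tens (dmx y) u v = \sum_a u 0 a * (pval y (enum_val a) * v 0 a).
Proof.
rewrite /tens mxE; apply: eq_bigr => a _.
by rewrite mul_mx_diag !mxE mulrA.
Qed.

Lemma tens_dmxC y u v : tens (dmx y) u v = tens (dmx y) v u.
Proof. by rewrite !tens_dmx; apply: eq_bigr => a _; rewrite mulrC mulrCA mulrA. Qed.

Lemma tens_delta (h : 'M[R]_(dimF n)) a b :
  tens h (delta_mx 0 a) (delta_mx 0 b) = h a b.
Proof.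
rewrite /tens -rowE mxE (bigD1 b) //= big1 ?addr0 => [|k kb].
  by rewrite !mxE !eqxx mulr1.
by rewrite !mxE (negbTE kb) andbF mulr0.
Qed.

Lemma retr_p_mx u M : skewh M ->
  Re (\tr (p_mx u *m M)) = - 2 * \sum_a u 0 a * pentry M (enum_val a).
Proof.
move=> sM; rewrite /p_mx mulmx_suml (raddf_sum (@mxtrace C n)) Re_sum mulr_sumr.
apply: eq_bigr => a _.
transitivity (Re ((u 0 a)%:C * \tr (pvec R (enum_val a) *m M))).
  by congr Re; rewrite -scalemxAl; exact: mxtraceZ.
by rewrite Re_real retr_pvec //; ring.
Qed.

Lemma pentry_hadamard y B c : pentry (hadamard y B) c = pval y c * pentry B c.
Proof. by rewrite !pentryE !mxE; case: ifP; rewrite ?Re_real ?Im_real. Qed.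

Lemma hadamard_skewh y B : (forall i j, y i j = y j i) -> skewh B ->
  skewh (hadamard y B).
Proof.
by move=> ysym sB i j; rewrite !mxE conjM conj_real sB ysym mulrN.
Qed.

(** In this form the invariance of the trace applies to diagonal metrics, both under brackets and
    under conjugation by the torus. *)
Lemma tens_dmxE y u v : (forall i j, y i j = y j i) ->
  tens (dmx y) u v = - 2^-1 * Re (\tr (p_mx u *m hadamard y (p_mx v))).
Proof.
move=> ysym; rewrite retr_p_mx; last exact/hadamard_skewh/p_mx_skewh.
rewrite mulrA mulrNN mulVf ?pnatr_eq0 // mul1r tens_dmx; apply: eq_bigr => a _.
by rewrite pentry_hadamard -p_coordE p_mxK.
Qed.

Lemma Qform_p X Y : skewh X -> skewh Y ->
  (forall k, X k k = 0) -> (forall k, Y k k = 0) ->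
  Qform X Y = - (2 * n%:R * Re (\tr (X *m Y))).
Proof. by move=> sX sY dX dY; rewrite /Qform killing_p. Qed.

Lemma proj_pij_skewh i j X : skewh X -> skewh (proj_pij i j X).
Proof.
move=> sX k l; rewrite !mxE orbC (andbC (l == j)) (andbC (l == i)).
case: ifP => _; first exact: sX.
by rewrite conj0 oppr0.
Qed.

Lemma proj_pij_pvec (i j : 'I_n) c : (i < j)%N ->
  proj_pij i j (pvec R c) =
  if (i == (val c).1.1) && (j == (val c).1.2) then pvec R c else 0.
Proof.
move=> ij; apply/matrixP => k l; have := pidx_ltn c.
rewrite mxE; case: ifP => [h|h] cc; last first.
  case: ifP => [/andP[/eqP ei /eqP ej]|_]; last by rewrite mxE.
  move: h; rewrite ei ej pvecE => /negbT; rewrite negb_or => /andP[/negbTE -> /negbTE ->].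
  by rewrite addr0 subr0 mulr0; case: ifP.
case: ifP => // h'; rewrite mxE pvecE.
have -> : (k == (val c).1.1) && (l == (val c).1.2) = false.
  apply/negP => /andP[/eqP ek /eqP el]; move: h h'; rewrite ek el.
  case/orP => /andP[/eqP e1 /eqP e2]; first by rewrite -e1 -e2 !eqxx.
  by move: cc; rewrite e1 e2 ltnNge ltnW.
have -> : (k == (val c).1.2) && (l == (val c).1.1) = false.
  apply/negP => /andP[/eqP ek /eqP el]; move: h h'; rewrite ek el.
  case/orP => /andP[/eqP e1 /eqP e2]; last by rewrite -e1 -e2 !eqxx.
  by move: cc; rewrite e1 e2 ltnNge ltnW.
by rewrite addr0 subr0 mulr0; case: ifP.
Qed.

(** On [p] the form Q is [-2n Re tr], and the basis vectors have [Re tr] square -2; hence the factor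
    [4n]. *)
Lemma diag_tensorE x : diag_tensor x = dmx (fun i j => 4 * n%:R * x i j).
Proof.
apply/matrixP => a b; rewrite dmxE mxE.
set c := enum_val a; set d := enum_val b.
have Q0 Y : Qform 0 Y = 0 :> R.
  have l0 Z : lieb 0 Z = 0 :> 'M[C]_n by rewrite /lieb mul0mx mulmx0 subr0.
  rewrite /Qform killing_split !big1 ?addr0 ?oppr0 // => k _.
    by rewrite l0 /tentry Im_sum big1 // => l _; rewrite mxE.
  by rewrite l0 pentry0.
rewrite (bigD1 (val c).1.1) //= [X in _ + X]big1 ?addr0; last first.
  move=> i ic; apply: big1 => j ij.
  by rewrite proj_pij_pvec // (negbTE ic) /= Q0 mulr0.
rewrite (bigD1 (val c).1.2) ?pidx_ltn //= [X in _ + X]big1 ?addr0; last first.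
  move=> j /andP[ij jc].
  by rewrite proj_pij_pvec // (negbTE jc) andbF Q0 mulr0.
rewrite proj_pij_pvec ?pidx_ltn // !eqxx /=.
rewrite Qform_p; last first.
- by move=> k; rewrite mxE pvec_diag; case: ifP.
- by move=> k; rewrite pvec_diag.
- exact/proj_pij_skewh/pvec_skewh.
- exact: pvec_skewh.
rewrite retr_pvec; last exact/proj_pij_skewh/pvec_skewh.
have -> : pentry (proj_pij (val c).1.1 (val c).1.2 (pvec R d)) c = (a == b)%:R.
  rewrite pentryE mxE !eqxx /= -pentryE pentry_pvec (inj_eq enum_val_inj).
  by rewrite eq_sym.
rewrite /pval; ring.
Qed.

End DiagonalTensor.

(** * Levi-Civita connection and Ricci curvature of diagonal metrics *)

Section Connection.
Variables (R : realType) (n : nat).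
Local Notation C := R[i].
Local Notation Re := (@complex.Re R).
Local Notation Im := (@complex.Im R).
Implicit Types (A B M X Y Z : 'M[C]_n) (u v z : 'rV[R]_(dimF n)) (c d : pidx n).
Variable y : 'I_n -> 'I_n -> R.
Hypothesis ysym : forall i j, y i j = y j i.
Hypothesis ynz : forall i j : 'I_n, i != j -> y i j != 0.

(** The coefficient of [A_ik B_kj] in the derivative of [B] along [A]: one half from the bracket
    plus [(y_kj - y_ik) / (2 y_ij)] from the symmetric part. *)
Definition conn_coef (i k j : 'I_n) : R := (y i j + y k j - y i k) / (2 * y i j).
Local Notation al := conn_coef.

(* Complex-bilinear in A and B, so that it can be evaluated at matrix units. *)
Definition conn A B : 'M[C]_n := \matrix_(i, j)
  if i == j then 0 else
  \sum_k ((al i k j)%:C * (A i k * B k j) - (al j k i)%:C * (B i k * A k j)).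

Lemma conn_skewh A B : skewh A -> skewh B -> skewh (conn A B).
Proof.
move=> sA sB i j; rewrite !mxE eq_sym; case: ifP => _; first by rewrite conj0 oppr0.
rewrite conj_sum -sumrN; apply: eq_bigr => k _.
rewrite conjD conjN !conjM !conj_real (sA k j) (sB i k) (sB k j) (sA i k).
rewrite !mulrNN; ring.
Qed.

Lemma mxtrace_offd M B : (forall k, B k k = 0) -> \tr (offd M *m B) = \tr (M *m B).
Proof.
move=> dB; apply: eq_bigr => i _; rewrite !mxE; apply: eq_bigr => j _; rewrite mxE.
by case: eqP => [->|//]; rewrite dB !mulr0.
Qed.

Lemma mxtrace_lieb Z A B : \tr (lieb Z A *m B) = \tr (Z *m lieb A B).
Proof.
rewrite /lieb mulmxBl mulmxBr !raddfB /= mulmxA; congr (_ - _).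
by rewrite -mulmxA mxtrace_mulC mulmxA.
Qed.

Lemma p_mx_brp u v : p_mx (brp u v) = offd (lieb (p_mx u) (p_mx v)).
Proof. by rewrite /brp p_coordK //; apply: lieb_skewh; apply: p_mx_skewh. Qed.

Lemma hadamard_diag B : (forall k, B k k = 0) -> forall k, hadamard y B k k = 0.
Proof. by move=> dB k; rewrite mxE dB mulr0. Qed.

(** Invariance of the trace form moves the basis vector out of the bracket, so that pairing with it
    becomes reading off a coordinate. *)
Lemma tens_brp a u v :
  tens (dmx y) (brp (delta_mx 0 a) u) v =
  pentry (lieb (p_mx u) (hadamard y (p_mx v))) (enum_val a).
Proof.
rewrite tens_dmxE // p_mx_brp mxtrace_offd; last exact/hadamard_diag/p_mx_diag.
rewrite mxtrace_lieb p_mx_delta retr_pvec.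
  by rewrite mulrA mulrNN mulVf ?mul1r // pnatr_eq0.
by apply: lieb_skewh; [exact: p_mx_skewh | exact/hadamard_skewh/p_mx_skewh].
Qed.

Lemma pentry_comb (r : R) (s : 'I_n -> 'I_n -> R) M X Z c :
  pentry (\matrix_(i, j) (r%:C * M i j + (s i j)%:C * (X i j + Z i j))) c =
  r * pentry M c + pval s c * (pentry X c + pentry Z c).
Proof.
by rewrite !pentryE mxE; case: ifP => _;
  rewrite ?(ImD, Im_real) ?(ReD, Re_real) ?(ImD, Im_real) ?(ReD, Re_real).
Qed.

Lemma brpE u v a : brp u v 0 a = pentry (lieb (p_mx u) (p_mx v)) (enum_val a).
Proof. exact: p_coordE. Qed.

Lemma levi_civita_dmx u v :
  levi_civita (dmx y) u v = p_coord (conn (p_mx u) (p_mx v)).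
Proof.
(* The Koszul formula before coefficients are compared: half the bracket plus the symmetric part,
   with the metric inverted entrywise. *)
pose W : 'M[C]_n := \matrix_(i, j) ((2^-1)%:C * lieb (p_mx u) (p_mx v) i j +
  ((2 * y i j)^-1)%:C * (lieb (p_mx u) (hadamard y (p_mx v)) i j + lieb (p_mx v) (hadamard y (p_mx u)) i j)).
transitivity (p_coord W).
  apply/rowP => a; rewrite /levi_civita /Upart invmx_dmx; last first.
    by move=> i j ij; apply: ynz; rewrite -val_eqE neq_ltn ij.
  have e (r : 'rV[R]_(dimF n)) s : (r *m dmx s) 0 a = r 0 a * pval s (enum_val a).
    by rewrite mul_mx_diag !mxE.
  rewrite [LHS]mxE e [X in X + _]mxE [X in _ + X * _]mxE.
  rewrite (tens_dmxC y u (brp (delta_mx 0 a) v)) (tens_brp a u v) (tens_brp a v u).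
  rewrite (brpE u v a).
  rewrite (p_coordE W a) pentry_comb.
  rewrite /pval invfM.
  have gen (p1 p2 p3 q : R) :
      2^-1 * p1 + (p2 + p3) / 2 / q = 2^-1 * p1 + 2^-1 / q * (p2 + p3) by ring.
  exact: gen.
move: (p_mx u) (p_mx v) => A B in W *.
apply/rowP => a; rewrite !p_coordE; move: (enum_val a) => c.
rewrite !pentryE !mxE (negbTE (pidx_neq c)).
suff -> : forall i j : 'I_n, i != j -> (2^-1)%:C * (\sum_k A i k * B k j - \sum_k B i k * A k j)
  + ((2 * y i j)^-1)%:C * ((\sum_k A i k * hadamard y B k j - \sum_k hadamard y B i k * A k j)
        + (\sum_k B i k * hadamard y A k j - \sum_k hadamard y A i k * B k j))
  = \sum_k ((al i k j)%:C * (A i k * B k j) - (al j k i)%:C * (B i k * A k j)).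
- by [].
- exact: pidx_neq.
move=> i j ij; rewrite -!sumrB -big_split /= !mulr_sumr -big_split /=.
apply: eq_bigr => k _; rewrite !mxE.
have e1 : al i k j = 2^-1 + (2 * y i j)^-1 * (y k j - y i k).
  by rewrite /al; field; rewrite ynz.
have e2 : al j k i = 2^-1 - (2 * y i j)^-1 * (y k j - y i k).
  by rewrite /al (ysym j i) (ysym k i) (ysym j k); field; rewrite ynz.
by rewrite e1 e2 !(realCD, realCN, realCM); ring.
Qed.

End Connection.

Section Ricci.
Variables (R : realType) (n : nat).
Local Notation C := R[i].
Local Notation Re := (@complex.Re R).
Local Notation Im := (@complex.Im R).
Implicit Types (A B M X Y Z : 'M[C]_n) (u v z : 'rV[R]_(dimF n)) (c d : pidx n).
Variable y : 'I_n -> 'I_n -> R.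
Hypothesis ysym : forall i j, y i j = y j i.
Hypothesis ynz : forall i j : 'I_n, i != j -> y i j != 0.
Local Notation al := (conn_coef y).
Local Notation conn := (conn y).

Lemma connDl X Y B : conn (X + Y) B = conn X B + conn Y B.
Proof.
apply/matrixP => i j; rewrite !mxE; case: ifP => _; first by rewrite addr0.
by rewrite -big_split /=; apply: eq_bigr => k _; rewrite !mxE; ring.
Qed.

Lemma connDr A X Y : conn A (X + Y) = conn A X + conn A Y.
Proof.
apply/matrixP => i j; rewrite !mxE; case: ifP => _; first by rewrite addr0.
by rewrite -big_split /=; apply: eq_bigr => k _; rewrite !mxE; ring.
Qed.

Lemma connZl (a : C) X B : conn (a *: X) B = a *: conn X B.
Proof.
apply/matrixP => i j; rewrite !mxE; case: ifP => _; first by rewrite mulr0.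
by rewrite mulr_sumr /=; apply: eq_bigr => k _; rewrite !mxE; ring.
Qed.

Lemma connZr (a : C) A X : conn A (a *: X) = a *: conn A X.
Proof.
apply/matrixP => i j; rewrite !mxE; case: ifP => _; first by rewrite mulr0.
by rewrite mulr_sumr /=; apply: eq_bigr => k _; rewrite !mxE; ring.
Qed.

Lemma conn_diag A B k : conn A B k k = 0.
Proof. by rewrite mxE eqxx. Qed.

Lemma offdD X Y : offd (X + Y) = offd X + offd Y.
Proof. by apply/matrixP => i j; rewrite !mxE; case: ifP; rewrite ?addr0. Qed.

Lemma offdZ (a : C) X : offd (a *: X) = a *: offd X.
Proof. by apply/matrixP => i j; rewrite !mxE; case: ifP; rewrite ?mulr0. Qed.

Lemma offd_id X : (forall k, X k k = 0) -> offd X = X.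
Proof. by move=> dX; apply/matrixP => i j; rewrite mxE; case: eqP => // ->. Qed.

Definition diagpart X : 'M[C]_n := diag_mx (\row_k X k k).

Lemma diagpartD X Y : diagpart (X + Y) = diagpart X + diagpart Y.
Proof. by apply/matrixP => i j; rewrite !mxE mulrnDl. Qed.

Lemma diagpartZ (a : C) X : diagpart (a *: X) = a *: diagpart X.
Proof. by apply/matrixP => i j; rewrite !mxE mulrnAr. Qed.

(** [R(Z, A) B] with all operations extended to complex matrices; [Z] comes last because the Ricci
    trace is taken over it. *)
Definition curv A B Z : 'M[C]_n :=
  conn Z (conn A B) - conn A (conn Z B) - conn (offd (lieb Z A)) B
  - lieb (diagpart (lieb Z A)) B.

Lemma curvD A B : {morph curv A B : X Y / X + Y}.
Proof.
have reg (V : zmodType) (a a' b b' c c' d d' : V) :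
    a + a' - (b + b') - (c + c') - (d + d') = a - b - c - d + (a' - b' - c' - d').
  have reg2 (a1 a2 a3 a4 : V) : a1 + a2 - (a3 + a4) = a1 - a3 + (a2 - a4).
    by rewrite opprD addrACA.
  by rewrite (reg2 a a' b b') (reg2 _ _ c c') (reg2 _ _ d d').
move=> X Y; rewrite /curv connDl (connDl X Y B) connDr (liebDl X Y A) offdD connDl.
by rewrite diagpartD liebDl; exact: reg.
Qed.

Lemma curvZ A B (a : C) : {morph curv A B : X / a *: X}.
Proof.
move=> X; rewrite /curv !(connZl, connZr, liebZl, offdZ, diagpartZ).
by rewrite -!scalerBr.
Qed.

Lemma conn_p_coord u A B : skewh A -> skewh B ->
  p_coord (conn (p_mx u) (p_mx (p_coord (conn A B)))) =
  p_coord (conn (p_mx u) (conn A B)).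
Proof.
by move=> sA sB; rewrite p_coordK ?offd_id //; [exact: conn_diag|exact: conn_skewh].
Qed.

Lemma curvature_dmx z u v :
  curvature (dmx y) z u v = p_coord (curv (p_mx u) (p_mx v) (p_mx z)).
Proof.
rewrite /curvature !levi_civita_dmx // !conn_p_coord; try exact: p_mx_skewh.
by rewrite p_mx_brp -!p_coordB.
Qed.

Lemma conn_deltaE (i j : 'I_n) B (k l : 'I_n) : k != l ->
  conn (delta_mx i j) B k l =
  (al i j l)%:C * B j l *+ (k == i) - (al j i k)%:C * B k i *+ (l == j).
Proof.
move=> kl; rewrite mxE (negbTE kl) sumrB; congr (_ - _).
  rewrite (bigD1 j) //= big1 ?addr0 => [|m mj].
    by rewrite mxE eqxx andbT; case: eqP => [->|_] /=; rewrite ?mul1r // mul0r mulr0.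
  by rewrite mxE (negbTE mj) andbF mul0r mulr0.
rewrite (bigD1 i) //= big1 ?addr0 => [|m mi].
  by rewrite mxE eqxx /=; case: eqP => [->|_] /=; rewrite ?mulr1 // !mulr0.
by rewrite mxE (negbTE mi) /= !mulr0.
Qed.

Lemma lieb_deltaE (i j : 'I_n) A (k l : 'I_n) :
  lieb (delta_mx i j) A k l = A j l *+ (k == i) - A k i *+ (l == j).
Proof. by rewrite /lieb submxE mulmx_deltaE delta_mulmxE. Qed.

Lemma lieb_diagpartE X B k l : lieb (diagpart X) B k l = (X k k - X l l) * B k l.
Proof. by rewrite /lieb submxE mul_diag_mx mul_mx_diag !mxE; ring. Qed.

Lemma curv_deltaE A B (i j : 'I_n) : i != j ->
  (forall k, A k k = 0) -> (forall k, B k k = 0) ->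
  curv A B (delta_mx i j) i j =
  - (2 * (A j i * B i j)) + \sum_(k | (k != i) && (k != j))
    ((al i k j)%:C * (al j i k)%:C * (A i k * B k i)
     + (al j k i)%:C * (al i j k)%:C * (A k j * B j k)
     - (al i k j)%:C * (A j k * B k j) - (al j k i)%:C * (B i k * A k i)).
Proof.
move=> ij dA dB.
have ji : (j == i) = false by rewrite eq_sym (negbTE ij).
(* The matrix unit [E_ij] reaches only the diagonal entries of [conn A B] here, and these vanish. *)
have T1 : conn (delta_mx i j) (conn A B) i j = 0.
  by rewrite conn_deltaE // !eqxx !conn_diag !mulr0 subr0.
have T2 : conn A (conn (delta_mx i j) B) i j =
    \sum_(k | (k != i) && (k != j))
      (- ((al i k j)%:C * (al j i k)%:C * (A i k * B k i))
       - (al j k i)%:C * (al i j k)%:C * (A k j * B j k)).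
  rewrite mxE (negbTE ij) (bigD1 i) //= (bigD1 j) //= ?ji //.
  rewrite !conn_diag !dA !mulr0 !mul0r !mulr0 !subr0 !add0r.
  apply: eq_bigr => k /andP[ki kj].
  have ik : i != k by rewrite eq_sym.
  by rewrite (conn_deltaE i j B kj) (conn_deltaE i j B ik) !eqxx (negbTE ki) (negbTE kj) /=; ring.
have T3 : conn (offd (lieb (delta_mx i j) A)) B i j =
    \sum_(k | (k != i) && (k != j))
      ((al i k j)%:C * (A j k * B k j) + (al j k i)%:C * (B i k * A k i)).
  rewrite mxE (negbTE ij) (bigD1 i) //= (bigD1 j) //= ?ji //.
  rewrite !dB ![offd _ _ _]mxE !eqxx !mulr0 !mul0r !mulr0 !subr0 !add0r.
  apply: eq_bigr => k /andP[ki kj].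
  rewrite ![offd _ _ _]mxE !lieb_deltaE (negbTE ki) (negbTE kj) !eqxx eq_sym (negbTE ki) /=; ring.
have T4 : lieb (diagpart (lieb (delta_mx i j) A)) B i j = 2 * (A j i * B i j).
  by rewrite lieb_diagpartE !lieb_deltaE !eqxx (negbTE ij) ji /=; ring.
rewrite /curv 3!submxE T1 T2 T3 T4 sub0r [LHS]addrC; congr (_ + _).
by rewrite -sumrN -sumrB; apply: eq_bigr => k _; ring.
Qed.

Definition ric i k : R := 2 * n%:R -
  \sum_(j | (j != i) && (j != k)) (y i j ^+ 2 + y k j ^+ 2 - y i k ^+ 2) / (y i j * y k j).

Lemma ricC i k : ric i k = ric k i.
Proof.
rewrite /ric; congr (_ - _); apply: eq_big => j; first by rewrite andbC.
by move=> _; rewrite (ysym k i) (mulrC (y i j)) (addrC (y i j ^+ 2)).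
Qed.

Lemma conn_coef_sum i j k : j != i -> j != k -> i != k ->
  (al i k j * al j i k - al j k i) + (al k i j * al j k i - al j i k) =
  (y i j ^+ 2 + y k j ^+ 2 - y i k ^+ 2) / (y i j * y k j) / 2 - 1.
Proof.
move=> ji jk ik; rewrite /conn_coef (ysym j i) (ysym j k) (ysym k i).
by field; rewrite !ynz // eq_sym.
Qed.

(** The sum is reorganized by the product [A_ik B_ki] instead of the plane [p_ij] being traced. The
    constant [2n] of [ric] arises as [4 + 2 (n - 2)]: 4 from the torus part of the bracket, and 2
    from each third index through [conn_coef_sum]. *)
Lemma mxtrace_curv A B : skewh A -> skewh B ->
  (forall k, A k k = 0) -> (forall k, B k k = 0) ->
  \sum_(i < n) \sum_(j < n | (i < j)%N) 2 * Re (curv A B (delta_mx i j) i j) =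
  - 2^-1 * \sum_i \sum_k ric i k * Re (A i k * B k i).
Proof.
move=> sA sB dA dB.
pose h (i k : 'I_n) : R := Re (A i k * B k i).
have hC i k : h i k = h k i.
  by rewrite /h (sA k i) (sB i k) mulrNN ReM_conj.
pose g (i j k : 'I_n) : R := al i k j * al j i k - al j k i.
pose f (i j : 'I_n) : R := - 2 * h i j + 2 * \sum_(k | (k != i) && (k != j)) g i j k * h i k.
have -> : \sum_(i < n) \sum_(j < n | (i < j)%N) 2 * Re (curv A B (delta_mx i j) i j)
        = \sum_(i < n) \sum_(j < n | (i < j)%N) (f i j + f j i).
  apply: eq_bigr => i _; apply: eq_bigr => j ij.
  rewrite curv_deltaE // -?val_eqE ?neq_ltn ?ij // ReD ReN Re_sum.
  have -> : Re (2 * (A j i * B i j)) = 2 * h j i.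
    by rewrite ReM Re_nat Im_nat mul0r subr0.
  rewrite /f (hC j i) mulrDr.
  have -> : \sum_(k | (k != j) && (k != i)) g j i k * h j k =
            \sum_(k | (k != i) && (k != j)) g j i k * h j k.
    by apply: eq_bigl => k; rewrite andbC.
  rewrite [RHS]addrACA -[X in _ = _ + X]mulrDr -big_split /=; congr (_ + _); first by ring.
  congr (2 * _); apply: eq_bigr => k _.
  rewrite !(ReD, ReN) -!realCM !Re_real /g.
  have -> : Re (A k j * B j k) = h j k by rewrite hC.
  have -> : Re (B i k * A k i) = h i k by rewrite mulrC -/(h k i) hC.
  rewrite -/(h i k) -/(h j k); ring.
rewrite sum_ord_ltn_sym.
(* Interchanging the roles of [j] and [k] collects the full coefficient of each [h i k]. *)
have -> : \sum_i \sum_(j | j != i) f i j =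
  \sum_i \sum_(k | k != i) (- 2 + 2 * \sum_(j | (j != i) && (j != k)) g i j k) * h i k.
  apply: eq_bigr => i _; rewrite /f big_split /= -!mulr_sumr.
  rewrite (exchange_big_dep (fun k => k != i)) /=; last by move=> j k _ /andP[].
  rewrite 2!mulr_sumr -big_split /=; apply: eq_bigr => k ki.
  rewrite [RHS]mulrDl; congr (_ + _); rewrite -mulrA mulr_suml; congr (_ * _).
  by apply: eq_bigl => j; rewrite ki eq_sym (eq_sym j k) /= eq_sym.
rewrite -sum_ord_ltn_sym.
have -> : \sum_i \sum_k ric i k * Re (A i k * B k i) =
          \sum_i \sum_(k | k != i) ric i k * h i k.
  by apply: eq_bigr => i _; rewrite (bigD1 i) //= dA mul0r mulr0 add0r.
rewrite -sum_ord_ltn_sym mulr_sumr; apply: eq_bigr => i _.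
rewrite mulr_sumr; apply: eq_bigr => k ik.
have nik : i != k by rewrite -val_eqE neq_ltn ik.
rewrite (hC k i) (ricC k i) -!mulrDl mulrA; congr (_ * _).
have -> : \sum_(j | (j != k) && (j != i)) g k j i = \sum_(j | (j != i) && (j != k)) g k j i.
  by apply: eq_bigl => j; rewrite andbC.
rewrite addrACA -mulrDr -big_split /=.
rewrite (eq_bigr (fun j => (y i j ^+ 2 + y k j ^+ 2 - y i k ^+ 2) / (y i j * y k j) / 2 - 1)); last first.
  by move=> j /andP[ji jk]; rewrite conn_coef_sum.
rewrite sumrB -mulr_suml sumr_const /ric.
have -> : #|[pred j | (j != i) && (j != k)]| = n.-2.
  have := cardC (pred2 i k); rewrite card2 nik card_ord => e.
  rewrite -[in RHS]e; apply: eq_card => j; by rewrite !inE negb_or.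
have n2 : (2 <= n)%N.
  by rewrite (leq_trans _ (ltn_ord k)) // ltnS (leq_ltn_trans _ ik).
have -> : n%:R = n.-2%:R + 2 :> R.
  by rewrite -natrD addn2 -subn2 -addn2 subnK.
by field.
Qed.

Lemma ricci_dmx : ricci (dmx y) = dmx ric.
Proof.
apply/matrixP => a b; rewrite mxE.
rewrite (@mxtrace_p _ _ (curv (p_mx (delta_mx 0 a)) (p_mx (delta_mx 0 b)))).
- rewrite mxtrace_curv; try exact: p_mx_skewh; try exact: p_mx_diag.
  rewrite -tens_delta tens_dmxE; last exact: ricC.
  congr (_ * _); rewrite /mxtrace Re_sum; apply: eq_bigr => i _.
  rewrite mxE Re_sum; apply: eq_bigr => k _.
  by rewrite mxE mulrCA Re_real ricC.
- exact: curvD.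
- exact: curvZ.
- by move=> v; rewrite curvature_dmx.
Qed.

End Ricci.

(** * Mixed second derivatives *)

Section Jets.
Variable R : realType.
Implicit Types (h k : R -> R -> R) (f : R -> R).

(* At the origin [h] has value [a], partial derivatives [b] in the first and [c]
   in the second variable, and mixed derivative [d]; [ht s] is the derivative of
   [h s] at 0. *)
Definition jet h (a b c d : R) : Prop := exists ht : R -> R,
  [/\ \forall s \near (0 : R), is_derive (0 : R) (1 : R) (h s) (ht s),
      is_derive (0 : R) (1 : R) (h ^~ 0) b, is_derive (0 : R) (1 : R) ht d,
      h 0 0 = a & ht 0 = c].

Lemma jet_derive1 h a b c d : jet h a b c d ->
  derive1 (fun s : R => derive1 (fun t : R => h s t) 0) 0 = d.
Proof.
move=> [ht [hts hs htd _ _]]; rewrite derive1E.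
rewrite (near_eq_derive (g := ht)); first exact: derive_val.
near=> s; have H : is_derive (0 : R) (1 : R) (h s) (ht s) by near: s.
by rewrite derive1E; case: H.
Unshelve. all: by end_near. Qed.

Lemma jet_ext h k a b c d : (forall s t, h s t = k s t) -> jet h a b c d -> jet k a b c d.
Proof.
by move=> e; have -> : k = h by apply/funext => s; apply/funext => t; rewrite e.
Qed.

(** The closed formulas for volume and curvature hold only while the perturbed weights stay
    positive, hence only near the origin. *)
Lemma jet_near h k a b c d :
  (\forall s \near (0 : R), \forall t \near (0 : R), h s t = k s t) ->
  jet h a b c d -> jet k a b c d.
Proof.
move=> hk [ht [hts hs htd h0 h1]]; exists ht; split => //.
- near=> s; apply: (@near_eq_is_derive _ _ _ (h s)); near: s => //.
- apply: (@near_eq_is_derive _ _ _ (h ^~ 0)) => //.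
  by near=> s; apply: (@nbhs_singleton _ _ (fun t => h s t = k s t)); near: s.
- by rewrite -h0; apply/esym; exact: (nbhs_singleton (nbhs_singleton hk)).
Unshelve. all: by end_near. Qed.

Lemma jet_eq h a b c d b' c' d' :
  jet h a b c d -> b = b' -> c = c' -> d = d' -> jet h a b' c' d'.
Proof. by move=> + <- <- <-. Qed.

Lemma jet_affine (x p q : R) : jet (fun s t => x + s * p + t * q) x p q 0.
Proof.
exists (cst q); split; rewrite ?mul0r ?addr0 //.
- near=> s; have H := is_deriveD (is_derive_cst (x + s * p) (0 : R) (1 : R))
    (is_deriveM (is_derive_id (0 : R) (1 : R)) (is_derive_cst q (0 : R) (1 : R))).
  by apply: (is_derive_eq H); rewrite scale0r !add0r /GRing.scale /= mulr1.
- have H := is_deriveD (is_deriveD (is_derive_cst x (0 : R) (1 : R))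
    (is_deriveM (is_derive_id (0 : R) (1 : R)) (is_derive_cst p (0 : R) (1 : R))))
    (is_derive_cst (0 : R) (0 : R) (1 : R)).
  by apply: (is_derive_eq H); rewrite scale0r !add0r addr0 /GRing.scale /= mulr1.
- exact: is_derive_cst.
Unshelve. all: by end_near. Qed.

Lemma jet_cst (x : R) : jet (fun _ _ => x) x 0 0 0.
Proof.
have := jet_affine x 0 0; apply: jet_ext => s t.
by rewrite !mulr0 !addr0.
Qed.

Lemma jetD h k a b c d a' b' c' d' : jet h a b c d -> jet k a' b' c' d' ->
  jet (fun s t => h s t + k s t) (a + a') (b + b') (c + c') (d + d').
Proof.
move=> [ht [hts hs htd h0 h1]] [kt [kts ks ktd k0 k1]]; exists (ht + kt); split.
- by near=> s; apply: is_deriveD; near: s.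
- exact: is_deriveD.
- exact: is_deriveD.
- by rewrite h0 k0.
- by rewrite /= -h1 -k1.
Unshelve. all: by end_near. Qed.

Lemma jetM h k a b c d a' b' c' d' : jet h a b c d -> jet k a' b' c' d' ->
  jet (fun s t => h s t * k s t) (a * a') (a * b' + b * a') (a * c' + c * a')
      (a * d' + b * c' + c * b' + d * a').
Proof.
move=> [ht [hts hs htd h0 h1]] [kt [kts ks ktd k0 k1]].
exists ((h ^~ 0) * kt + (k ^~ 0) * ht); split.
- near=> s; have H : is_derive (0 : R) (1 : R) (h s) (ht s) by near: s.
  have K : is_derive (0 : R) (1 : R) (k s) (kt s) by near: s.
  exact: is_deriveM.
- apply: (is_derive_eq (is_deriveM hs ks)).
  by rewrite /GRing.scale /= h0 k0; ring.
- apply: (is_derive_eq (is_deriveD (is_deriveM hs ktd) (is_deriveM ks htd))).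
  by rewrite /GRing.scale /= h0 k0 h1 k1; ring.
- by rewrite h0 k0.
- by rewrite -h1 -k1 -h0 -k0 !fctE; ring.
Unshelve. all: by end_near. Qed.

(** Differentiability of [f] is asked only near the value [a], which admits inverses and real powers
    at positive values. *)
Lemma jet_comp f (f1 : R -> R) (f2 : R) h (a b c d : R) :
  (\forall x \near a, is_derive x (1 : R) f (f1 x)) -> is_derive a (1 : R) f1 f2 ->
  jet h a b c d ->
  jet (fun s t => f (h s t)) (f a) (f1 a * b) (f1 a * c) (f2 * b * c + f1 a * d).
Proof.
move=> ff1 f1f2 [ht [hts hs htd h0 h1]].
have hc : {for 0, continuous (h ^~ 0)}.
  by apply: differentiable_continuous; apply/derivable1_diffP; case: hs.
exists ((f1 \o (h ^~ 0)) * ht); split.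
- have near_h : \forall s \near (0 : R), is_derive (h s 0) (1 : R) f (f1 (h s 0)).
    by move: ff1; rewrite -h0 => ff1; exact: (hc _ ff1).
  near=> s; apply: is_derive1_comp; first by near: s.
  by near: s.
- rewrite -h0; apply: is_derive1_comp => //; rewrite h0.
  exact: (nbhs_singleton ff1).
- have F : is_derive (0 : R) (1 : R) (f1 \o (h ^~ 0)) (f2 * b).
    by apply: is_derive1_comp => //; rewrite h0.
  apply: (is_derive_eq (is_deriveM F htd)).
  by rewrite /GRing.scale /= h0 h1; ring.
- by rewrite h0.
- by rewrite -h1 -h0.
Unshelve. all: by end_near. Qed.

Lemma near_gt0 (a : R) : 0 < a -> \forall x \near a, 0 < x.
Proof. by move=> a0; exact: lt_nbhsr. Qed.

Lemma jetV h (a b c d : R) : 0 < a -> jet h a b c d ->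
  jet (fun s t => (h s t)^-1) a^-1 (- a ^- 2 * b) (- a ^- 2 * c)
    (2 * a ^- 3 * b * c - a ^- 2 * d).
Proof.
move=> a0 jh; have an0 : a != 0 by rewrite gt_eqF.
have := @jet_comp (fun x => x^-1) (fun x => - (x * x)^-1) (2 * a ^- 3) h a b c d.
move=> H; apply: jet_eq (H _ _ jh) _ _ _; rewrite ?expr2 ?mulNr //.
- near=> x; apply: (is_derive_eq (is_deriveV (f := id) (t := 1) _ _)).
    by rewrite gt_eqF //; near: x; exact: near_gt0.
  by rewrite /GRing.scale /= mulr1 expr2.
- have X2 := is_deriveM (is_derive_id a (1 : R)) (is_derive_id a (1 : R)).
  have aa : (id * id : R -> R) a != 0 by rewrite mulf_neq0.
  have H2 := is_deriveV aa X2.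
  by apply: (is_derive_eq (is_deriveN H2)); rewrite !fctE /GRing.scale /=; field.
Unshelve. all: by end_near. Qed.

Lemma jet_powR h (a b c d r : R) : 0 < a -> jet h a b c d ->
  jet (fun s t => h s t `^ r) (a `^ r) (r * a `^ (r - 1) * b) (r * a `^ (r - 1) * c)
    (r * (r - 1) * a `^ (r - 2) * b * c + r * a `^ (r - 1) * d).
Proof.
move=> a0 jh.
have := @jet_comp (fun x => x `^ r) (fun x => r * x `^ (r - 1))
  (r * ((r - 1) * a `^ (r - 2))) h a b c d.
move=> H; apply: jet_eq (H _ _ jh) _ _ _ => //; last by ring.
- by near=> x; apply: is_derive1_powR; near: x; exact: near_gt0.
- have P := @is_derive1_powR _ (r - 1) a a0.
  apply: (is_derive_eq (is_deriveM (is_derive_cst r a 1) P)).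
  have -> : r - 1 - 1 = r - 2 :> R by ring.
  by rewrite /GRing.scale /=; ring.
Unshelve. all: by end_near. Qed.

Lemma jet_sum (I : Type) (s : seq I) (P : pred I) (H : I -> R -> R -> R) (a b c d : I -> R) :
  (forall i, P i -> jet (H i) (a i) (b i) (c i) (d i)) ->
  jet (fun x t => \sum_(i <- s | P i) H i x t) (\sum_(i <- s | P i) a i)
   (\sum_(i <- s | P i) b i) (\sum_(i <- s | P i) c i) (\sum_(i <- s | P i) d i).
Proof.
move=> J; elim: s => [|i s IH].
  rewrite !big_nil; have := jet_cst 0; apply: jet_ext => x t.
  by rewrite big_nil.
rewrite !big_cons; have [Pi|nPi] := boolP (P i).
  have := jetD (J i Pi) IH; apply: jet_ext => x t.
  by rewrite big_cons Pi.
have := IH; apply: jet_ext => x t.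
by rewrite big_cons (negbTE nPi).
Qed.

(** The mixed derivative collects [b_i c_j] over distinct factors, that is, the full product of sums
    minus its diagonal. It is meant for the determinant of a diagonal perturbation. *)
Lemma jet_prod1 (I : Type) (s : seq I) (P : pred I) (H : I -> R -> R -> R) (b c : I -> R) :
  (forall i, P i -> jet (H i) 1 (b i) (c i) 0) ->
  jet (fun x t => \prod_(i <- s | P i) H i x t) 1
   (\sum_(i <- s | P i) b i) (\sum_(i <- s | P i) c i)
   ((\sum_(i <- s | P i) b i) * (\sum_(i <- s | P i) c i) - \sum_(i <- s | P i) b i * c i).
Proof.
move=> J; elim: s => [|i s IH].
  rewrite !big_nil mul0r subr0; have := jet_cst 1; apply: jet_ext => x t.
  by rewrite big_nil.
rewrite !big_cons; have [Pi|nPi] := boolP (P i).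
  have := jetM (J i Pi) IH; rewrite !mul1r !mulr1 => K.
  apply: jet_eq; first (apply: jet_ext; last exact: K).
  - by move=> x t; rewrite big_cons Pi.
  - by ring.
  - by ring.
  - by ring.
have := IH; apply: jet_ext => x t.
by rewrite big_cons (negbTE nPi).
Qed.

End Jets.

(** * Scalar curvature of diagonal metrics and its second variation *)

Section ScalarCurvature.
Variables (R : realType) (n : nat).
Implicit Types x y u w : 'I_n -> 'I_n -> R.

Definition sum3 (F : 'I_n -> 'I_n -> 'I_n -> R) : R :=
  \sum_i \sum_k \sum_(j | [&& k != i, j != i & j != k]) F i k j.

Lemma sum3_mkcond F : sum3 F =
  \sum_i \sum_k \sum_j if [&& k != i, j != i & j != k] then F i k j else 0.
Proof.
by apply: eq_bigr => i _; apply: eq_bigr => k _; rewrite big_mkcond.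
Qed.

Lemma sum3C12 F : sum3 (fun i k j => F k i j) = sum3 F.
Proof.
rewrite !sum3_mkcond exchange_big; apply: eq_bigr => i _; apply: eq_bigr => k _.
by apply: eq_bigr => j _; rewrite (eq_sym i k) (andbC (j != k)).
Qed.

Lemma sum3C23 F : sum3 (fun i k j => F i j k) = sum3 F.
Proof.
rewrite !sum3_mkcond; apply: eq_bigr => i _; rewrite exchange_big.
apply: eq_bigr => k _; apply: eq_bigr => j _.
by rewrite (eq_sym k j) andbCA.
Qed.

Lemma sum3D F G : sum3 (fun i k j => F i k j + G i k j) = sum3 F + sum3 G.
Proof.
rewrite -big_split; apply: eq_bigr => i _; rewrite -big_split; apply: eq_bigr => k _.
by rewrite -big_split.
Qed.

Lemma sum3M (a : R) F : sum3 (fun i k j => a * F i k j) = a * sum3 F.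
Proof.
rewrite mulr_sumr; apply: eq_bigr => i _; rewrite mulr_sumr; apply: eq_bigr => k _.
by rewrite mulr_sumr.
Qed.

Lemma eq_sum3 F G :
  (forall i k j, k != i -> j != i -> j != k -> F i k j = G i k j) -> sum3 F = sum3 G.
Proof.
move=> e; apply: eq_bigr => i _; apply: eq_bigr => k _; apply: eq_bigr => j.
by case/and3P; exact: e.
Qed.

(** Ordered pairs count each plane [p_ij] twice, which matches its real dimension. *)
Definition sum2 (F : 'I_n -> 'I_n -> R) : R := \sum_i \sum_(k | k != i) F i k.

Lemma sum2D F G : sum2 (fun i k => F i k + G i k) = sum2 F + sum2 G.
Proof. by rewrite -big_split; apply: eq_bigr => i _; rewrite -big_split. Qed.

Lemma sum2M (a : R) F : sum2 (fun i k => a * F i k) = a * sum2 F.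
Proof. by rewrite mulr_sumr; apply: eq_bigr => i _; rewrite mulr_sumr. Qed.

Lemma eq_sum2 F G : (forall i k, k != i -> F i k = G i k) -> sum2 F = sum2 G.
Proof. by move=> e; apply: eq_bigr => i _; apply: eq_bigr => k; exact: e. Qed.

Lemma sum_pval y : (forall i j, y i j = y j i) ->
  \sum_(a < dimF n) pval y (enum_val a) = sum2 y.
Proof.
move=> ysym; rewrite (sum_dimF (fun c => pval y c)).
rewrite (@sum_pidx _ _ (fun p => y p.1.1 p.1.2)) /= /sum2 -sum_ord_ltn_sym.
by apply: eq_bigr => i _; apply: eq_bigr => j _; rewrite (ysym j i).
Qed.

Lemma mxtrace_dmx y : (forall i j, y i j = y j i) -> \tr (dmx y) = sum2 y.
Proof.
by move=> ysym; rewrite -sum_pval // /mxtrace; apply: eq_bigr => a _; rewrite dmxE eqxx mul1r.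
Qed.

Lemma det_dmx y : \det (dmx y) = \prod_(a < dimF n) pval y (enum_val a).
Proof. by rewrite det_diag; apply: eq_bigr => a _; rewrite mxE. Qed.

Definition scal y : R :=
  sum2 (fun i k => 2 * n%:R * (y i k)^-1)
  - sum3 (fun i k j => y i k * ((y i j)^-1 * (y k j)^-1)).

(** Each third index yields three quotients with signs -, -, +. After summation over ordered triples
    the three sums agree by relabelling, so exactly one negative copy remains. *)
Lemma scalar_curvature_dmx y : (forall i j, y i j = y j i) ->
  (forall i j : 'I_n, i != j -> y i j != 0) -> scalar_curvature (dmx y) = scal y.
Proof.
move=> ysym ynz; rewrite /scalar_curvature /tr_wrt ricci_dmx //.
rewrite invmx_dmx; last by move=> i j ij; apply: ynz; rewrite -val_eqE neq_ltn ij.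
rewrite mul_dmx mxtrace_dmx; last by move=> i j; rewrite ricC // ysym.
pose F i k j := y i k * ((y i j)^-1 * (y k j)^-1).
have -> : sum2 (fun i k => ric y i k * (y i k)^-1) =
    sum2 (fun i k => 2 * n%:R * (y i k)^-1) +
    sum3 (fun i k j => - F i j k + (- F k j i + F i k j)).
  have -> : sum3 (fun i k j => - F i j k + (- F k j i + F i k j)) =
     sum2 (fun i k => \sum_(j | (j != i) && (j != k)) (- F i j k + (- F k j i + F i k j))).
    apply: eq_bigr => i _; rewrite [RHS]big_mkcond; apply: eq_bigr => k _.
    by case: ifP => //= _; rewrite big_pred0.
  rewrite -sum2D; apply: eq_sum2 => i k ki.
  rewrite /ric mulrBl mulr_suml; congr (_ + _); rewrite -sumrN.
  apply: eq_bigr => j /andP[ji jk]; rewrite /F (ysym j k) (ysym j i) (ysym k i).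
  by field; rewrite !ynz // eq_sym.
rewrite (sum3D (fun i k j => - F i j k)) (sum3D (fun i k j => - F k j i)).
have N G : sum3 (fun i k j => - G i k j) = - sum3 G.
  by rewrite -mulN1r -sum3M; apply: eq_sum3 => i k j _ _ _; rewrite mulN1r.
rewrite (N (fun i k j => F i j k)) (N (fun i k j => F k j i)).
have e1 : sum3 (fun i k j => F i j k) = sum3 F by exact: sum3C23.
have e2 : sum3 (fun i k j => F k j i) = sum3 F.
  by rewrite -e1; exact: (sum3C12 (fun i k j => F i j k)).
by rewrite e1 e2 addNr addr0.
Qed.

Lemma scalZ (c : R) y : c != 0 -> scal (fun i j => c * y i j) = c^-1 * scal y.
Proof.
move=> c0; rewrite /scal mulrBr -sum2M -sum3M; congr (_ - _).
  by apply: eq_sum2 => i k _; rewrite invfM; ring.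
apply: eq_sum3 => i k j _ _ _; rewrite !invfM.
by move: (y i j)^-1 (y k j)^-1 => p q; field.
Qed.

(* The mixed second derivative of [scal] at [y] in the directions [y u], [y w]. *)
Definition scal2 y u w : R :=
  sum2 (fun i k => 4 * n%:R * (y i k)^-1 * (u i k * w i k))
  - sum3 (fun i k j => y i k * ((y i j)^-1 * (y k j)^-1) *
      (2 * u i j * w i j + 2 * u k j * w k j + u i j * w k j + u k j * w i j
       - u i k * (w i j + w k j) - w i k * (u i j + u k j))).

Lemma jet_scal y u w : (forall i j : 'I_n, i != j -> 0 < y i j) ->
  exists b c, jet (fun s t => scal (fun i j => y i j + s * (y i j * u i j) + t * (y i j * w i j)))
    (scal y) b c (scal2 y u w).
Proof.
move=> ypos.
pose Y (s t : R) i j := y i j + s * (y i j * u i j) + t * (y i j * w i j).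
have JY i j : jet (fun s t => Y s t i j) (y i j) (y i j * u i j) (y i j * w i j) 0.
  exact: jet_affine.
have JV i j : i != j -> jet (fun s t => (Y s t i j)^-1) (y i j)^-1 (- (y i j)^-1 * u i j)
     (- (y i j)^-1 * w i j) (2 * (y i j)^-1 * u i j * w i j).
  move=> ij; apply: jet_eq (jetV (ypos _ _ ij) (JY i j)) _ _ _;
  by field; rewrite gt_eqF // ypos.
have J2 : exists b c, jet (fun s t => sum2 (fun i k => 2 * n%:R * (Y s t i k)^-1))
    (sum2 (fun i k => 2 * n%:R * (y i k)^-1)) b c
    (sum2 (fun i k => 4 * n%:R * (y i k)^-1 * (u i k * w i k))).
  do 2!eexists; apply: jet_sum => i _; apply: jet_sum => k ki.
  apply: jet_eq (jetM (jet_cst (2 * n%:R)) (JV i k _)) _ _ _;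
    [by rewrite eq_sym | reflexivity | reflexivity | ring].
have J3 : exists b c, jet (fun s t => sum3 (fun i k j => - (Y s t i k * ((Y s t i j)^-1 * (Y s t k j)^-1))))
    (sum3 (fun i k j => - (y i k * ((y i j)^-1 * (y k j)^-1)))) b c
    (sum3 (fun i k j => - (y i k * ((y i j)^-1 * (y k j)^-1) *
      (2 * u i j * w i j + 2 * u k j * w k j + u i j * w k j + u k j * w i j
       - u i k * (w i j + w k j) - w i k * (u i j + u k j))))).
  do 2!eexists; apply: jet_sum => i _; apply: jet_sum => k _; apply: jet_sum => j /and3P[ki ji jk].
  have ij : i != j by rewrite eq_sym.
  have kj : k != j by rewrite eq_sym.
  have := jetM (jet_cst (-1)) (jetM (JY i k) (jetM (JV i j ij) (JV k j kj))).
  rewrite mulN1r => J; apply: jet_eq.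
  - by apply: jet_ext J => s t; rewrite mulN1r.
  - reflexivity.
  - reflexivity.
  - ring.
case: J2 => b2 [c2 J2]; case: J3 => b3 [c3 J3].
have N G : sum3 (fun i k j => - G i k j) = - sum3 G.
  by rewrite -mulN1r -sum3M; apply: eq_sum3 => i k j _ _ _; rewrite mulN1r.
exists (b2 + b3), (c2 + c3); have := jetD J2 J3.
rewrite (N (fun i k j => y i k * ((y i j)^-1 * (y k j)^-1))).
rewrite (N (fun i k j => y i k * ((y i j)^-1 * (y k j)^-1) * _)).
by apply: jet_ext => s t; rewrite (N (fun i k j => Y s t i k * ((Y s t i j)^-1 * (Y s t k j)^-1))).
Qed.

End ScalarCurvature.

(** * Volume normalization and the Hessian in traceless directions *)

Section Hessian.
Variables (R : realType) (n : nat).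
Implicit Types x y u w : 'I_n -> 'I_n -> R.
Hypothesis n_gt1 : (1 < n)%N.

Lemma dimF_gt0 : (0 < dimF n)%N.
Proof.
apply/card_gt0P.
exists (exist _ (Ordinal (ltnW n_gt1), Ordinal n_gt1, true) isT : pidx n).
by [].
Qed.

Lemma det_dmx_gt0 y : (forall i j : 'I_n, (i < j)%N -> 0 < y i j) -> 0 < \det (dmx y).
Proof.
by move=> y0; rewrite det_dmx; apply: prodr_gt0 => a _; exact/y0/pidx_ltn.
Qed.

Lemma det_diag_tensor_gt0 :
  0 < \det (diag_tensor (fun _ _ : 'I_n => (1 : R))).
Proof.
rewrite diag_tensorE; apply: det_dmx_gt0 => i j _.
by rewrite mulr1 mulr_gt0 // ltr0n // (ltnW n_gt1).
Qed.

Lemma volume_gt0 (v0 : R) y : 0 < v0 -> (forall i j : 'I_n, (i < j)%N -> 0 < y i j) ->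
  0 < volume v0 (dmx y).
Proof.
move=> v00 y0; rewrite /volume mulr_gt0 // sqrtr_gt0 divr_gt0 //.
  exact: det_dmx_gt0.
exact: det_diag_tensor_gt0.
Qed.

Lemma powR_volume (v0 : R) y r : 0 < v0 -> (forall i j : 'I_n, (i < j)%N -> 0 < y i j) ->
  volume v0 (dmx y) `^ (2 * r) =
  v0 `^ (2 * r) * ((\det (dmx y) / \det (diag_tensor (fun _ _ : 'I_n => (1 : R)))) `^ r).
Proof.
move=> v00 y0; rewrite /volume powRM ?sqrtr_ge0 ?ltW //; congr (_ * _).
rewrite -powR12_sqrt; last first.
  by rewrite ltW // divr_gt0 // ?det_dmx_gt0 // det_diag_tensor_gt0.
by rewrite -powRrM mulrA mulVf ?pnatr_eq0 // mul1r.
Qed.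

Lemma near_affine_gt0 (a p q : R) : 0 < a ->
  \forall s \near (0 : R), \forall t \near (0 : R), 0 < a + s * p + t * q.
Proof.
have H (b r : R) : 0 < b -> \forall s \near (0 : R), 0 < b + s * r.
  move=> b0; have := @jet_affine R b r 0 => -[ht [_ hs _ _ _]].
  have hc : {for 0, continuous (fun s : R => b + s * r + 0 * 0)}.
    by apply: differentiable_continuous; apply/derivable1_diffP; case: hs.
  have b0' : 0 < b + 0 * r + 0 * 0 by rewrite !mul0r !addr0.
  near=> s; have : 0 < b + s * r + 0 * 0.
    by near: s; exact: (hc _ (near_gt0 b0')).
  by rewrite mulr0 addr0.
by move=> a0; apply: (filterS _ (H a p a0)) => s; exact: H.
Unshelve. all: by end_near. Qed.

(** Scalar curvature has degree -1, so normalizing the volume multiplies it by the volume to the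
    power [2 / dim], a constant times [L] to the power [1 / dim], where [L] is the relative
    determinant. For traceless directions [L] has no first-order terms: the first derivatives of
    [scal], left existential in [jet_scal], are multiplied by zero, and the mixed derivative of [L]
    supplies the correction term. *)
Lemma hess_sc_dmx (v0 : R) y u w : 0 < v0 ->
  (forall i j, y i j = y j i) -> (forall i j : 'I_n, i != j -> 0 < y i j) ->
  (forall i j, u i j = u j i) -> (forall i j, w i j = w j i) ->
  sum2 u = 0 -> sum2 w = 0 ->
  hess_sc v0 (dmx y) (dmx (fun i j => y i j * u i j)) (dmx (fun i j => y i j * w i j)) =
  volume v0 (dmx y) `^ (2 / (dimF n)%:R) *
   (scal2 y u w - scal y / (dimF n)%:R * sum2 (fun i j => u i j * w i j)).
Proof.
move=> v00 ysym y0 usym wsym su sw.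
have lt_neq (i j : 'I_n) : (i < j)%N -> i != j.
  by move=> ij; rewrite -val_eqE neq_ltn ij.
set N := (dimF n)%:R; pose r : R := N^-1.
pose Y (s t : R) i j := y i j + s * (y i j * u i j) + t * (y i j * w i j).
pose L (s t : R) := \prod_(a < dimF n) (1 + s * pval u (enum_val a) + t * pval w (enum_val a)).
have Ysym s t i j : Y s t i j = Y s t j i by rewrite /Y (ysym i j) (usym i j) (wsym i j).
have YE s t i j : Y s t i j = y i j * (1 + s * u i j + t * w i j) by rewrite /Y; ring.
have detY s t : \det (dmx (Y s t)) = \det (dmx y) * L s t.
  by rewrite !det_dmx -big_split; apply: eq_bigr => a _; rewrite /pval YE.
pose V : R := volume v0 (dmx y) `^ (2 * r).
have [b [c J]] := jet_scal u w y0.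
have JL : jet L 1 0 0 (- sum2 (fun i j => u i j * w i j)).
  have := @jet_prod1 R _ (index_enum 'I_(dimF n)) xpredT
    (fun a s t => 1 + s * pval u (enum_val a) + t * pval w (enum_val a))
    (fun a => pval u (enum_val a)) (fun a => pval w (enum_val a)) _.
  rewrite !sum_pval // su sw mul0r sub0r => H.
  have := H (fun a _ => jet_affine _ _ _).
  rewrite -(@sum_pval _ _ (fun i j => u i j * w i j)) //.
  by move=> i j; rewrite usym wsym.
have JF := jetM (jet_cst V) (jetM (jet_powR r ltr01 JL) J).
rewrite /hess_sc; apply: jet_derive1; apply: jet_eq.
- apply: jet_near JF.
  (* Positivity of all weights at once: there are finitely many pairs, so the neighbourhoods can be
     intersected in each variable. *)
  have pos : \forall s \near (0 : R), \forall t \near (0 : R), forall p : 'I_n * 'I_n,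
     p.1 != p.2 -> 0 < Y s t p.1 p.2.
    have H p : \forall s \near (0 : R), \forall t \near (0 : R), p.1 != p.2 -> 0 < Y s t p.1 p.2.
      have [e|ne] := eqVneq p.1 p.2; first by near do near do by [].
      have P := near_affine_gt0 (y p.1 p.2 * u p.1 p.2) (y p.1 p.2 * w p.1 p.2) (y0 _ _ ne).
      by apply: (filterS _ P) => s Ps; apply: (filterS _ Ps).
    have F0 : Filter (nbhs (0 : R)) by exact: nbhs_filter.
    have H1 := @filter_forall _ ('I_n * 'I_n)%type (fun p s => \forall t \near (0 : R),
       p.1 != p.2 -> 0 < Y s t p.1 p.2) (nbhs (0 : R)) F0 H.
    apply: (filterS _ H1) => s hs.
    exact: (@filter_forall _ ('I_n * 'I_n)%type (fun p t =>
       p.1 != p.2 -> 0 < Y s t p.1 p.2) (nbhs (0 : R)) F0 hs).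
  near=> s; near=> t.
  have P : forall p : 'I_n * 'I_n, p.1 != p.2 -> 0 < Y s t p.1 p.2.
    by near: t; near: s.
  have P' i j : i != j -> 0 < Y s t i j by exact: (P (i, j)).
  have P1 (i j : 'I_n) : (i < j)%N -> 0 < Y s t i j by move=> ij; apply/P'/lt_neq.
  have Y0 i j : i != j -> Y s t i j != 0 by move=> ij; rewrite gt_eqF // P'.
  have -> : dmx y + s *: dmx (fun i j => y i j * u i j) + t *: dmx (fun i j => y i j * w i j)
     = dmx (Y s t) by rewrite !dmxZ !dmxD.
  have vol0 : 0 < volume v0 (dmx (Y s t)) by exact: volume_gt0.
  rewrite /unit_volume dmxZ.
  have cnz : volume v0 (dmx (Y s t)) `^ (- (2 / N)) != 0 by rewrite gt_eqF // powR_gt0.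
  rewrite scalar_curvature_dmx; last first.
  - by move=> i j ij; rewrite mulf_neq0 // Y0.
  - by move=> i j; rewrite Ysym.
  rewrite (scalZ _ cnz).
  rewrite powRN invrK.
  suff e : V * L s t `^ r = volume v0 (dmx (Y s t)) `^ (2 / N) by rewrite -e mulrA.
  rewrite /V !powR_volume //; last by move=> i j /lt_neq; exact: y0.
  have Dy : 0 < \det (dmx y) by apply: det_dmx_gt0 => i j /lt_neq; exact: y0.
  have D0 := det_diag_tensor_gt0.
  have L0 : 0 <= L s t.
    by have := det_dmx_gt0 P1; rewrite detY (pmulr_rgt0 _ Dy) => /ltW.
  rewrite -mulrA; congr (_ * _).
  have DD : 0 <= \det (dmx y) / \det (diag_tensor (fun _ _ : 'I_n => (1 : R))).
    exact/ltW/divr_gt0.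
  by rewrite detY mulrAC (powRM r DD L0).
- reflexivity.
- reflexivity.
- by rewrite !powR1 /V /r; ring.
Unshelve. all: by end_near. Qed.

End Hessian.

(** * Invariant tensors *)

Section Invariance.
Variables (R : realType) (n : nat).
Local Notation C := R[i].
Local Notation Re := (@complex.Re R).
Local Notation Im := (@complex.Im R).
Implicit Types (X : 'M[C]_n) (u v : 'rV[R]_(dimF n)) (c d : pidx n) (t : 'M[C]_n).

Lemma in_torus_offdiag t (i j : 'I_n) : in_torus t -> i != j -> t i j = 0.
Proof. by case=> /is_diag_mxP h _ _; exact: h. Qed.

Lemma in_torus_unitary t : in_torus t ->
  (forall k, t k k * conjc (t k k) = 1) /\ invmx t = (map_mx (@conjc R) t)^T.
Proof.
move=> ht; have [_ tt1 _] := ht; split.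
  move=> k; have := congr1 (fun M : 'M[C]_n => M k k) tt1.
  rewrite !mxE eqxx (bigD1 k) //= !mxE big1 ?addr0 => [//|j jk].
  by rewrite (in_torus_offdiag ht) ?mul0r // eq_sym.
have [ut _] := mulmx1_unit tt1.
by rewrite -[LHS]mulmx1 -tt1 mulmxA mulVmx // mul1mx.
Qed.

Lemma torus_conjE t X (i j : 'I_n) : in_torus t ->
  (t *m X *m invmx t) i j = t i i * X i j * conjc (t j j).
Proof.
move=> ht; have [_ ->] := in_torus_unitary ht.
rewrite mxE (bigD1 j) //= big1 ?addr0 => [|k kj].
  rewrite !mxE (bigD1 i) //= big1 ?addr0 // => k ki.
  by rewrite (in_torus_offdiag ht) ?mul0r // eq_sym.
by rewrite !mxE (in_torus_offdiag (i := j) (j := k) ht) 1?eq_sym // conj0 mulr0.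
Qed.

Lemma p_mx_Ad t v : in_torus t -> p_mx (Ad_p t v) = t *m p_mx v *m invmx t.
Proof.
move=> ht; rewrite /Ad_p p_coordK; last first.
  move=> i j; rewrite !torus_conjE // p_mx_skewh !conjM conjcK; ring.
rewrite offd_id // => k.
by rewrite torus_conjE // p_mx_diag mulr0 mul0r.
Qed.

Lemma dmx_invariant (y : 'I_n -> 'I_n -> R) : (forall i j, y i j = y j i) ->
  invariant_tensor (dmx y).
Proof.
move=> ysym; split; first by rewrite tr_diag_mx.
move=> t ht u v; rewrite !tens_dmxE //; congr (_ * Re _).
have [ut _] := in_torus_unitary ht.
rewrite /mxtrace; apply: eq_bigr => i _; rewrite ![LHS]mxE ![RHS]mxE; apply: eq_bigr => j _.
rewrite ![hadamard _ _ _ _]mxE !p_mx_Ad // !torus_conjE //.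
transitivity ((t i i * conjc (t i i)) * (t j j * conjc (t j j)) *
   (p_mx u i j * ((y j i)%:C * p_mx v j i))); first by ring.
by rewrite !ut !mul1r.
Qed.

(** The other basis vector of the same plane [p_ij]. *)
Definition pflip c : pidx n :=
  exist _ ((val c).1, ~~ (val c).2) (valP c).

(** The torus rotates the plane [p_ij] by the phase [z = t_i conj(t_j)]; the sign of the second
    coefficient depends on which of the two basis vectors is rotated. *)
Lemma torus_conj_pvec t c : in_torus t ->
  t *m pvec R c *m invmx t =
  let z := t (val c).1.1 (val c).1.1 * conjc (t (val c).1.2 (val c).1.2) in
  (Re z)%:C *: pvec R c + (if (val c).2 then - Im z else Im z)%:C *: pvec R (pflip c).
Proof.
move=> ht; apply/matrixP => k l; rewrite torus_conjE // /=.
set i := (val c).1.1; set j := (val c).1.2.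
set z := t i i * conjc (t j j).
have zE : z = (Re z)%:C + 'i%C * (Im z)%:C by apply: complexP; rewrite ?(Re_i, Im_i, ReD, ImD) /=; case: (z) => p q /=; ring.
have zcE : conjc z = (Re z)%:C - 'i%C * (Im z)%:C.
  by case: (z) => p q; apply: complexP; rewrite ?(Re_i, Im_i, ReD, ImD, ReN, ImN) /=; ring.
rewrite !mxE !pvecE /= -/i -/j.
have ij : i != j by exact: pidx_neq.
have i2 : 'i%C * 'i%C = -1 :> C by rewrite -expr2 sqr_i.
have i2D (p q : C) : 'i%C * (p + 'i%C * q) = 'i%C * p - q.
  by rewrite mulrDr mulrA i2 mulN1r.
have [/andP[/eqP -> /eqP ->]|h1] := boolP ((k == i) && (l == j)).
  rewrite (negbTE ij) /= !mulr0n !mulr1n.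
  case: ((val c).2) => /=.
    transitivity ('i%C * z); first by rewrite /z; ring.
    by rewrite [in LHS]zE realCN i2D; ring.
  transitivity z; first by rewrite /z; ring.
  by rewrite [in LHS]zE; ring.
have [/andP[/eqP -> /eqP ->]|h2] := boolP ((k == j) && (l == i)).
  rewrite !mulr0n !mulr1n.
  have cz : t j j * conjc (t i i) = conjc z by rewrite /z conjM conjcK mulrC.
  case: ((val c).2) => /=.
    transitivity ('i%C * conjc z); first by rewrite -cz; ring.
    by rewrite [in LHS]zcE realCN -mulrN i2D; ring.
  transitivity (- conjc z); first by rewrite -cz; ring.
  by rewrite [in LHS]zcE; ring.
by rewrite !mulr0n addr0 subr0 mulr0 !if_same; ring.
Qed.

(** The conjugate entry at [m] restores determinant 1. *)
Definition torus2 (p m : 'I_n) (a : C) : 'M[C]_n :=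
  diag_mx (\row_k (if k == p then a else if k == m then conjc a else 1)).

Lemma torus2_in (p m : 'I_n) (a : C) : p != m -> a * conjc a = 1 ->
  in_torus (torus2 p m a).
Proof.
move=> pm a1; split.
- exact: diag_mx_is_diag.
- apply/matrixP => i j; rewrite /torus2 map_diag_mx tr_diag_mx mulmx_diag !mxE.
  congr (_ *+ _); case: ifP => _ //; case: ifP => _.
    by transitivity (conjc a * conjc (conjc a)) => //; rewrite conjcK mulrC.
  by transitivity (1 * conjc 1 : C) => //; rewrite conjc1 mulr1.
- rewrite det_diag (bigD1 p) //= (bigD1 m) ?(eq_sym m) //= big1 => [|k /andP[kp km]].
    by rewrite !mxE eqxx eq_sym (negbTE pm) eqxx mulr1.
  by rewrite mxE (negbTE kp) (negbTE km).
Qed.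

Lemma torus2E (p m : 'I_n) (a : C) (k : 'I_n) :
  torus2 p m a k k = if k == p then a else if k == m then conjc a else 1.
Proof. by rewrite !mxE eqxx. Qed.

Lemma p_coord_pvec c : p_coord (pvec R c) = delta_mx 0 (enum_rank c).
Proof.
apply/rowP => a; rewrite p_coordE pentry_pvec mxE /=.
by rewrite -(inj_eq enum_val_inj) enum_rankK eq_sym.
Qed.

Lemma Ad_pvec t c : in_torus t ->
  let z := t (val c).1.1 (val c).1.1 * conjc (t (val c).1.2 (val c).1.2) in
  Ad_p t (delta_mx 0 (enum_rank c)) =
  Re z *: delta_mx 0 (enum_rank c) +
  (if (val c).2 then - Im z else Im z) *: delta_mx 0 (enum_rank (pflip c)).
Proof.
move=> ht z; rewrite /Ad_p p_mx_delta enum_rankK torus_conj_pvec //=.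
by rewrite p_coordD !p_coordZ !p_coord_pvec.
Qed.

Lemma ord_notin (s : seq 'I_n) : (size s < n)%N -> exists m, m \notin s.
Proof.
move=> sn; case: (pickP (fun m : 'I_n => m \notin s)) => [m ms|h]; first by exists m.
suff : (n <= size s)%N by rewrite leqNgt sn.
rewrite -[n in (n <= _)%N]card_ord (leq_trans _ (card_size s)) //.
by apply: subset_leq_card; apply/fintype.subsetP => m _; have /negbFE := h m.
Qed.

Hypothesis n_ge5 : (5 <= n)%N.

(** Schur's lemma made explicit by two kinds of torus elements: a sign change separates distinct
    planes, and a quarter turn makes the tensor scalar on each plane. Two pairs occupy at most four
    indices and the determinant must be balanced at a further one, which is where [5 <= n]
    enters. *)
Lemma invariant_tensorP (T : 'M[R]_(dimF n)) : invariant_tensor T ->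
  exists2 y : 'I_n -> 'I_n -> R, (forall i j, y i j = y j i) & T = dmx y.
Proof.
move=> [Tsym Tinv].
pose tau c d : R := T (enum_rank c) (enum_rank d).
have tauE c d : tens T (delta_mx 0 (enum_rank c)) (delta_mx 0 (enum_rank d)) = tau c d.
  exact: tens_delta.
have tensZ (r s : R) u v : tens T (r *: u) (s *: v) = r * s * tens T u v.
  by rewrite /tens linearZ /= -!scalemxAl -scalemxAr !mxE mulrA.
have tausym c d : tau c d = tau d c by rewrite /tau -{1}Tsym mxE.
have off c d : (val c).1 != (val d).1 -> tau c d = 0.
  wlog: c d / exists2 p, (p == (val c).1.1) || (p == (val c).1.2)
                       & (p != (val d).1.1) && (p != (val d).1.2).
    have [h1|] := boolP ([|| (val c).1.1 == (val d).1.1 | (val c).1.1 == (val d).1.2]); last first.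
      rewrite negb_or => /andP[h1 h1'] hw; apply: hw; exists (val c).1.1; first by rewrite eqxx.
      by rewrite h1.
    have [h2|] := boolP ([|| (val c).1.2 == (val d).1.1 | (val c).1.2 == (val d).1.2]); last first.
      rewrite negb_or => /andP[h2 h2'] hw; apply: hw; exists (val c).1.2; first by rewrite eqxx orbT.
      by rewrite h2.
    move=> _ /negP[]; have := pidx_ltn c; have := pidx_ltn d.
    move: h1 h2; case: ((val c).1) => i j; case: ((val d).1) => k l /=.
    case/orP=> /eqP -> /orP[] /eqP -> // kl; rewrite ?ltnn //.
    by rewrite ltnNge ltnW.
  move=> [p pc /andP[pd1 pd2]] _.
  (* Entries -1 at [p] and at an index [m] outside both pairs: this torus element
     changes the sign of the plane of [c] and fixes that of [d]. *)
  have [m] := @ord_notin [:: (val c).1.1; (val c).1.2; (val d).1.1; (val d).1.2] n_ge5.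
  rewrite !inE !negb_or => /and4P[mc1 mc2 md1 md2].
  have pm : p != m by case/orP: pc => /eqP ->; rewrite eq_sym.
  have a1 : -1 * conjc (-1) = 1 :> C by rewrite conjN conjc1 mulrNN mulr1.
  have ht := torus2_in pm a1.
  have := Tinv _ ht (delta_mx 0 (enum_rank c)) (delta_mx 0 (enum_rank d)).
  rewrite !Ad_pvec // !torus2E.
  rewrite !(eq_sym _ m) (negbTE mc1) (negbTE mc2) (negbTE md1) (negbTE md2).
  rewrite !(eq_sym _ p) (negbTE pd1) (negbTE pd2).
  have e1 : (if p == (val c).1.1 then -1 else 1) * conjc (if p == (val c).1.2 then -1 else 1) = -1 :> C.
    have := pidx_neq c; case/orP: pc => /eqP ->; rewrite eqxx.
      by move=> /negbTE ->; rewrite conjc1 mulr1.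
    by rewrite eq_sym => /negbTE ->; rewrite conjN conjc1 mul1r.
  rewrite e1 conjc1 mulr1 ReN ImN Re1 Im1 !oppr0 !if_same !scale0r !addr0.
  by rewrite tensZ tauE mulr1 => h; lra.
have rot c : tau (pflip c) (pflip c) = tau c c /\ tau c (pflip c) = 0.
  (* An entry i at one index of the pair rotates its plane by a right angle. *)
  have [m] := @ord_notin [:: (val c).1.1; (val c).1.2] (leq_trans (isT : 2 < 5)%N n_ge5).
  rewrite !inE !negb_or => /andP[mc1 mc2].
  have i1 : 'i%C * conjc 'i%C = 1 :> C by apply: complexP; rewrite ?ReM ?ImM /=; ring.
  have ht : in_torus (torus2 (val c).1.1 m 'i%C) by apply: torus2_in; rewrite // eq_sym.
  have H := Tinv _ ht.
  have z1 : torus2 (val c).1.1 m 'i%C (val c).1.1 (val c).1.1 *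
            conjc (torus2 (val c).1.1 m 'i%C (val c).1.2 (val c).1.2) = 'i%C.
    rewrite !torus2E eqxx eq_sym (negbTE (pidx_neq c)) eq_sym (negbTE mc2).
    by rewrite conjc1 mulr1.
  have A := @Ad_pvec _ c ht; have A' := @Ad_pvec _ (pflip c) ht.
  rewrite /= z1 /= scale0r add0r in A; rewrite /= z1 /= scale0r add0r in A'.
  have ff : pflip (pflip c) = c.
    by apply: val_inj; rewrite /= negbK; case: (val c) => [? ?].
  rewrite ff in A'.
  (* The quarter turn exchanges the two basis vectors with opposite signs: the two diagonal values
     agree, and the mixed value equals its own negative. *)
  have := H (delta_mx 0 (enum_rank c)) (delta_mx 0 (enum_rank c)).
  have := H (delta_mx 0 (enum_rank c)) (delta_mx 0 (enum_rank (pflip c))).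
  rewrite A A' !tensZ !tauE (tausym (pflip c) c).
  by case: ((val c).2) => /= h1 h2; split; lra.
(* For [i = j] the pair is not an element of [pidx n], so [insub] fails and the weight is 0. *)
pose y (i j : 'I_n) : R :=
  if insub (if (i < j)%N then (i, j, true) else (j, i, true)) is Some c then tau c c else 0.
exists y.
  move=> i j; rewrite /y; case: ltngtP => // ij.
  by have -> : i = j by apply: val_inj.
apply/matrixP => a b; rewrite dmxE.
pose c := enum_val a; pose d := enum_val b.
have -> : T a b = tau c d by rewrite /tau !enum_valK.
have -> : (a == b) = (c == d) by rewrite (inj_eq enum_val_inj).
have [<-|cd] := eqVneq c d; last first.
  rewrite mul0r; have [e|] := eqVneq (val c).1 (val d).1; last exact: off.
  have -> : d = pflip c; last by have [] := rot c.
  have ne : (val c).2 != (val d).2.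
    apply: contra cd => /eqP e2; apply/eqP/val_inj; move: e e2.
    by case: (val c) => ? ?; case: (val d) => ? ? /= -> ->.
  suff H : val d = ((val c).1, ~~ (val c).2) by apply: val_inj.
  move: e ne.
  case: (val c) => p b1; case: (val d) => q b2 /= ->.
  by case: b1; case: b2.
rewrite mul1r /pval /y pidx_ltn -/c.
have e : ((val c).1.1, (val c).1.2, true) = val (if (val c).2 then c else pflip c).
  by rewrite /pflip; case: (c) => [[[i j] []] h].
by rewrite e valK; case: ifP => // _; have [->] := rot c.
Qed.

(** Writing [T] relative to [y] turns the [g]-trace into a plain sum, so the condition on [u] does
    not depend on the metric. *)
Lemma TT_dmxP (y : 'I_n -> 'I_n -> R) (T : 'M[R]_(dimF n)) :
  (forall i j, y i j = y j i) -> (forall i j : 'I_n, i != j -> y i j != 0) ->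
  TT (dmx y) T <->
  exists u : 'I_n -> 'I_n -> R, [/\ forall i j, u i j = u j i, sum2 u = 0
      & T = dmx (fun i j => y i j * u i j)].
Proof.
move=> ysym y0.
have tr (u : 'I_n -> 'I_n -> R) : (forall i j, u i j = u j i) -> tr_wrt (dmx y) (dmx (fun i j => y i j * u i j)) = sum2 u.
  move=> usym; rewrite /tr_wrt invmx_dmx; last first.
    by move=> i j ij; apply: y0; rewrite -val_eqE neq_ltn ij.
  rewrite mul_dmx mxtrace_dmx => [|i j]; last by rewrite ysym usym.
  by apply: eq_sum2 => i k ki; field; rewrite y0 // eq_sym.
split=> [[invT trT]|[u [usym su ->]]]; last first.
  by split; [apply: dmx_invariant => i j; rewrite ysym usym|rewrite tr].
have [tau tsym eT] := invariant_tensorP invT.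
have eu : T = dmx (fun i j => y i j * (tau i j / y i j)).
  rewrite eT; apply: eq_dmx => i j ij.
  by rewrite mulrCA mulfV ?mulr1 // y0 // -val_eqE neq_ltn ij.
exists (fun i j => tau i j / y i j); split => //.
  by move=> i j; rewrite tsym ysym.
by rewrite -tr => [|i j]; rewrite -?eu // tsym ysym.
Qed.

End Invariance.

(** * The Hessian of the scalar curvature and its signature *)

Section Signature.
Variables (R : realType) (n : nat).
Implicit Types x y u w : 'I_n -> 'I_n -> R.

(* The Hessian of [Sc] at [x] in the directions [x u] and [x w], up to a positive factor. *)
Definition hform x u w : R :=
  scal2 x u w - scal x / (dimF n)%:R * sum2 (fun i j => u i j * w i j).

Lemma scal2Z (c : R) x u w : c != 0 -> scal2 (fun i j => c * x i j) u w = c^-1 * scal2 x u w.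
Proof.
move=> c0; rewrite /scal2 mulrBr -sum2M -sum3M; congr (_ - _).
  by apply: eq_sum2 => i k _; rewrite invfM; ring.
apply: eq_sum3 => i k j _ _ _; rewrite !invfM !mulrA; congr (_ * _).
by move: (x i j)^-1 (x k j)^-1 => p q; field.
Qed.

Lemma hformZ (c : R) x u w : c != 0 -> hform (fun i j => c * x i j) u w = c^-1 * hform x u w.
Proof. by move=> c0; rewrite /hform scal2Z // scalZ //; ring. Qed.

Lemma hformC x u w : hform x u w = hform x w u.
Proof.
rewrite /hform /scal2; congr (_ - _ - _ * _).
- by apply: eq_sum2 => i k _; ring.
- by apply: eq_sum3 => i k j _ _ _; ring.
- by apply: eq_sum2 => i k _; ring.
Qed.

Lemma hformDl x u u' w a :
  hform x (fun i j => u i j + a * u' i j) w = hform x u w + a * hform x u' w.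
Proof.
have S2 F G : sum2 (fun i k => F i k + a * G i k) = sum2 F + a * sum2 G :> R.
  by rewrite -sum2M -sum2D.
have S3 (F G : 'I_n -> 'I_n -> 'I_n -> R) :
    sum3 (fun i k j => F i k j + a * G i k j) = sum3 F + a * sum3 G.
  by rewrite -sum3M -sum3D.
rewrite /hform /scal2.
set c := scal x / _.
have -> p q r p' q' r' : p - q - c * r + a * (p' - q' - c * r')
  = (p + a * p') - (q + a * q') - c * (r + a * r') by ring.
rewrite -!S2 -S3; congr (_ - _ - _ * _).
- by apply: eq_sum2 => i k _; ring.
- by apply: eq_sum3 => i k j _ _ _; ring.
- by apply: eq_sum2 => i k _; ring.
Qed.

Lemma hformDr x u w w' a :
  hform x u (fun i j => w i j + a * w' i j) = hform x u w + a * hform x u w'.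
Proof. by rewrite hformC hformDl !(hformC x u). Qed.

Lemma hform0 x w : hform x (fun _ _ => 0) w = 0.
Proof.
have := hformDl x (fun _ _ => 0) (fun _ _ => 0) w (-1).
have -> : (fun _ _ : 'I_n => 0 + -1 * 0) = (fun _ _ => 0 : R).
  by apply/funext => i; apply/funext => j; rewrite mulr0 addr0.
by rewrite mulN1r subrr.
Qed.

Hypothesis n_ge5 : (5 <= n)%N.
Variables (v0 : R) (x : 'I_n -> 'I_n -> R).
Hypothesis v0_gt0 : 0 < v0.
Hypothesis xsym : forall i j, x i j = x j i.
Hypothesis x_gt0 : forall i j : 'I_n, i != j -> 0 < x i j.

Let n_gt1 : (1 < n)%N := leq_trans (isT : (2 <= 5)%N) n_ge5.

Lemma unit_volume_dmx :
  exists2 lam : R, 0 < lam & unit_volume v0 (dmx x) = dmx (fun i j => lam * x i j).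
Proof.
exists (volume v0 (dmx x) `^ (- (2 / (dimF n)%:R))).
  apply: powR_gt0; apply: volume_gt0 => // i j ij.
  by apply: x_gt0; rewrite -val_eqE neq_ltn ij.
by rewrite /unit_volume dmxZ.
Qed.

Variable lam : R.
Hypothesis lam_gt0 : 0 < lam.
Hypothesis g1E : unit_volume v0 (dmx x) = dmx (fun i j => lam * x i j).

Local Notation g1 := (dmx (fun i j => lam * x i j)).
Local Notation phi u := (dmx (fun i j => lam * x i j * u i j)).

Let lxsym i j : lam * x i j = lam * x j i. Proof. by rewrite xsym. Qed.

Let lx_gt0 i j : i != j -> 0 < lam * x i j.
Proof. by move=> ij; rewrite mulr_gt0 // x_gt0. Qed.

Lemma TT_unit_volumeP T : TT g1 T <->
  exists u, [/\ forall i j, u i j = u j i, sum2 u = 0 & T = phi u].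
Proof.
by apply: TT_dmxP => // i j ij; rewrite gt_eqF // lx_gt0.
Qed.

(** The form has degree -1 in the metric, so passing to unit volume changes it by a positive factor
    only and signs can be read at [x] itself. *)
Lemma hess_sc_unit_volume : exists2 kap : R, 0 < kap &
  forall u w, (forall i j, u i j = u j i) -> (forall i j, w i j = w j i) ->
  sum2 u = 0 -> sum2 w = 0 -> hess_sc v0 g1 (phi u) (phi w) = kap * hform x u w.
Proof.
exists (volume v0 g1 `^ (2 / (dimF n)%:R) * lam^-1).
  apply: mulr_gt0; last by rewrite invr_gt0.
  apply: powR_gt0; apply: volume_gt0 => // i j ij.
  by apply: lx_gt0; rewrite -val_eqE neq_ltn ij.
move=> u w usym wsym su sw.
rewrite (hess_sc_dmx n_gt1 v0_gt0 lxsym lx_gt0 usym wsym su sw).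
by rewrite -[RHS]mulrA -(hformZ _ _ _ (lt0r_neq0 lam_gt0)).
Qed.

(** * Coindex and nondegeneracy from complementary positive and negative families *)

Variables (k m : nat) (A : 'rV[R]_k -> 'I_n -> 'I_n -> R) (B : 'rV[R]_m -> 'I_n -> 'I_n -> R).
Hypothesis Alin : forall (a : R) c c' i j, A (a *: c + c') i j = a * A c i j + A c' i j.
Hypothesis Blin : forall (a : R) d d' i j, B (a *: d + d') i j = a * B d i j + B d' i j.
Hypothesis Asym : forall c i j, A c i j = A c j i.
Hypothesis Bsym : forall d i j, B d i j = B d j i.
Hypothesis Asum : forall c, sum2 (A c) = 0.
Hypothesis Bsum : forall d, sum2 (B d) = 0.
Hypothesis ABspan : forall u, (forall i j, u i j = u j i) -> sum2 u = 0 ->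
  exists c d, forall i j : 'I_n, (i < j)%N -> u i j = A c i j + B d i j.
Hypothesis Apos : forall c, c != 0 -> 0 < hform x (A c) (A c).
Hypothesis Bneg : forall d, d != 0 -> hform x (B d) (B d) < 0.

Let phiD u w : phi (fun i j => u i j + w i j) = phi u + phi w.
Proof. by rewrite dmxD; apply: eq_dmx => i j _; ring. Qed.

Let phiZ a u : phi (fun i j => a * u i j) = a *: phi u.
Proof. by rewrite dmxZ; apply: eq_dmx => i j _; ring. Qed.

Let fA c := phi (A c).
Let fB d := phi (B d).

Let fA_linear : linear fA.
Proof.
move=> a c c'; rewrite /fA -phiZ -phiD; congr dmx.
by apply/funext => i; apply/funext => j; rewrite Alin.
Qed.

Let fB_linear : linear fB.
Proof.
move=> a c c'; rewrite /fB -phiZ -phiD; congr dmx.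
by apply/funext => i; apply/funext => j; rewrite Blin.
Qed.

Let FA : {linear 'rV[R]_k -> 'M[R]_(dimF n)} :=
  HB.pack fA (GRing.isLinear.Build R _ _ _ fA fA_linear).
Let FB : {linear 'rV[R]_m -> 'M[R]_(dimF n)} :=
  HB.pack fB (GRing.isLinear.Build R _ _ _ fB fB_linear).

Let fA0 : fA 0 = 0. Proof. exact: (linear0 FA). Qed.
Let fB0 : fB 0 = 0. Proof. exact: (linear0 FB). Qed.

Let TT_A c : TT g1 (fA c).
Proof. by apply/TT_unit_volumeP; exists (A c). Qed.

Let TT_span T : TT g1 T -> exists c d, T = fA c + fB d.
Proof.
move=> /TT_unit_volumeP [u [usym su ->]]; have [c [d e]] := ABspan usym su.
by exists c, d; rewrite /fA /fB -phiD; apply: eq_dmx => i j ij; rewrite e.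
Qed.

Let hessA c : c != 0 -> 0 < hess_sc v0 g1 (fA c) (fA c).
Proof.
by move=> c0; have [kap k0 ->] := hess_sc_unit_volume; rewrite // mulr_gt0 // Apos.
Qed.

Let hessB d : d != 0 -> hess_sc v0 g1 (fB d) (fB d) < 0.
Proof.
by move=> d0; have [kap k0 ->] := hess_sc_unit_volume; rewrite // pmulr_rlt0 // Bneg.
Qed.

Lemma G_nondegenerate_split : G_nondegenerate v0 (dmx x).
Proof.
rewrite /G_nondegenerate g1E => S TS HS; have [c [d eS]] := TT_span TS.
pose u i j := A c i j + B d i j.
(* Testing [A c + B d] against [A c - B d] cancels the cross terms. *)
pose w i j := A c i j + -1 * B d i j.
have su : sum2 u = 0 by rewrite sum2D Asum Bsum addr0.
have sw : sum2 w = 0 by rewrite sum2D sum2M Asum Bsum mulr0 addr0.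
have usym i j : u i j = u j i by rewrite /u Asym Bsym.
have wsym i j : w i j = w j i by rewrite /w Asym Bsym.
have [kap k0 hk] := hess_sc_unit_volume.
have : hess_sc v0 g1 S (phi w) = 0 by apply: HS; apply/TT_unit_volumeP; exists w.
rewrite eS /fA /fB -phiD hk // => /eqP; rewrite mulf_eq0 gt_eqF //= => /eqP.
have -> : hform x u w = hform x (A c) (A c) - hform x (B d) (B d).
  have -> : u = (fun i j => A c i j + 1 * B d i j).
    by apply/funext => i; apply/funext => j; rewrite mul1r.
  by rewrite hformDl !hformDr (hformC x (B d) (A c)); ring.
have A0 : A 0 = fun _ _ => 0.
  apply/funext => i; apply/funext => j; have := Alin (-1) 0 0 i j.
  by rewrite scaler0 addr0 mulN1r addNr.
have B0 : B 0 = fun _ _ => 0.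
  apply/funext => i; apply/funext => j; have := Blin (-1) 0 0 i j.
  by rewrite scaler0 addr0 mulN1r addNr.
have [c0|c0] := eqVneq c 0; have [d0|d0] := eqVneq d 0.
- by move=> _; rewrite phiD -/(fA c) -/(fB d) c0 d0 fA0 fB0 addr0.
- by move=> /eqP; rewrite c0 A0 hform0 sub0r oppr_eq0 lt_eqF // Bneg.
- by move=> /eqP; rewrite d0 B0 hform0 subr0 gt_eqF // Apos.
- by move=> /eqP; rewrite gt_eqF // subr_gt0 (lt_trans (Bneg d0)) // Apos.
Qed.

Let limg_dim_inj p (F : {linear 'rV[R]_p -> 'M[R]_(dimF n)}) :
  (forall c, F c = 0 -> c = 0) -> \dim (limg (linfun F)) = p.
Proof.
move=> Finj; have K0 : (fullv :&: lker (linfun F) = 0)%VS.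
  apply/eqP; rewrite capfv -subv0; apply/subvP => c.
  by rewrite memv_ker lfunE /= => /eqP /Finj ->; rewrite mem0v.
by rewrite (limg_dim_eq K0) dimvf /dim /= mul1n.
Qed.

(** Together with definiteness this makes both parametrizations injective, so their images have
    dimensions [k] and [m]. *)
Let hess0 : hess_sc v0 g1 (0 : 'M[R]_(dimF n)) 0 = 0.
Proof.
have [kap _ hk] := hess_sc_unit_volume.
have s0 : sum2 (fun _ _ : 'I_n => 0) = 0 :> R.
  by apply: big1 => i _; apply: big1.
have := hk (fun _ _ => 0) (fun _ _ => 0) (fun _ _ => erefl) (fun _ _ => erefl) s0 s0.
rewrite hform0 mulr0.
have -> // : phi (fun _ _ : 'I_n => (0 : R)) = 0.
by have := phiZ 0 (fun _ _ => 0); rewrite scale0r => <-; apply: eq_dmx => i j _; rewrite !mulr0.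
Qed.

Let dimA : \dim (limg (linfun FA)) = k.
Proof.
apply: limg_dim_inj => c fc; apply/eqP; apply: contraT => c0.
have := hessA c0; have -> : fA c = 0 by exact: fc.
by rewrite hess0 ltxx.
Qed.

Let dimB : \dim (limg (linfun FB)) = m.
Proof.
apply: limg_dim_inj => d fd; apply/eqP; apply: contraT => d0.
have := hessB d0; have -> : fB d = 0 by exact: fd.
by rewrite hess0 ltxx.
Qed.

(** A positive subspace meets the [m]-dimensional negative image only in 0, and both lie in the
    tangent space, of dimension at most [k + m]; hence it has dimension at most [k]. *)
Lemma G_coindex_split : G_coindex v0 (dmx x) k.
Proof.
rewrite /G_coindex g1E; split.
  exists (limg (linfun FA)); last exact: dimA.
  split=> T /memv_imgP[c _ ->]; rewrite lfunE /=; first exact: TT_A.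
  move=> nz; apply: hessA; apply: contraNneq nz => ->.
  by rewrite fA0.
move=> V [VT Vpos].
have VB0 : (V :&: limg (linfun FB) = 0)%VS.
  apply/eqP; rewrite -subv0; apply/subvP => T; rewrite memv_cap.
  case/andP => TV /memv_imgP[d _ eT].
  rewrite lfunE /= in eT; rewrite memv0; apply: contraT => T0.
  have := Vpos T TV T0; rewrite eT.
  have d0 : d != 0 by apply: contraNneq T0 => d0; rewrite eT d0 fB0.
  by have := hessB d0 => h1 h2; have := lt_trans h1 h2; rewrite ltxx.
have := dimv_disjoint_sum VB0; rewrite dimB => e.
suff : (\dim (V + limg (linfun FB)) <= k + m)%N by rewrite e leq_add2r.
apply: (@leq_trans (\dim (limg (linfun FA) + limg (linfun FB)))).
  apply: dimvS; rewrite subv_add addvSr andbT; apply/subvP => T TV.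
  have [c [d ->]] := TT_span (VT T TV).
  by apply: memv_add; [rewrite -[fA c](lfunE FA)|rewrite -[fB d](lfunE FB)];
    exact/memv_img/memvf.
by apply: leq_trans (dimv_add_leqif _ _) _; rewrite dimA dimB.
Qed.

Lemma G_unstable_split : (0 < k)%N -> G_unstable v0 (dmx x).
Proof.
move=> k0; rewrite /G_unstable g1E; exists (fA (const_mx 1)); first exact: TT_A.
apply: hessA; apply/eqP => /rowP /(_ (Ordinal k0)); rewrite !mxE => /eqP.
by rewrite oner_eq0.
Qed.

End Signature.

(** * The family (a, a, a, a, X, Y, X, X, Y, X) on F(5) *)

Section FiveByFive.
Variable R : realType.
Implicit Types (s v : nat -> R) (f : nat -> nat -> R).

Definition lexi (i j : nat) : nat := index (minn i j, maxn i j) (lex_pairs 5).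

Definition symf v (i j : nat) : R := v (lexi i j).

Lemma lexiC i j : lexi i j = lexi j i.
Proof. by rewrite /lexi minnC maxnC. Qed.

Lemma symfC v i j : symf v i j = symf v j i.
Proof. by rewrite /symf lexiC. Qed.

Lemma lexiE :
  (lexi 0 1 = 0)%N * (lexi 0 2 = 1)%N * (lexi 0 3 = 2)%N * (lexi 0 4 = 3)%N *
  (lexi 1 2 = 4)%N * (lexi 1 3 = 5)%N * (lexi 1 4 = 6)%N * (lexi 2 3 = 7)%N *
  (lexi 2 4 = 8)%N * (lexi 3 4 = 9)%N *
  (lexi 1 0 = 0)%N * (lexi 2 0 = 1)%N * (lexi 3 0 = 2)%N * (lexi 4 0 = 3)%N *
  (lexi 2 1 = 4)%N * (lexi 3 1 = 5)%N * (lexi 4 1 = 6)%N * (lexi 3 2 = 7)%N *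
  (lexi 4 2 = 8)%N * (lexi 4 3 = 9)%N.
Proof. by vm_compute. Qed.

Lemma sum2_nat f : sum2 (fun i k : 'I_5 => f i k) =
  \sum_(0 <= i < 5) \sum_(0 <= k < 5 | k != i) f i k.
Proof. by rewrite big_mkord; apply: eq_bigr => i _; rewrite big_mkord. Qed.

Lemma sum3_nat (f : nat -> nat -> nat -> R) : sum3 (fun i k j : 'I_5 => f i k j) =
  \sum_(0 <= i < 5) \sum_(0 <= k < 5) \sum_(0 <= j < 5 | [&& k != i, j != i & j != k]) f i k j.
Proof.
rewrite big_mkord; apply: eq_bigr => i _; rewrite big_mkord; apply: eq_bigr => k _.
by rewrite big_mkord.
Qed.

Lemma sum2_symf v : sum2 (fun i k : 'I_5 => symf v i k) =
  2 * (v 0%N + v 1%N + v 2%N + v 3%N + v 4%N + v 5%N + v 6%N + v 7%N + v 8%N + v 9%N).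
Proof.
by rewrite (sum2_nat (symf v)) unlock /= /symf !lexiE; ring.
Qed.

(* Coordinates adapted to the symmetry group of the 4-cycle 1-2-3-4 on the last
   four indices: [t], [a], [b] belong to three characters ([t] to the trivial
   one) and the pairs [(p, q)] to the two-dimensional representation. *)
Definition isov (t1 t2 a1 a2 b p1 p2 q1 q2 : R) : nat -> R :=
  nth 0 [:: t1 + t2 + a1 + p1; t1 + t2 - a1 + q1; t1 + t2 + a1 - p1; t1 + t2 - a1 - q1;
    - t1 + b + p2 + q2; - 2 * t2 + a2; - t1 - b + p2 - q2; - t1 - b - p2 + q2;
    - 2 * t2 - a2; - t1 + b - p2 - q2].

Lemma sum2_isov t1 t2 a1 a2 b p1 p2 q1 q2 :
  sum2 (fun i k : 'I_5 => symf (isov t1 t2 a1 a2 b p1 p2 q1 q2) i k) = 0.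
Proof. by rewrite sum2_symf /isov /=; ring. Qed.

Lemma isov_span (u : 'I_5 -> 'I_5 -> R) : (forall i j, u i j = u j i) -> sum2 u = 0 ->
  exists t1 t2 a1 a2 b p1 p2 q1 q2, forall i j : 'I_5, (i < j)%N ->
    u i j = symf (isov t1 t2 a1 a2 b p1 p2 q1 q2) i j.
Proof.
move=> usym su.
pose f (i j : nat) := u (inord i) (inord j).
have fu (i j : 'I_5) : u i j = f i j by rewrite /f !inord_val.
have fC i j : f i j = f j i by exact: usym.
have sf : sum2 (fun i j : 'I_5 => f i j) = 0.
  by rewrite -su; apply: eq_sum2 => i k _; rewrite fu.
move: sf; rewrite sum2_nat unlock /=.
rewrite (fC 1 0)%N (fC 2 0)%N (fC 3 0)%N (fC 4 0)%N (fC 2 1)%N (fC 3 1)%N (fC 4 1)%N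
   (fC 3 2)%N (fC 4 2)%N (fC 4 3)%N => sf.
(* Signed averages over the three orbits of edges. The mean over the four edges at index 0 is not
   free: [sf] forces it to be [t1 + t2]. *)
exists (- (f 1%N 2%N + f 1%N 4%N + f 2%N 3%N + f 3%N 4%N) / 4),
  (- (f 1%N 3%N + f 2%N 4%N) / 4),
  ((f 0%N 1%N + f 0%N 3%N - f 0%N 2%N - f 0%N 4%N) / 4),
  ((f 1%N 3%N - f 2%N 4%N) / 2),
  ((f 1%N 2%N - f 1%N 4%N - f 2%N 3%N + f 3%N 4%N) / 4),
  ((f 0%N 1%N - f 0%N 3%N) / 2),
  ((f 1%N 2%N + f 1%N 4%N - f 2%N 3%N - f 3%N 4%N) / 4),
  ((f 0%N 2%N - f 0%N 4%N) / 2),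
  ((f 1%N 2%N - f 1%N 4%N + f 2%N 3%N - f 3%N 4%N) / 4).
move=> i j; rewrite fu /symf.
case: i => [[|[|[|[|[|//]]]]] hi]; case: j => [[|[|[|[|[|//]]]]] hj] //= _;
  rewrite lexiE /isov /=; lra.
Qed.

Lemma isov_lin (r : R) t1 t2 a1 a2 b p1 p2 q1 q2 t1' t2' a1' a2' b' p1' p2' q1' q2' i j :
  symf (isov (r * t1 + t1') (r * t2 + t2') (r * a1 + a1') (r * a2 + a2') (r * b + b')
     (r * p1 + p1') (r * p2 + p2') (r * q1 + q1') (r * q2 + q2')) i j =
  r * symf (isov t1 t2 a1 a2 b p1 p2 q1 q2) i j +
  symf (isov t1' t2' a1' a2' b' p1' p2' q1' q2') i j.
Proof.
rewrite /symf; move: (lexi i j) => k.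
rewrite /isov; do 10 (case: k => [|k]; first by rewrite /=; ring).
by rewrite /= !nth_nil mulr0 addr0.
Qed.

Variables (a X Y : R).
Hypotheses (a0 : 0 < a) (X0 : 0 < X) (Y0 : 0 < Y).

Definition wts : seq R := [:: a; a; a; a; X; Y; X; X; Y; X].

(* Q has eigenvalue 4n = 20 on the coordinate basis of p. *)
Definition w5 (i j : 'I_5) : R := 20 * symf (nth 0 wts) i j.

Lemma w5C i j : w5 i j = w5 j i. Proof. by rewrite /w5 symfC. Qed.

Lemma w5_gt0 i j : i != j -> 0 < w5 i j.
Proof.
move=> ij; rewrite mulr_gt0 ?ltr0n //; move: ij; rewrite /symf.
by case: i => [[|[|[|[|[|//]]]]] hi]; case: j => [[|[|[|[|[|//]]]]] hj] //= _;
  rewrite lexiE.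
Qed.

Lemma lex_tensor_w5 : lex_tensor 5 wts = dmx w5.
Proof.
rewrite /lex_tensor diag_tensorE; apply: eq_dmx => i j ij.
rewrite /w5 /symf /lexi (minn_idPl (ltnW ij)) (maxn_idPr (ltnW ij)).
by rewrite -natrM.
Qed.

(* The Einstein equations on the edges at index 0, on the edges of the 4-cycle
   and on its diagonals. *)
Hypothesis e1 : 10 - (2 * X + Y) / a = a.
Hypothesis e2 : 8 + X ^+ 2 / a ^+ 2 - 2 * Y / X = X.
Hypothesis e3 : 4 + Y ^+ 2 / a ^+ 2 + 2 * Y ^+ 2 / X ^+ 2 = Y.

Lemma ric_w5 (i k : 'I_5) : (i < k)%N -> ric w5 i k = 1 / 20 * w5 i k.
Proof.
move=> ik; rewrite /ric.
have -> : 1 / 20 * w5 i k = symf (nth 0 wts) i k by rewrite /w5; field.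
pose F j := (symf (nth 0 wts) i j ^+ 2 + symf (nth 0 wts) k j ^+ 2 - symf (nth 0 wts) i k ^+ 2)
   / (symf (nth 0 wts) i j * symf (nth 0 wts) k j).
(* The summands have degree 0, so the factor 20 cancels. *)
have -> : \sum_(j | (j != i) && (j != k)) (w5 i j ^+ 2 + w5 k j ^+ 2 - w5 i k ^+ 2) / (w5 i j * w5 k j)
  = \sum_(0 <= j < 5 | (j != i) && (j != k)) F j.
  rewrite big_mkord; apply: eq_bigr => j /andP[ji jk]; rewrite /F /w5.
  have := w5_gt0 ji; have := w5_gt0 jk; rewrite /w5 !(symfC _ j) => h1 h2.
  have h1' : symf (nth 0 wts) k j != 0.
    by apply/eqP => h; rewrite h mulr0 ltxx in h1.
  have h2' : symf (nth 0 wts) i j != 0.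
    by apply/eqP => h; rewrite h mulr0 ltxx in h2.
  by field; rewrite h1' h2'.
have an : a != 0 by rewrite gt_eqF.
have Xn : X != 0 by rewrite gt_eqF.
have Yn : Y != 0 by rewrite gt_eqF.
rewrite /F {F} unlock; move: ik.
case: i => [[|[|[|[|[|//]]]]] hi]; case: k => [[|[|[|[|[|//]]]]] hk] //= _;
  rewrite /symf !lexiE /wts /=;
  first [rewrite -[RHS]e1|rewrite -[RHS]e2|rewrite -[RHS]e3]; field; by rewrite ?an ?Xn ?Yn.
Qed.

End FiveByFive.

(** * Einstein constants, and the Hessian in adapted coordinates *)

Section Blocks.
Variable R : realType.
Variables (a X Y : R).
Hypotheses (a0 : 0 < a) (X0 : 0 < X) (Y0 : 0 < Y).
Hypothesis e1 : 10 - (2 * X + Y) / a = a.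
Hypothesis e2 : 8 + X ^+ 2 / a ^+ 2 - 2 * Y / X = X.
Hypothesis e3 : 4 + Y ^+ 2 / a ^+ 2 + 2 * Y ^+ 2 / X ^+ 2 = Y.

Local Notation w5 := (w5 a X Y).

Let w5_nz i j : i != j -> w5 i j != 0.
Proof. by move=> ij; rewrite gt_eqF // w5_gt0. Qed.

Lemma einstein_w5 : einstein (1 / 20) (dmx w5).
Proof.
rewrite /einstein ricci_dmx; [|exact: w5C|exact: w5_nz].
by rewrite dmxZ; apply: eq_dmx => i j ij; exact: ric_w5.
Qed.

(** The Ricci tensor is invariant under homothety; halving the metric therefore doubles the Einstein
    constant. *)
Lemma ricZ (n : nat) (y : 'I_n -> 'I_n -> R) (c : R) i k : c != 0 ->
  ric (fun i j => c * y i j) i k = ric y i k.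
Proof.
move=> c0; rewrite /ric; congr (_ - _); apply: eq_bigr => j _.
have -> : c * y i j * (c * y k j) = c ^+ 2 * (y i j * y k j) by ring.
have -> : (c * y i j) ^+ 2 + (c * y k j) ^+ 2 - (c * y i k) ^+ 2
        = c ^+ 2 * (y i j ^+ 2 + y k j ^+ 2 - y i k ^+ 2) by ring.
by rewrite -mulf_div divff ?mul1r // expf_neq0.
Qed.

Lemma einstein_half_w5 : einstein (1 / 10) (2^-1 *: dmx w5).
Proof.
have h0 : 2^-1 != 0 :> R by rewrite invr_eq0 pnatr_eq0.
rewrite /einstein dmxZ ricci_dmx; last first.
- by move=> i j ij; rewrite mulf_neq0 // w5_nz.
- by move=> i j; rewrite w5C.
rewrite dmxZ; apply: eq_dmx => i j ij; by rewrite ricZ // ric_w5 //; field.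
Qed.

(** The trace of the Einstein equation. *)
Lemma scal_w5 : scal w5 / (dimF 5)%:R = 1 / 20.
Proof.
have d0 : (dimF 5)%:R != 0 :> R by rewrite pnatr_eq0 -lt0n dimF_gt0.
rewrite -scalar_curvature_dmx; [|exact: w5C|exact: w5_nz].
have uw : dmx w5 \in unitmx.
  rewrite unitmxE unitfE gt_eqF // det_dmx_gt0 // => i j ij.
  by apply: w5_gt0; rewrite // -val_eqE neq_ltn ij.
rewrite /scalar_curvature /tr_wrt einstein_w5 -scalemxAl mulmxV // mxtraceZ mxtrace1.
by field.
Qed.

Let A := a^-1.
Let B := X^-1.
Let D := Y^-1.
Let E := X / a ^+ 2.
Let F := Y / a ^+ 2.
Let G := Y / X ^+ 2.

(** The triangles have sides [(a, a, X)], [(a, a, Y)] or [(X, X, Y)], so up to the factor 20 only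
    the six quantities [A], [B], [D], [E], [F], [G] occur. The copies [p] and [q] carry the same
    matrix because they are conjugate under the symmetry of the 4-cycle. *)
Lemma hform_w5 t1 t2 a1 a2 b p1 p2 q1 q2 :
  let v := symf (isov t1 t2 a1 a2 b p1 p2 q1 q2) in
  hform w5 (fun i j : 'I_5 => v i j) (fun i j : 'I_5 => v i j) =
  (8 * A - 4 / 5 + 32 / 5 * B - 4 * E - 6 / 5 * F - 12 / 5 * G) * t1 ^+ 2
  + 2 * (8 * A - 2 / 5 - 16 / 5 * E - 2 * F + 8 / 5 * G) * (t1 * t2)
  + (8 * A - 6 / 5 + 32 / 5 * D - 12 / 5 * E - 14 / 5 * F) * t2 ^+ 2
  + (8 * A - 2 / 5 - 16 / 5 * B - 4 / 5 * E - 6 / 5 * F) * a1 ^+ 2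
  + 2 * (2 / 5 * F) * (a1 * a2)
  + (8 / 5 * D - 1 / 5) * a2 ^+ 2
  + (32 / 5 * B - 2 / 5 - 16 / 5 * D - 4 / 5 * G) * b ^+ 2
  + (4 * A - 1 / 5 - 4 / 5 * B - 4 / 5 * D - 4 / 5 * E - 1 / 5 * F) * (p1 ^+ 2 + q1 ^+ 2)
  + 2 * (2 / 5 * E) * (p1 * p2 + q1 * q2)
  + (32 / 5 * B - 2 / 5 - 8 / 5 * D - 8 / 5 * G) * (p2 ^+ 2 + q2 ^+ 2).
Proof.
move=> v; rewrite /hform scal_w5 /scal2.
pose x i j := 20 * symf (nth 0 (wts a X Y)) i j.
pose F2 (i k : nat) := 4 * 5%:R * (x i k)^-1 * (v i k * v i k).
pose F3 (i k j : nat) := x i k * ((x i j)^-1 * (x k j)^-1) *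
  (2 * v i j * v i j + 2 * v k j * v k j + v i j * v k j + v k j * v i j
       - v i k * (v i j + v k j) - v i k * (v i j + v k j)).
have -> : sum2 (fun i k : 'I_5 => 4 * 5%:R * (w5 i k)^-1 * (v i k * v i k)) =
   sum2 (fun i k : 'I_5 => F2 i k) by [].
set S3 := sum3 _.
have -> : S3 = sum3 (fun i k j : 'I_5 => F3 i k j) by [].
rewrite (sum3_nat F3) (sum2_nat F2) (sum2_nat (fun i j => v i j * v i j)) unlock /= /F2 /F3 /x /v /symf !lexiE /wts /isov /=.
have kA u : 20 * a * ((20 * a)^-1 * (20 * u)^-1) = u^-1 / 20.
  rewrite mulrA mulfV; last by rewrite mulf_neq0 ?pnatr_eq0 // gt_eqF.
  by rewrite mul1r invfM mulrC.
have kX u : 20 * X * ((20 * X)^-1 * (20 * u)^-1) = u^-1 / 20.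
  rewrite mulrA mulfV; last by rewrite mulf_neq0 ?pnatr_eq0 // gt_eqF.
  by rewrite mul1r invfM mulrC.
have kA' u : 20 * a * ((20 * u)^-1 * (20 * a)^-1) = u^-1 / 20 by rewrite -kA (mulrC (20 * u)^-1).
have kX' u : 20 * X * ((20 * u)^-1 * (20 * X)^-1) = u^-1 / 20 by rewrite -kX (mulrC (20 * u)^-1).
have kE : 20 * X * ((20 * a)^-1 * (20 * a)^-1) = E / 20 by rewrite /E; field; rewrite gt_eqF.
have kF : 20 * Y * ((20 * a)^-1 * (20 * a)^-1) = F / 20 by rewrite /F; field; rewrite gt_eqF.
have kG : 20 * Y * ((20 * X)^-1 * (20 * X)^-1) = G / 20 by rewrite /G; field; rewrite gt_eqF.
rewrite !kA !kA' !kX !kX' !kE !kF !kG !invfM -/A -/B -/D.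
(* With the six quantities generalized, the identity is linear in them and quadratic in the
   coordinates; no relation among them is used. *)
clear kE kF kG; move: A B D E F G => iA iB iD iE iF iG.
by field.
Qed.

End Blocks.

(** * Coindex from inequalities on the blocks *)

Section Stability.
Variable R : realType.
Variables (v0 a X Y : R).
Hypotheses (v0_gt0 : 0 < v0) (a0 : 0 < a) (X0 : 0 < X) (Y0 : 0 < Y).
Hypothesis e1 : 10 - (2 * X + Y) / a = a.
Hypothesis e2 : 8 + X ^+ 2 / a ^+ 2 - 2 * Y / X = X.
Hypothesis e3 : 4 + Y ^+ 2 / a ^+ 2 + 2 * Y ^+ 2 / X ^+ 2 = Y.

Local Notation w5 := (w5 a X Y).
Local Notation A := (a^-1).
Local Notation B := (X^-1).
Local Notation D := (Y^-1).
Local Notation E := (X / a ^+ 2).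
Local Notation F := (Y / a ^+ 2).
Local Notation G := (Y / X ^+ 2).

(* The matrices of [hform] on the blocks of coordinates t, a, b and (p, q). *)
Definition cT11 := 8 * A - 4 / 5 + 32 / 5 * B - 4 * E - 6 / 5 * F - 12 / 5 * G.
Definition cT12 := 8 * A - 2 / 5 - 16 / 5 * E - 2 * F + 8 / 5 * G.
Definition cT22 := 8 * A - 6 / 5 + 32 / 5 * D - 12 / 5 * E - 14 / 5 * F.
Definition cA11 := 8 * A - 2 / 5 - 16 / 5 * B - 4 / 5 * E - 6 / 5 * F.
Definition cA12 := 2 / 5 * F.
Definition cA22 := 8 / 5 * D - 1 / 5.
Definition cB := 32 / 5 * B - 2 / 5 - 16 / 5 * D - 4 / 5 * G.
Definition cP11 := 4 * A - 1 / 5 - 4 / 5 * B - 4 / 5 * D - 4 / 5 * E - 1 / 5 * F.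
Definition cP12 := 2 / 5 * E.
Definition cP22 := 32 / 5 * B - 2 / 5 - 8 / 5 * D - 8 / 5 * G.

Lemma row_sqr_gt0 n (c : 'rV[R]_n) : c != 0 -> 0 < \sum_k c 0 k ^+ 2.
Proof.
move=> c0; rewrite lt_neqAle sumr_ge0 ?andbT => [|k _]; last exact: sqr_ge0.
apply: contra c0 => /eqP/esym/eqP; rewrite psumr_eq0 => [|k _]; last exact: sqr_ge0.
move/allP => h; apply/eqP/rowP => k; rewrite mxE.
by have := h k (mem_index_enum k); rewrite /= sqrf_eq0 => /eqP.
Qed.

Lemma row_sqr_inord n (c : 'rV[R]_n.+1) :
  \sum_k c 0 k ^+ 2 = \sum_(0 <= k < n.+1) c 0 (inord k) ^+ 2.
Proof. by rewrite big_mkord; apply: eq_bigr => k _; rewrite inord_val. Qed.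

Lemma quad_ge0 (p q r x y : R) : 0 < p -> q ^+ 2 <= p * r ->
  0 <= p * x ^+ 2 + 2 * q * (x * y) + r * y ^+ 2.
Proof.
move=> p0 h; rewrite -(pmulr_rge0 _ p0).
have -> : p * (p * x ^+ 2 + 2 * q * (x * y) + r * y ^+ 2) =
  (p * x + q * y) ^+ 2 + (p * r - q ^+ 2) * y ^+ 2 by ring.
by rewrite addr_ge0 ?sqr_ge0 // mulr_ge0 ?sqr_ge0 // subr_ge0.
Qed.

(** A margin: with [e] taken off the diagonal coefficients each block is still semidefinite, so the
    form exceeds [e] times the sum of squares of the parameters in absolute value. This gives strict
    definiteness without a case distinction on which parameter is nonzero. *)
Let e : R := 1 / 100.

Let w5s := w5C a X Y.
Let w5p := w5_gt0 a0 X0 Y0.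

Definition stability_type k :=
  [/\ G_nondegenerate v0 (dmx w5), G_unstable v0 (dmx w5) & G_coindex v0 (dmx w5) k].

(** The direction (1, -1) is needed for the negative part because at the first metric [cP22] is
    about -0.001, too close to 0 for the margin. *)
Lemma stability_6 :
  0 < cT11 - e -> cT12 ^+ 2 <= (cT11 - e) * (cT22 - e) ->
  0 < cA11 - e -> cA12 ^+ 2 <= (cA11 - e) * (cA22 - e) ->
  e <= cP11 + 2 * cP12 + cP22 ->
  cB <= - e -> cP11 - 2 * cP12 + cP22 <= - e ->
  stability_type 6.
Proof.
move=> hT1 hT2 hA1 hA2 hP hB hN.
have e0 : 0 < e by rewrite /e; lra.
(* In the block (p, q) the form is positive at (1, 1) and negative at (1, -1). *)
pose fA (c : 'rV[R]_6) (i j : 'I_5) := symf (isov (c 0 (inord 0)) (c 0 (inord 1))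
   (c 0 (inord 2)) (c 0 (inord 3)) 0 (c 0 (inord 4)) (c 0 (inord 4)) (c 0 (inord 5)) (c 0 (inord 5))) i j.
pose fB (d : 'rV[R]_3) (i j : 'I_5) := symf (isov 0 0 0 0 (d 0 (inord 0))
   (d 0 (inord 1)) (- d 0 (inord 1)) (d 0 (inord 2)) (- d 0 (inord 2))) i j.
have Alin (r : R) c c' i j : fA (r *: c + c') i j = r * fA c i j + fA c' i j.
  by rewrite /fA -isov_lin !mxE mulr0 addr0.
have Blin (r : R) c c' i j : fB (r *: c + c') i j = r * fB c i j + fB c' i j.
  by rewrite /fB -isov_lin !mxE mulr0 addr0 !mulrN -!opprD.
have Asym c i j : fA c i j = fA c j i by exact: symfC.
have Bsym c i j : fB c i j = fB c j i by exact: symfC.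
have Asum c : sum2 (fA c) = 0 by exact: sum2_isov.
have Bsum c : sum2 (fB c) = 0 by exact: sum2_isov.
have ABspan u : (forall i j, u i j = u j i) -> sum2 u = 0 ->
  exists c d, forall i j : 'I_5, (i < j)%N -> u i j = fA c i j + fB d i j.
  move=> usym su; have [t1 [t2 [a1 [a2 [b [p1 [p2 [q1 [q2 hu]]]]]]]]] := isov_span usym su.
  exists (\row_k [:: t1; t2; a1; a2; (p1 + p2) / 2; (q1 + q2) / 2]`_k),
     (\row_k [:: b; (p1 - p2) / 2; (q1 - q2) / 2]`_k) => i j ij.
  rewrite hu // /fA /fB !mxE !inordK //= -[X in X + _]mul1r -isov_lin.
  by congr (symf (isov _ _ _ _ _ _ _ _ _) _ _); field.
have Apos c : c != 0 -> 0 < hform w5 (fA c) (fA c).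
  move=> /row_sqr_gt0; rewrite row_sqr_inord unlock /= => c0.
  rewrite /fA (hform_w5 a0 X0 Y0 e1 e2 e3) -/cT11 -/cT12 -/cT22 -/cA11 -/cA12 -/cA22 -/cB -/cP11 -/cP12 -/cP22.
  have QT := quad_ge0 (c 0 (inord 0)) (c 0 (inord 1)) hT1 hT2.
  have QA := quad_ge0 (c 0 (inord 2)) (c 0 (inord 3)) hA1 hA2.
  have QP : 0 <= (cP11 + 2 * cP12 + cP22 - e) * (c 0 (inord 4) ^+ 2 + c 0 (inord 5) ^+ 2).
    by rewrite mulr_ge0 ?subr_ge0 // addr_ge0 ?sqr_ge0.
  have := mulr_gt0 e0 c0; move: QT QA QP.
  move: cT11 cT12 cT22 cA11 cA12 cA22 cB cP11 cP12 cP22 => *.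
  by nra.
have Bneg d : d != 0 -> hform w5 (fB d) (fB d) < 0.
  move=> /row_sqr_gt0; rewrite row_sqr_inord unlock /= => c0.
  rewrite /fB (hform_w5 a0 X0 Y0 e1 e2 e3) -/cT11 -/cT12 -/cT22 -/cA11 -/cA12 -/cA22 -/cB -/cP11 -/cP12 -/cP22.
  have QB : 0 <= (- e - cB) * (d 0 (inord 0) ^+ 2).
    by rewrite mulr_ge0 ?subr_ge0 // sqr_ge0.
  have QP : 0 <= (- e - (cP11 - 2 * cP12 + cP22)) * (d 0 (inord 1) ^+ 2 + d 0 (inord 2) ^+ 2).
    by rewrite mulr_ge0 ?subr_ge0 // addr_ge0 ?sqr_ge0.
  have := mulr_gt0 e0 c0; move: QB QP.
  move: cT11 cT12 cT22 cA11 cA12 cA22 cB cP11 cP12 cP22 => *.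
  by nra.
have [lam lam0 g1E] := unit_volume_dmx (isT : (5 <= 5)%N) v0_gt0 w5p.
split.
- exact: (G_nondegenerate_split (isT : (5 <= 5)%N) v0_gt0 w5s w5p lam0 g1E Alin Blin Asym Bsym Asum Bsum ABspan Apos Bneg).
- exact: (G_unstable_split (isT : (5 <= 5)%N) v0_gt0 w5s w5p lam0 g1E Asym Asum Apos).
- exact: (G_coindex_split (isT : (5 <= 5)%N) v0_gt0 w5s w5p lam0 g1E Alin Blin Asym Bsym Asum Bsum ABspan Apos Bneg).
Qed.

(** The block [t] is now indefinite and its two axes already have opposite signs. In the pairs
    [(p1, p2)] and [(q1, q2)] the form is positive at (1, 1) and negative at (0, 1). *)
Lemma stability_5 :
  e <= cT22 ->
  0 < cA11 - e -> cA12 ^+ 2 <= (cA11 - e) * (cA22 - e) ->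
  e <= cP11 + 2 * cP12 + cP22 ->
  cT11 <= - e -> cB <= - e -> cP22 <= - e ->
  stability_type 5.
Proof.
move=> hT hA1 hA2 hP hT1 hB hN.
have e0 : 0 < e by rewrite /e; lra.
pose fA (c : 'rV[R]_5) (i j : 'I_5) := symf (isov 0 (c 0 (inord 0))
   (c 0 (inord 1)) (c 0 (inord 2)) 0 (c 0 (inord 3)) (c 0 (inord 3)) (c 0 (inord 4)) (c 0 (inord 4))) i j.
pose fB (d : 'rV[R]_4) (i j : 'I_5) := symf (isov (d 0 (inord 0)) 0 0 0 (d 0 (inord 1))
   0 (d 0 (inord 2)) 0 (d 0 (inord 3))) i j.
have Alin (r : R) c c' i j : fA (r *: c + c') i j = r * fA c i j + fA c' i j.
  by rewrite /fA -isov_lin !mxE mulr0 addr0.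
have Blin (r : R) c c' i j : fB (r *: c + c') i j = r * fB c i j + fB c' i j.
  by rewrite /fB -isov_lin !mxE mulr0 addr0.
have Asym c i j : fA c i j = fA c j i by exact: symfC.
have Bsym c i j : fB c i j = fB c j i by exact: symfC.
have Asum c : sum2 (fA c) = 0 by exact: sum2_isov.
have Bsum c : sum2 (fB c) = 0 by exact: sum2_isov.
have ABspan u : (forall i j, u i j = u j i) -> sum2 u = 0 ->
  exists c d, forall i j : 'I_5, (i < j)%N -> u i j = fA c i j + fB d i j.
  move=> usym su; have [t1 [t2 [a1 [a2 [b [p1 [p2 [q1 [q2 hu]]]]]]]]] := isov_span usym su.
  exists (\row_k [:: t2; a1; a2; p1; q1]`_k),
     (\row_k [:: t1; b; p2 - p1; q2 - q1]`_k) => i j ij.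
  rewrite hu // /fA /fB !mxE !inordK //= -[X in X + _]mul1r -isov_lin.
  by congr (symf (isov _ _ _ _ _ _ _ _ _) _ _); ring.
have Apos c : c != 0 -> 0 < hform w5 (fA c) (fA c).
  move=> /row_sqr_gt0; rewrite row_sqr_inord unlock /= => c0.
  rewrite /fA (hform_w5 a0 X0 Y0 e1 e2 e3) -/cT11 -/cT12 -/cT22 -/cA11 -/cA12 -/cA22 -/cB -/cP11 -/cP12 -/cP22.
  have QT : 0 <= (cT22 - e) * c 0 (inord 0) ^+ 2.
    by rewrite mulr_ge0 ?subr_ge0 // sqr_ge0.
  have QA := quad_ge0 (c 0 (inord 1)) (c 0 (inord 2)) hA1 hA2.
  have QP : 0 <= (cP11 + 2 * cP12 + cP22 - e) * (c 0 (inord 3) ^+ 2 + c 0 (inord 4) ^+ 2).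
    by rewrite mulr_ge0 ?subr_ge0 // addr_ge0 ?sqr_ge0.
  have := mulr_gt0 e0 c0; move: QT QA QP.
  move: cT11 cT12 cT22 cA11 cA12 cA22 cB cP11 cP12 cP22 => *.
  by nra.
have Bneg d : d != 0 -> hform w5 (fB d) (fB d) < 0.
  move=> /row_sqr_gt0; rewrite row_sqr_inord unlock /= => c0.
  rewrite /fB (hform_w5 a0 X0 Y0 e1 e2 e3) -/cT11 -/cT12 -/cT22 -/cA11 -/cA12 -/cA22 -/cB -/cP11 -/cP12 -/cP22.
  have QT : 0 <= (- e - cT11) * (d 0 (inord 0) ^+ 2).
    by rewrite mulr_ge0 ?subr_ge0 // sqr_ge0.
  have QB : 0 <= (- e - cB) * (d 0 (inord 1) ^+ 2).
    by rewrite mulr_ge0 ?subr_ge0 // sqr_ge0.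
  have QP : 0 <= (- e - cP22) * (d 0 (inord 2) ^+ 2 + d 0 (inord 3) ^+ 2).
    by rewrite mulr_ge0 ?subr_ge0 // addr_ge0 ?sqr_ge0.
  have := mulr_gt0 e0 c0; move: QT QB QP.
  move: cT11 cT12 cT22 cA11 cA12 cA22 cB cP11 cP12 cP22 => *.
  by nra.
have [lam lam0 g1E] := unit_volume_dmx (isT : (5 <= 5)%N) v0_gt0 w5p.
split.
- exact: (G_nondegenerate_split (isT : (5 <= 5)%N) v0_gt0 w5s w5p lam0 g1E Alin Blin Asym Bsym Asum Bsum ABspan Apos Bneg).
- exact: (G_unstable_split (isT : (5 <= 5)%N) v0_gt0 w5s w5p lam0 g1E Asym Asum Apos).
- exact: (G_coindex_split (isT : (5 <= 5)%N) v0_gt0 w5s w5p lam0 g1E Alin Blin Asym Bsym Asum Bsum ABspan Apos Bneg).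
Qed.

End Stability.

(** * Enclosures of the roots *)

Section Numbers.
Variable R : realType.

Definition quartic (x : R) : R :=
  27 * x ^+ 4 - 270 * x ^+ 3 + 1008 * x ^+ 2 - 1700 * x + 1129.

Lemma Ppoly_horner x : (Ppoly R).[x] = quartic x.
Proof.
by rewrite /Ppoly /quartic !(hornerD, hornerN, hornerM, hornerC, hornerXn, hornerX).
Qed.

Lemma root_Ppoly x : root (Ppoly R) x = (quartic x == 0).
Proof. by rewrite rootE Ppoly_horner. Qed.

Lemma quartic_ivt (l u : R) : l <= u -> quartic l <= 0 <= quartic u ->
  exists2 c, l <= c <= u & quartic c = 0.
Proof.
move=> lu h; have [|c cI rc] := @poly_ivt R (Ppoly R) l u lu.
  by rewrite !Ppoly_horner.
by exists c => //; apply/eqP; rewrite -root_Ppoly.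
Qed.

Lemma quartic_ivtN (l u : R) : l <= u -> quartic u <= 0 <= quartic l ->
  exists2 c, l <= c <= u & quartic c = 0.
Proof.
move=> lu h; have [|c cI rc] := @poly_ivt R (- Ppoly R) l u lu.
  by rewrite !hornerN !Ppoly_horner oppr_le0 oppr_ge0 andbC.
by exists c => //; apply/eqP; rewrite -root_Ppoly -rootN.
Qed.

Lemma inv_bounds (l u x : R) : 0 < l -> l <= x <= u -> u^-1 <= x^-1 <= l^-1.
Proof.
move=> l0 /andP[lx xu]; have x0 : 0 < x by exact: lt_le_trans lx.
by rewrite !lef_pV2 ?posrE ?lx ?xu // (lt_le_trans x0).
Qed.

Lemma mul_bounds (l1 u1 l2 u2 x y : R) : 0 <= l1 -> 0 <= l2 ->
  l1 <= x <= u1 -> l2 <= y <= u2 -> l1 * l2 <= x * y <= u1 * u2.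
Proof.
move=> l10 l20 /andP[a b] /andP[c d].
by apply/andP; split; apply: ler_pM => //; [exact: le_trans a|exact: le_trans c].
Qed.

Lemma pow_bounds (l u x : R) : 0 <= l -> l <= x <= u ->
  l ^+ 2 <= x ^+ 2 <= u ^+ 2 /\ l ^+ 3 <= x ^+ 3 <= u ^+ 3.
Proof.
move=> l0 h; have h2 := mul_bounds l0 l0 h h.
have h3 := mul_bounds l0 (mulr_ge0 l0 l0) h h2.
by split; rewrite ?expr2 // !exprS !mulr1.
Qed.

(** Each monomial is taken at its own worst endpoint, which loses a factor of several hundred but
    leaves linear arithmetic only. *)
Lemma Xc_bounds (l u C : R) : 0 <= l -> l <= C <= u ->
  - (10 / 3) * u ^+ 3 + 250 / 9 * l ^+ 2 - 2110 / 27 * u + 2258 / 27 <= Xc C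
  <= - (10 / 3) * l ^+ 3 + 250 / 9 * u ^+ 2 - 2110 / 27 * l + 2258 / 27.
Proof.
move=> l0 h; have [/andP[h1 h2] /andP[h3 h4]] := pow_bounds l0 h.
by case/andP: h => h h'; rewrite /Xc; apply/andP; split; lra.
Qed.

Lemma Yc_bounds (l u C : R) : 0 <= l -> l <= C <= u ->
  20 / 3 * l ^+ 3 - 536 / 9 * u ^+ 2 + 4760 / 27 * l - 4516 / 27 <= Yc C
  <= 20 / 3 * u ^+ 3 - 536 / 9 * l ^+ 2 + 4760 / 27 * u - 4516 / 27.
Proof.
move=> l0 h; have [/andP[h1 h2] /andP[h3 h4]] := pow_bounds l0 h.
by case/andP: h => h h'; rewrite /Yc; apply/andP; split; lra.
Qed.

(** An identity in [C]: the cubic terms cancel in [2 Xc C + Yc C = 20 C - 4 C^2]. The equation P(C)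
    = 0 is needed only for the other two. *)
Lemma spoke_eq (C : R) : 0 < C -> 10 - (2 * Xc C + Yc C) / (2 * C) = 2 * C.
Proof. by move=> C0; rewrite /Xc /Yc; field; rewrite gt_eqF. Qed.

(* In the next two proofs the second factor is the quotient of the cleared
   equation by P; large numerals are written as products and sums of small ones
   because their notation expands to unary numbers. *)
Lemma cycle_eq (C : R) : 0 < C -> 0 < Xc C -> quartic C = 0 ->
  8 + Xc C ^+ 2 / (2 * C) ^+ 2 - 2 * Yc C / Xc C = Xc C.
Proof.
move=> C0 X0 q0.
have h : 8 * (2 * C) ^+ 2 * Xc C + Xc C ^+ 3 - 2 * Yc C * (2 * C) ^+ 2 - Xc C ^+ 2 * (2 * C) ^+ 2 = 0.
  transitivity (quartic C * ((((10 * 1000 + 197) * 1000 + 128)/(19 * 1000 + 683)) - (((13 * 1000 + 231) * 1000 + 880)/(19 * 1000 + 683)) * C + (((7 * 1000 + 427) * 1000 + 600)/(19 * 1000 + 683)) * C ^+ 2 - ((250 * 1000)/2187) * C ^+ 3 + (4600/243) * C ^+ 4 - (1000/729) * C ^+ 5)).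
    by rewrite /quartic /Xc /Yc; field.
  by rewrite q0 mul0r.
apply/eqP; rewrite -subr_eq0.
have -> : 8 + Xc C ^+ 2 / (2 * C) ^+ 2 - 2 * Yc C / Xc C - Xc C =
  (8 * (2 * C) ^+ 2 * Xc C + Xc C ^+ 3 - 2 * Yc C * (2 * C) ^+ 2 - Xc C ^+ 2 * (2 * C) ^+ 2)
   / ((2 * C) ^+ 2 * Xc C).
  by move: (Xc C) (Yc C) X0 {h} => X Y X0; field; rewrite !gt_eqF.
by rewrite h mul0r.
Qed.

Lemma diagonal_eq (C : R) : 0 < C -> 0 < Xc C -> quartic C = 0 ->
  4 + Yc C ^+ 2 / (2 * C) ^+ 2 + 2 * Yc C ^+ 2 / Xc C ^+ 2 = Yc C.
Proof.
move=> C0 X0 q0.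
have h : 4 * (2 * C) ^+ 2 * Xc C ^+ 2 + Yc C ^+ 2 * Xc C ^+ 2 + 2 * Yc C ^+ 2 * (2 * C) ^+ 2
   - Yc C * (2 * C) ^+ 2 * Xc C ^+ 2 = 0.
  transitivity (quartic C * (((((92 * 1000 + 100) * 1000 + 460) * 1000 + 96)/(531 * 1000 + 441)) - ((((25 * 1000 + 288) * 1000 + 877) * 1000 + 440)/(59 * 1000 + 49)) * C + ((((83 * 1000 + 263) * 1000 + 695) * 1000 + 808)/(177 * 1000 + 147)) * C ^+ 2 - ((((158 * 1000 + 710) * 1000 + 106) * 1000 + 240)/(531 * 1000 + 441)) * C ^+ 3 + ((((21 * 1000 + 224) * 1000 + 585) * 1000 + 600)/(177 * 1000 + 147)) * C ^+ 4 - ((((1 * 1000 + 827) * 1000 + 752) * 1000)/(59 * 1000 + 49)) * C ^+ 5 + (((98 * 1000 + 459) * 1000 + 200)/(19 * 1000 + 683)) * C ^+ 6 - (((3 * 1000 + 16) * 1000)/6561) * C ^+ 7 + ((40 * 1000)/2187) * C ^+ 8)).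
    by rewrite /quartic /Xc /Yc; field.
  by rewrite q0 mul0r.
apply/eqP; rewrite -subr_eq0.
have -> : 4 + Yc C ^+ 2 / (2 * C) ^+ 2 + 2 * Yc C ^+ 2 / Xc C ^+ 2 - Yc C =
  (4 * (2 * C) ^+ 2 * Xc C ^+ 2 + Yc C ^+ 2 * Xc C ^+ 2 + 2 * Yc C ^+ 2 * (2 * C) ^+ 2
   - Yc C * (2 * C) ^+ 2 * Xc C ^+ 2) / ((2 * C) ^+ 2 * Xc C ^+ 2).
  by move: (Xc C) (Yc C) X0 {h} => X Y X0; field; rewrite !gt_eqF.
by rewrite h mul0r.
Qed.

Lemma decimal5 (d0 d1 d2 d3 d4 : nat) : decimal R [:: d0; d1; d2; d3; d4] =
  d0%:R + d1%:R / 10 + d2%:R / 100 + d3%:R / 1000 + d4%:R / (10 * 1000).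
Proof.
by rewrite /decimal !big_ord_recl big_ord0 /=; field.
Qed.

(** Dividing P by [(x - C1) (x - C2)] leaves [27 x^2 + b x + c], whose discriminant is negative, so
    P has no further real root. The identity [key] is Lagrange interpolation at [C1] and [C2],
    multiplied by [C1 - C2] to avoid a division. *)
Lemma quartic_roots (C1 C2 : R) :
  345 / 100 <= C1 <= 346 / 100 -> 292 / 100 <= C2 <= 293 / 100 ->
  quartic C1 = 0 -> quartic C2 = 0 ->
  forall x, quartic x = 0 -> x = C1 \/ x = C2.
Proof.
move=> /andP[l1 u1] /andP[l2 u2] q1 q2 x qx.
have d : 0 < C1 - C2 by rewrite subr_gt0; lra.
pose b := 27 * (C1 + C2) - 270.
pose c := 1008 - 27 * (C1 * C2) + (C1 + C2) * b.
have key : (C1 - C2) * ((x - C1) * (x - C2) * (27 * x ^+ 2 + b * x + c)) = 0.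
  transitivity ((C1 - C2) * quartic x - (x - C2) * quartic C1 + (x - C1) * quartic C2).
    by rewrite /quartic /c /b; ring.
  by rewrite qx q1 q2 !mulr0 subr0 addr0.
have pos : 0 < 27 * x ^+ 2 + b * x + c.
  have hp : C1 * C2 <= 346 / 100 * (293 / 100) by apply: ler_pM => //; lra.
  have hb1 : - (981 / 10) <= b by rewrite /b; lra.
  have hb2 : b <= 0 by rewrite /b; lra.
  have hs : (C1 + C2) * - b <= 639 / 100 * (981 / 10) by apply: ler_pM; lra.
  have hc : 107 <= c by rewrite /c; lra.
  have hbb : b ^+ 2 <= (981 / 10) ^+ 2 by rewrite -sqrrN !expr2; apply: ler_pM; lra.
  have -> : 27 * x ^+ 2 + b * x + c = ((54 * x + b) ^+ 2 + (108 * c - b ^+ 2)) / 108 by field.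
  by rewrite divr_gt0 // ltr_wpDl ?sqr_ge0 //; lra.
move/eqP: key; rewrite !mulf_eq0 (gt_eqF d) (gt_eqF pos) orbF /= !subr_eq0.
by case/orP => /eqP; [left|right].
Qed.

(** The width of 10^-8 leaves room for the loss in [Xc_bounds] and [Yc_bounds] when four decimals of
    X and Y are certified. *)
Lemma root1_bounds : exists2 C : R,
  ((345 * 1000 + 762) * 1000 + 143) / 10 ^+ 8 <= C <= ((345 * 1000 + 762) * 1000 + 144) / 10 ^+ 8
  & quartic C = 0.
Proof. by apply: quartic_ivt; rewrite /quartic; lra. Qed.

Lemma root2_bounds : exists2 C : R,
  ((292 * 1000 + 929) * 1000 + 132) / 10 ^+ 8 <= C <= ((292 * 1000 + 929) * 1000 + 133) / 10 ^+ 8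
  & quartic C = 0.
Proof. by apply: quartic_ivtN; rewrite /quartic; lra. Qed.

Lemma approx4P (l u x : R) (d0 d1 d2 d3 d4 : nat) : l <= x <= u ->
  d0%:R + d1%:R / 10 + d2%:R / 100 + d3%:R / 1000 + d4%:R / (10 * 1000) - 1 / (20 * 1000) <= l ->
  u <= d0%:R + d1%:R / 10 + d2%:R / 100 + d3%:R / 1000 + d4%:R / (10 * 1000) + 1 / (20 * 1000) ->
  approx4 x [:: d0; d1; d2; d3; d4].
Proof.
move=> /andP[lx xu] hl hu; rewrite /approx4 decimal5 ler_distl.
have -> : 1 / (2 * 10 ^+ 4) = 1 / (20 * 1000) :> R by field.
by rewrite (le_trans hl lx) (le_trans xu hu).
Qed.

Lemma double_bounds (l u x : R) : l <= x <= u -> 2 * l <= 2 * x <= 2 * u.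
Proof. by rewrite !ler_pM2l. Qed.

Lemma root1_approx (C : R) :
  ((345 * 1000 + 762) * 1000 + 143) / 10 ^+ 8 <= C <= ((345 * 1000 + 762) * 1000 + 144) / 10 ^+ 8 ->
  [/\ approx4 (2 * C) [:: 6; 9; 1; 5; 2], approx4 (Xc C) [:: 7; 7; 2; 2; 4]
    & approx4 (Yc C) [:: 5; 8; 8; 7; 0]].
Proof.
move=> h; have l0 : 0 <= ((345 * 1000 + 762) * 1000 + 143) / 10 ^+ 8 :> R by lra.
split; [apply: approx4P (double_bounds h) _ _|apply: approx4P (Xc_bounds l0 h) _ _
  |apply: approx4P (Yc_bounds l0 h) _ _]; clear; lra.
Qed.

Lemma root2_approx (C : R) :
  ((292 * 1000 + 929) * 1000 + 132) / 10 ^+ 8 <= C <= ((292 * 1000 + 929) * 1000 + 133) / 10 ^+ 8 ->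
  [/\ approx4 (2 * C) [:: 5; 8; 5; 8; 6], approx4 (Xc C) [:: 9; 2; 8; 0; 0]
    & approx4 (Yc C) [:: 5; 7; 0; 2; 8]].
Proof.
move=> h; have l0 : 0 <= ((292 * 1000 + 929) * 1000 + 132) / 10 ^+ 8 :> R by lra.
split; [apply: approx4P (double_bounds h) _ _|apply: approx4P (Xc_bounds l0 h) _ _
  |apply: approx4P (Yc_bounds l0 h) _ _]; clear; lra.
Qed.

End Numbers.

(** * Signs of the blocks at the two metrics *)

Section Signatures.
Variable R : realType.

Lemma ratio_bounds (l u p q x y : R) : 0 < l -> 0 < p -> l <= x <= u -> p <= y <= q ->
  p / u ^+ 2 <= y / x ^+ 2 <= q / l ^+ 2.
Proof.
move=> l0 p0 hx hy; have [h2 _] := pow_bounds (ltW l0) hx.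
apply: mul_bounds => //; [exact: ltW|rewrite invr_ge0 sqr_ge0 //|].
by apply: inv_bounds => //; rewrite exprn_gt0.
Qed.

(** The determinant condition on a 2 by 2 block, from an upper bound on the off-diagonal entry and
    lower bounds on the diagonal ones. *)
Lemma sqr_le_mul (q u l1 l2 p r : R) : 0 <= q -> q <= u -> 0 <= l1 -> 0 <= l2 ->
  l1 <= p -> l2 <= r -> u ^+ 2 <= l1 * l2 -> q ^+ 2 <= p * r.
Proof.
move=> q0 qu l10 l20 h1 h2 h; apply: (le_trans _ (ler_pM l10 l20 h1 h2)).
by apply: le_trans h; rewrite !expr2 ler_pM.
Qed.

(** The side conditions are cross-multiplied, so they involve numerals only. *)
Lemma inv_le_bounds (l u p q x : R) : 0 < l -> l <= x <= u ->
  p * u <= 1 -> 1 <= q * l -> p <= x^-1 <= q.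
Proof.
move=> l0 h hp hq; have x0 : 0 < x by case/andP: h => /(lt_le_trans l0).
have u0 : 0 < u by case/andP: h => _ /(lt_le_trans x0).
have /andP[h1 h2] := inv_bounds l0 h; apply/andP; split.
  by apply: le_trans h1; rewrite -[leRHS]div1r ler_pdivlMr.
by apply: le_trans h2 _; rewrite -[leLHS]div1r ler_pdivrMr.
Qed.

Lemma ratio_le_bounds (l u p q r s x y : R) : 0 < l -> 0 < p -> l <= x <= u -> p <= y <= q ->
  r * u ^+ 2 <= p -> q <= s * l ^+ 2 -> r <= y / x ^+ 2 <= s.
Proof.
move=> l0 p0 h hy hr hs; have x0 : 0 < x by case/andP: h => /(lt_le_trans l0).
have u0 : 0 < u by case/andP: h => _ /(lt_le_trans x0).
have /andP[h1 h2] := ratio_bounds l0 p0 h hy; apply/andP; split.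
  by apply: le_trans h1; rewrite ler_pdivlMr ?exprn_gt0.
by apply: le_trans h2 _; rewrite ler_pdivrMr ?exprn_gt0.
Qed.

Lemma stability1 (v0 a X Y : R) : 0 < v0 ->
  10 - (2 * X + Y) / a = a -> 8 + X ^+ 2 / a ^+ 2 - 2 * Y / X = X ->
  4 + Y ^+ 2 / a ^+ 2 + 2 * Y ^+ 2 / X ^+ 2 = Y ->
  (6 + (91 + 5 / 10) / 100) <= a <= (6 + (91 + 6 / 10) / 100) -> (7 + (72 + 2 / 10) / 100) <= X <= (7 + (72 + 3 / 10) / 100) ->
  (5 + (88 + 6 / 10) / 100) <= Y <= (5 + (88 + 8 / 10) / 100) -> stability_type v0 a X Y 6.
Proof.
move=> v00 e1 e2 e3 ha hX hY.
have la0 : 0 < (6 + (91 + 5 / 10) / 100) :> R by clear; lra.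
have lX0 : 0 < (7 + (72 + 2 / 10) / 100) :> R by clear; lra.
have lY0 : 0 < (5 + (88 + 6 / 10) / 100) :> R by clear; lra.
have a0 : 0 < a by case/andP: ha => /(lt_le_trans la0).
have X0 : 0 < X by case/andP: hX => /(lt_le_trans lX0).
have Y0 : 0 < Y by case/andP: hY => /(lt_le_trans lY0).
have /andP[A1 A2] : (14 + 45 / 100) / 100 <= a^-1 <= (14 + 47 / 100) / 100.
  by apply: (inv_le_bounds la0 ha); clear; lra.
have /andP[B1 B2] : (12 + 94 / 100) / 100 <= X^-1 <= (12 + 96 / 100) / 100.
  by apply: (inv_le_bounds lX0 hX); clear; lra.
have /andP[D1 D2] : (16 + 98 / 100) / 100 <= Y^-1 <= (16 + 99 / 100) / 100.
  by apply: (inv_le_bounds lY0 hY); clear; lra.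
have /andP[E1 E2] : (16 + 14 / 100) / 100 <= X / a ^+ 2 <= (16 + 16 / 100) / 100.
  by apply: (ratio_le_bounds la0 lX0 ha hX); clear; lra.
have /andP[F1 F2] : (12 + 30 / 100) / 100 <= Y / a ^+ 2 <= (12 + 32 / 100) / 100.
  by apply: (ratio_le_bounds la0 lY0 ha hY); clear; lra.
have /andP[G1 G2] : (9 + 86 / 100) / 100 <= Y / X ^+ 2 <= (9 + 88 / 100) / 100.
  by apply: (ratio_le_bounds lX0 lY0 hX hY); clear; lra.
apply: stability_6 => //; rewrite /cT11 /cT12 /cT22 /cA11 /cA12 /cA22 /cB /cP11 /cP12 /cP22.
- move: A1 B1 E2 F2 G2; clear; lra.
(* Numerically the block [t] is about (0.155, 0.152; 0.152, 0.312); [l1] and [l2] also absorb the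
   margin [e]. *)
- apply: (sqr_le_mul (u := 16 / 100) (l1 := 14 / 100) (l2 := 29 / 100)).
  + move: A1 E2 F2 G1; clear; lra.
  + move: A2 E1 F1 G2; clear; lra.
  + clear; lra.
  + clear; lra.
  + move: A1 B1 E2 F2 G2; clear; lra.
  + move: A1 D1 E2 F2; clear; lra.
  + clear; lra.
- move: A1 B2 E2 F2; clear; lra.
- apply: (sqr_le_mul (u := 5 / 100) (l1 := 5 / 100) (l2 := 6 / 100)).
  + move: F1; clear; lra.
  + move: F2; clear; lra.
  + clear; lra.
  + clear; lra.
  + move: A1 B2 E2 F2; clear; lra.
  + move: D1; clear; lra.
  + clear; lra.
- move: A1 B1 D2 F2 G2; clear; lra.
- move: B2 D1 G1; clear; lra.
- move: A2 B2 D1 E1 F1 G1; clear; lra.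
Qed.

Lemma stability2 (v0 a X Y : R) : 0 < v0 ->
  10 - (2 * X + Y) / a = a -> 8 + X ^+ 2 / a ^+ 2 - 2 * Y / X = X ->
  4 + Y ^+ 2 / a ^+ 2 + 2 * Y ^+ 2 / X ^+ 2 = Y ->
  (5 + (85 + 8 / 10) / 100) <= a <= (5 + (85 + 9 / 10) / 100) -> (9 + (27 + 9 / 10) / 100) <= X <= (9 + (28 + 1 / 10) / 100) ->
  (5 + (70 + 2 / 10) / 100) <= Y <= (5 + (70 + 3 / 10) / 100) -> stability_type v0 a X Y 5.
Proof.
move=> v00 e1 e2 e3 ha hX hY.
have la0 : 0 < (5 + (85 + 8 / 10) / 100) :> R by clear; lra.
have lX0 : 0 < (9 + (27 + 9 / 10) / 100) :> R by clear; lra.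
have lY0 : 0 < (5 + (70 + 2 / 10) / 100) :> R by clear; lra.
have a0 : 0 < a by case/andP: ha => /(lt_le_trans la0).
have X0 : 0 < X by case/andP: hX => /(lt_le_trans lX0).
have Y0 : 0 < Y by case/andP: hY => /(lt_le_trans lY0).
have /andP[A1 A2] : (17 + 6 / 100) / 100 <= a^-1 <= (17 + 8 / 100) / 100.
  by apply: (inv_le_bounds la0 ha); clear; lra.
have /andP[B1 B2] : (10 + 77 / 100) / 100 <= X^-1 <= (10 + 78 / 100) / 100.
  by apply: (inv_le_bounds lX0 hX); clear; lra.
have /andP[D1 D2] : (17 + 53 / 100) / 100 <= Y^-1 <= (17 + 54 / 100) / 100.
  by apply: (inv_le_bounds lY0 hY); clear; lra.
have /andP[E1 E2] : (27 + 3 / 100) / 100 <= X / a ^+ 2 <= (27 + 5 / 100) / 100.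
  by apply: (ratio_le_bounds la0 lX0 ha hX); clear; lra.
have /andP[F1 F2] : (16 + 61 / 100) / 100 <= Y / a ^+ 2 <= (16 + 62 / 100) / 100.
  by apply: (ratio_le_bounds la0 lY0 ha hY); clear; lra.
have /andP[G1 G2] : (6 + 61 / 100) / 100 <= Y / X ^+ 2 <= (6 + 63 / 100) / 100.
  by apply: (ratio_le_bounds lX0 lY0 hX hY); clear; lra.
apply: stability_5 => //; rewrite /cT11 /cT12 /cT22 /cA11 /cA12 /cA22 /cB /cP11 /cP12 /cP22.
- move: A1 D1 E2 F2; clear; lra.
- move: A1 B2 E2 F2; clear; lra.
- apply: (sqr_le_mul (u := 7 / 100) (l1 := 18 / 100) (l2 := 6 / 100)).
  + move: F1; clear; lra.
  + move: F2; clear; lra.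
  + clear; lra.
  + clear; lra.
  + move: A1 B2 E2 F2; clear; lra.
  + move: D1; clear; lra.
  + clear; lra.
- move: A1 B1 D2 F2 G2; clear; lra.
- move: A2 B2 E1 F1 G1; clear; lra.
- move: B2 D1 G1; clear; lra.
- move: B2 D1 G1; clear; lra.
Qed.

End Signatures.

(** * Positivity of the metrics and their Einstein equations *)

Section Metrics.
Variable R : realType.

Lemma dmx_gt0 n (y : 'I_n -> 'I_n -> R) (v : 'rV[R]_(dimF n)) :
  (forall i j : 'I_n, (i < j)%N -> 0 < y i j) -> v != 0 -> 0 < tens (dmx y) v v.
Proof.
move=> y0 v0; have [a va] : exists a, v 0 a != 0.
  apply/existsP; apply: contraR v0; rewrite negb_exists => /forallP h.
  by apply/eqP/rowP => a; rewrite mxE; apply/eqP; have := h a; rewrite negbK.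
have p0 (b : 'I_(dimF n)) : 0 < pval y (enum_val b) by apply: y0; exact: pidx_ltn.
rewrite tens_dmx (bigD1 a) //= ltr_wpDr //.
  by apply: sumr_ge0 => b _; rewrite mulrCA -expr2 mulr_ge0 ?sqr_ge0 // ltW.
by rewrite mulrCA -expr2 mulr_gt0 // lt_def sqr_ge0 sqrf_eq0 va.
Qed.

Lemma gC_w5 (C : R) : gC C = dmx (w5 (2 * C) (Xc C) (Yc C)).
Proof. exact: lex_tensor_w5. Qed.

Lemma gC_einstein (C : R) : 0 < C -> 0 < Xc C -> 0 < Yc C -> quartic C = 0 ->
  [/\ invariant_metric (gC C), einstein (1 / 20) (gC C)
    & einstein (1 / 10) (2^-1 *: gC C)].
Proof.
move=> C0 X0 Y0 q0; have a0 : 0 < 2 * C by rewrite mulr_gt0.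
have e1 := spoke_eq C0; have e2 := cycle_eq C0 X0 q0; have e3 := diagonal_eq C0 X0 q0.
rewrite gC_w5; split.
- split; first by apply: dmx_invariant => i j; exact: w5C.
  by move=> v; apply: dmx_gt0 => i j ij; apply: w5_gt0; rewrite // -val_eqE neq_ltn ij.
- exact: einstein_w5.
- exact: einstein_half_w5.
Qed.

Lemma widen (l u p q x : R) : l <= x <= u -> p <= l -> u <= q -> p <= x <= q.
Proof. by move=> /andP[h1 h2] hl hu; rewrite (le_trans hl h1) (le_trans h2 hu). Qed.

Lemma root1_coarse (C : R) :
  ((345 * 1000 + 762) * 1000 + 143) / 10 ^+ 8 <= C <= ((345 * 1000 + 762) * 1000 + 144) / 10 ^+ 8 ->
  [/\ 345 / 100 <= C <= 346 / 100,
      (6 + (91 + 5 / 10) / 100) <= 2 * C <= (6 + (91 + 6 / 10) / 100),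
      (7 + (72 + 2 / 10) / 100) <= Xc C <= (7 + (72 + 3 / 10) / 100)
    & (5 + (88 + 6 / 10) / 100) <= Yc C <= (5 + (88 + 8 / 10) / 100)].
Proof.
move=> h; have l0 : 0 <= ((345 * 1000 + 762) * 1000 + 143) / 10 ^+ 8 :> R by lra.
split; [apply: widen h _ _|apply: widen (double_bounds h) _ _
  |apply: widen (Xc_bounds l0 h) _ _|apply: widen (Yc_bounds l0 h) _ _]; clear; lra.
Qed.

Lemma root2_coarse (C : R) :
  ((292 * 1000 + 929) * 1000 + 132) / 10 ^+ 8 <= C <= ((292 * 1000 + 929) * 1000 + 133) / 10 ^+ 8 ->
  [/\ 292 / 100 <= C <= 293 / 100,
      (5 + (85 + 8 / 10) / 100) <= 2 * C <= (5 + (85 + 9 / 10) / 100),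
      (9 + (27 + 9 / 10) / 100) <= Xc C <= (9 + (28 + 1 / 10) / 100)
    & (5 + (70 + 2 / 10) / 100) <= Yc C <= (5 + (70 + 3 / 10) / 100)].
Proof.
move=> h; have l0 : 0 <= ((292 * 1000 + 929) * 1000 + 132) / 10 ^+ 8 :> R by lra.
split; [apply: widen h _ _|apply: widen (double_bounds h) _ _
  |apply: widen (Xc_bounds l0 h) _ _|apply: widen (Yc_bounds l0 h) _ _]; clear; lra.
Qed.

Lemma bounds_gt0 (l u x : R) : l <= x <= u -> 0 < l -> 0 < x.
Proof. by move=> /andP[h _] /lt_le_trans; apply. Qed.

End Metrics.

Unset Implicit Arguments.
Set Strict Implicit.
Set Printing Implicit Defensive.
Local Close Scope complex_scope.

(* Here v0 stands for the volume of F(5) for the metric induced by Q.  With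
   Q = -B the tuples g1, g2 have Einstein constant 1/20; the constant 1/10 is
   that of the same tuples taken with respect to Q/2, i.e. of g1/2, g2/2. *)
Theorem proposition8p5 (R : realType) (v0 : R) (v0_gt0 : 0 < v0) :
  exists C1 C2 : R,
    [/\ 0 < C2 < C1,
        forall x : R, 0 < x -> (root (Ppoly R) x <-> x = C1 \/ x = C2),
        [/\ approx4 (2 * C1) [:: 6; 9; 1; 5; 2],
            approx4 (Xc C1) [:: 7; 7; 2; 2; 4]
          & approx4 (Yc C1) [:: 5; 8; 8; 7; 0]],
        [/\ approx4 (2 * C2) [:: 5; 8; 5; 8; 6],
            approx4 (Xc C2) [:: 9; 2; 8; 0; 0]
          & approx4 (Yc C2) [:: 5; 7; 0; 2; 8]]
      & [/\ invariant_metric (gC C1) /\ invariant_metric (gC C2),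
            einstein (1 / 20) (gC C1) /\ einstein (1 / 20) (gC C2),
            einstein (1 / 10) (2^-1 *: gC C1) /\ einstein (1 / 10) (2^-1 *: gC C2),
            [/\ G_nondegenerate v0 (gC C1), G_unstable v0 (gC C1)
              & G_coindex v0 (gC C1) 6]
          & [/\ G_nondegenerate v0 (gC C2), G_unstable v0 (gC C2)
              & G_coindex v0 (gC C2) 5]]].
Proof.
have [C1 h1 q1] := root1_bounds R; have [C2 h2 q2] := root2_bounds R.
have [c1 a1 x1 y1] := root1_coarse h1; have [c2 a2 x2 y2] := root2_coarse h2.
have C10 : 0 < C1 by apply: (bounds_gt0 c1); clear; lra.
have C20 : 0 < C2 by apply: (bounds_gt0 c2); clear; lra.
have X10 : 0 < Xc C1 by apply: (bounds_gt0 x1); clear; lra.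
have X20 : 0 < Xc C2 by apply: (bounds_gt0 x2); clear; lra.
have Y10 : 0 < Yc C1 by apply: (bounds_gt0 y1); clear; lra.
have Y20 : 0 < Yc C2 by apply: (bounds_gt0 y2); clear; lra.
have [i1 e1 f1] := gC_einstein C10 X10 Y10 q1.
have [i2 e2 f2] := gC_einstein C20 X20 Y20 q2.
exists C1, C2; split.
- by rewrite C20 /=; case/andP: c1 => lc _; case/andP: c2 => _ uc; move: lc uc; clear; lra.
- move=> x _; rewrite root_Ppoly; split=> [/eqP qx|]; first exact: quartic_roots c1 c2 q1 q2 x qx.
  by case=> ->; apply/eqP.
- exact: root1_approx.
- exact: root2_approx.
split => //; rewrite gC_w5.
- exact: (stability1 v0_gt0 (spoke_eq C10) (cycle_eq C10 X10 q1) (diagonal_eq C10 X10 q1)).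
- exact: (stability2 v0_gt0 (spoke_eq C20) (cycle_eq C20 X20 q2) (diagonal_eq C20 X20 q2)).
Qed.
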